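(* There are no compact constant mean curvature surfaces in $\mathrm{Sol}_3$, with shape operator $A$ and (constant) mean curvature $f=\frac12\operatorname{trace}A$, such that $$ 2f^2+2\leq |A|^2\leq 4f^2-2 $$ at every point of the surface.
   Context: $\mathrm{Sol}_3$ is $\mathbb{R}^3$ with coordinates $(x,y,z)$ and the Riemannian metric $\langle\cdot,\cdot\rangle=e^{2z}dx^2+e^{-2z}dy^2+dz^2$; $\bar\nabla$ is its Levi-Civita connection. A surface in $\mathrm{Sol}_3$ means a smooth isometric immersion $\phi:\Sigma^2\to\mathrm{Sol}_3$ of a connected Riemannian surface without boundary, equipped with a unit normal vector field $\xi$. The shape operator $A$ is defined by $AX=-\bar\nabla_X\xi$ for $X$ tangent; $f=\frac12\operatorname{trace}A$ is the mean curvature function and $|A|^2=\operatorname{trace}(A^2)$. The surface is a constant mean curvature (CMC) surface if $f$ is constant. *)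

(* Defs.v *)
From HB Require Import structures.
From mathcomp Require Import all_boot all_order all_algebra.
From mathcomp Require Import all_classical all_reals all_analysis.
From mathcomp Require Import ring.

Set Implicit Arguments.
Unset Strict Implicit.
Unset Printing Implicit Defensive.

Import Order.TTheory GRing.Theory Num.Theory.
Import numFieldNormedType.Exports.

Local Open Scope classical_set_scope.
Local Open Scope ring_scope.

Definition partial (R : realType) (m : nat) (W : normedModType R) (i : 'I_m)
  (f : 'rV[R]_m -> W) : 'rV[R]_m -> W := 'D_(delta_mx 0 i) f.

(* C^oo on the open set U: every iterated partial derivative of f is (Frechet)
   differentiable at every point of U, hence in particular continuous there. *)
Definition smooth_on (R : realType) (m : nat) (W : normedModType R)
  (U : set 'rV[R]_m) (f : 'rV[R]_m -> W) : Prop :=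
  forall (l : seq 'I_m) (x : 'rV[R]_m), U x ->
    differentiable (foldr (@partial R m W) f l) x.

Record chart (R : realType) (T : topologicalType) := Chart {
  chart_dom : set T ;
  chart_map :> T -> 'rV[R]_2 ;
  chart_inv : 'rV[R]_2 -> T ;
  chart_dom_open : open chart_dom ;
  chart_codom_open : open (chart_map @` chart_dom) ;
  chart_mapK : {in chart_dom, cancel chart_map chart_inv} ;
  chart_map_continuous : {within chart_dom, continuous chart_map} ;
  chart_inv_continuous :
    {within chart_map @` chart_dom, continuous chart_inv} }.

Definition chart_codom (R : realType) (T : topologicalType) (c : chart R T) :
  set 'rV[R]_2 := c @` chart_dom c.

(* The requirement of nonemptiness matters: the empty space is compact and
   connected in the sense of the library. *)
Record surface (R : realType) := Surface {
  surface_space :> topologicalType ;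
  atlas : set (chart R surface_space) ;
  surface_nonempty : [set: surface_space] !=set0 ;
  surface_connected : connected [set: surface_space] ;
  surface_hausdorff : hausdorff_space surface_space ;
  surface_second_countable : @second_countable surface_space ;
  atlas_cover : forall p : surface_space,
    exists2 c, atlas c & chart_dom c p ;
  atlas_compatible : forall c d : chart R surface_space,
    atlas c -> atlas d ->
    smooth_on (c @` (chart_dom c `&` chart_dom d)) (d \o chart_inv c) }.

Definition smooth_map (R : realType) (S : surface R) (n : nat)
  (F : S -> 'rV[R]_n) : Prop :=
  forall c : chart R S, atlas c -> smooth_on (chart_codom c) (F \o chart_inv c).

(* Matrix of dF_p : T_pS -> R^n with respect to the coordinate frame of c.
   Tangent vectors are rows: the i-th row is d(F o c^-1)/du_i at c(p), and
   X in T_pS with coordinate row v is sent to v *m chart_diff F c p. *)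
Definition chart_diff (R : realType) (S : surface R) (n : nat)
  (F : S -> 'rV[R]_n) (c : chart R S) (p : S) : 'M[R]_(2, n) :=
  'J (F \o chart_inv c) (c p).

(* A Riemannian metric is given by its Gram matrices h c p in the coordinate
   frames; chart_diff d c p is the matrix of change of frame. *)
Record is_riemannian_metric (R : realType) (S : surface R)
  (h : chart R S -> S -> 'M[R]_2) : Prop := IsRiemannianMetric {
  metric_smooth : forall c : chart R S, atlas c ->
    smooth_on (chart_codom c) (h c \o chart_inv c) ;
  metric_sym : forall (c : chart R S) (p : S), atlas c -> chart_dom c p ->
    (h c p)^T = h c p ;
  metric_pos : forall (c : chart R S) (p : S) (v : 'rV[R]_2), atlas c ->
    chart_dom c p -> v != 0 -> 0 < (v *m h c p *m v^T) 0 0 ;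
  metric_change : forall (c d : chart R S) (p : S), atlas c -> atlas d ->
    chart_dom c p -> chart_dom d p ->
    h c p = chart_diff d c p *m h d p *m (chart_diff d c p)^T }.

(* Coefficients, in the coordinate frame, of the Levi-Civita connection of g:
   nabla_i e_j = sum_k christoffel g p k i j e_k. *)
Definition christoffel (R : realType) (n : nat) (g : 'rV[R]_n -> 'M[R]_n)
  (p : 'rV[R]_n) (k i j : 'I_n) : R :=
  \sum_l 2^-1 * invmx (g p) k l *
    (partial i (fun q => g q j l) p + partial j (fun q => g q i l) p
     - partial l (fun q => g q i j) p).

Lemma christoffel_torsion_free (R : realType) (n : nat)
  (g : 'rV[R]_n -> 'M[R]_n) (p : 'rV[R]_n) (k i j : 'I_n) :
  (forall q, (g q)^T = g q) ->
  christoffel g p k i j = christoffel g p k j i.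
Proof.
move=> gsym; apply: eq_bigr => l _; congr (_ * (_ - _)); first by rewrite addrC.
by congr (partial l _ p); apply/funext => q; rewrite -{1}(gsym q) mxE.
Qed.

Lemma christoffel_metric_compatible (R : realType) (n : nat)
  (g : 'rV[R]_n -> 'M[R]_n) (p : 'rV[R]_n) (l i j : 'I_n) :
  (forall q, (g q)^T = g q) -> g p \in unitmx ->
  partial l (fun q => g q i j) p =
  \sum_k (christoffel g p k l i * g p k j + christoffel g p k l j * g p i k).
Proof.
move=> gsym gunit.
have gC q a b : g q a b = g q b a by rewrite -{1}(gsym q) mxE.
have lower a b s : \sum_k christoffel g p k a b * g p k s =
    2^-1 * (partial a (fun q => g q b s) p + partial b (fun q => g q a s) p
            - partial s (fun q => g q a b) p).
  under eq_bigr => k _ do rewrite mulr_suml.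
  rewrite exchange_big /=.
  transitivity (\sum_t 2^-1 * (partial a (fun q => g q b t) p
      + partial b (fun q => g q a t) p - partial t (fun q => g q a b) p)
      * (g p *m invmx (g p)) s t).
    apply: eq_bigr => t _; rewrite mxE mulr_sumr; apply: eq_bigr => k _.
    rewrite (gC p s k) -!mulrA; congr (_ * _); rewrite mulrCA; congr (_ * _).
    exact: mulrC.
  rewrite mulmxV // (bigD1 s) //= mxE eqxx mulr1 big1 ?addr0 // => t ts.
  by rewrite mxE eq_sym (negPf ts) mulr0.
rewrite big_split /= lower; under [X in _ + X]eq_bigr => k _ do rewrite (gC p i k).
rewrite lower -mulrDr.
have -> : (fun q => g q j i) = (fun q => g q i j) by apply/funext => q.
set u := partial l _ p; set v := partial i _ p; set w := partial j _ p.
by field.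
Qed.

(* The connection of g pulled back to a map psi into the coordinate space:
   the i-th row is the covariant derivative of the vector field V along psi in
   the i-th coordinate direction of the source. *)
Definition covariant_jacobian (R : realType) (m n : nat)
  (g : 'rV[R]_n -> 'M[R]_n) (psi V : 'rV[R]_m -> 'rV[R]_n) (u : 'rV[R]_m) :
  'M[R]_(m, n) :=
  'J V u + \matrix_(i, k) \sum_a \sum_b
    christoffel g (psi u) k a b * 'J psi u i a * V u 0 b.

(* The metric of Sol_3 on R^3 in the coordinates (x, y, z) = (p_0, p_1, p_2);
   tangent vectors are written in the frame (d/dx, d/dy, d/dz). *)
Definition sol3_metric (R : realType) (p : 'rV[R]_3) : 'M[R]_3 :=
  let z := p 0 ord_max in
  diag_mx (\row_(i < 3) [:: expR (2 * z); expR (- (2 * z)); 1]`_i).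

Lemma sol3_metric_sym (R : realType) (p : 'rV[R]_3) :
  (sol3_metric p)^T = sol3_metric p.
Proof. exact: tr_diag_mx. Qed.

Lemma sol3_metric_unit (R : realType) (p : 'rV[R]_3) :
  sol3_metric p \in unitmx.
Proof.
rewrite unitmxE det_diag unitfE; apply/prodf_neq0 => i _; rewrite mxE.
by case: i => [[|[|[|]]]] //= _; rewrite ?gt_eqF ?expR_gt0 ?oner_neq0.
Qed.

Record isometric_immersion (R : realType) (S : surface R)
  (h : chart R S -> S -> 'M[R]_2) (phi : S -> 'rV[R]_3) : Prop :=
  IsometricImmersion {
  immersion_smooth : smooth_map phi ;
  immersion_injective : forall (c : chart R S) (p : S), atlas c ->
    chart_dom c p -> row_free (chart_diff phi c p) ;
  immersion_isometric : forall (c : chart R S) (p : S), atlas c ->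
    chart_dom c p ->
    h c p =
    chart_diff phi c p *m sol3_metric (phi p) *m (chart_diff phi c p)^T }.

Record unit_normal (R : realType) (S : surface R)
  (phi xi : S -> 'rV[R]_3) : Prop := UnitNormal {
  normal_smooth : smooth_map xi ;
  normal_unit : forall p : S,
    xi p *m sol3_metric (phi p) *m (xi p)^T = 1%:M ;
  normal_orthogonal : forall (c : chart R S) (p : S), atlas c ->
    chart_dom c p ->
    chart_diff phi c p *m sol3_metric (phi p) *m (xi p)^T = 0 }.

(* A c p is the matrix, in the coordinate frame of c and acting on the right on
   coordinate rows, of the endomorphism X |-> - nabla_X xi of T_pS. *)
Definition shape_operator (R : realType) (S : surface R)
  (phi xi : S -> 'rV[R]_3) (A : chart R S -> S -> 'M[R]_2) : Prop :=
  forall (c : chart R S) (p : S), atlas c -> chart_dom c p ->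
    A c p *m chart_diff phi c p =
    - covariant_jacobian (@sol3_metric R)
        (phi \o chart_inv c) (xi \o chart_inv c) (c p).

Definition mean_curvature (R : realType) (S : surface R)
  (A : chart R S -> S -> 'M[R]_2) (H : S -> R) : Prop :=
  forall (c : chart R S) (p : S), atlas c -> chart_dom c p ->
    H p = 2^-1 * \tr (A c p).

Definition squared_norm (R : realType) (S : surface R)
  (A : chart R S -> S -> 'M[R]_2) (N : S -> R) : Prop :=
  forall (c : chart R S) (p : S), atlas c -> chart_dom c p ->
    N p = \tr (A c p *m A c p).

(* Main.v *)
(* On such a surface [det A = (4 f^2 - |A|^2) / 2 >= 1], and the larger principal
   curvature exceeds the mean curvature, [f^2 - det A = |A|^2 / 2 - f^2 >= 1], so
   that there are no umbilic points and the corresponding principal directions form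
   a smooth line field. The connection form of that line field is unchanged when the
   unit vector is replaced by its opposite, hence is a global 1-form; its exterior
   derivative is the Gauss curvature [K = det A + 2 n_z^2 - 1] times the area form.
   Since [K >= 0], Stokes' theorem forces [K = 0] everywhere, whereas the tangent
   plane is horizontal where [z] is maximal, so that [n_z^2 = 1] and [K >= 2] there.
   Stokes' theorem is used without orientability: the signed densities of the
   charts enter through their absolute values, and a partition of unity whose
   members are supported where the sign of the density is constant localizes
   the statement in single charts. *)
Require Import Defs.
From HB Require Import structures.
From mathcomp Require Import all_boot all_order all_algebra.
From mathcomp Require Import all_classical all_reals all_analysis.
From mathcomp Require Import ring lra.
Import Order.TTheory GRing.Theory Num.Theory.
Import numFieldNormedType.Exports.

Set Implicit Arguments.
Unset Strict Implicit.
Unset Printing Implicit Defensive.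

Local Open Scope classical_set_scope.
Local Open Scope ring_scope.

(** * Functions of class C^k *)

(** A unit eigenvector picked at each point need not depend continuously on the point, so no formula
    may differentiate it. The tensor [e (x) e] does not see the sign of [e]: near each point it is
    that of a smooth unit lift, and the connection form is written through it alone. Likewise no
    regularity is given for [|A|^2]; that of [det A], and hence of the eigenvectors, comes from
    quotients of triple products of the normal, its covariant derivatives and the coordinate tangent
    vectors.

    Vectors are expressed in the orthonormal frame [e^-z d/dx, e^z d/dy, d/dz], in which the
    connection has constant coefficients. The relation between the connection form and the curvature
    then becomes a polynomial identity, whose analytic input is the symmetry of second derivatives.

    Integration is restricted to iterated integrals of continuous functions of compact support in
    the plane. The change of variables is proved near a point only, by bending the map into its
    affine tangent map and comparing 1-forms. Partitions of unity of class C^2 suffice, and these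
    are built from powers of positive parts. *)

Lemma differentiable_epsP (R : realType) (V W : normedModType R) (f : V -> W)
    (x : V) (df : {linear V -> W}) : continuous df ->
  (forall e : R, 0 < e -> \forall h \near 0,
     `|f (h + x) - (f x + df h)| <= e * `|h|) ->
  differentiable f x /\ 'd f x = df :> (V -> W).
Proof.
move=> cdf H.
have E : f \o shift x = cst (f x) + df +o_ 0 id.
  apply/eqaddoP => e e0; move: (H e e0); apply: filterS => h.
  by rewrite /= !fctE.
have D := diff_unique cdf E.
split=> //; apply/diff_locallyP; split.
  by rewrite D.
by rewrite D.
Qed.

Lemma differentiable_eps (R : realType) (V W : normedModType R) (f : V -> W)
    (x : V) : differentiable f x ->
  forall e : R, 0 < e -> \forall h \near 0,
     `|f (h + x) - (f x + 'd f x h)| <= e * `|h|.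
Proof.
move=> /diff_locallyP[_ /eqaddoP H] e e0; move: (H e e0).
by apply: filterS => h; rewrite /= !fctE.
Qed.

Lemma near_eq_differentiable (R : realType) (V W : normedModType R)
    (f g : V -> W) (x : V) :
  {near x, f =1 g} -> differentiable f x -> differentiable g x.
Proof.
move=> fg df; apply: (proj1 (@differentiable_epsP _ _ _ g x ('d f x) _ _)).
  exact: diff_continuous.
move=> e e0; have := differentiable_eps df e0.
have fgx := nbhs_singleton fg.
have : \forall h \near 0, f (h + x) = g (h + x).
  have := fg; rewrite (near_shift 0) /=; apply: filterS => h /=.
  by rewrite subr0.
by apply: filterS2 => h -> H; rewrite -fgx.
Qed.

Lemma partial_near (R : realType) (m : nat) (f g : 'rV[R]_m -> R)
    (x : 'rV[R]_m) (i : 'I_m) :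
  {near x, f =1 g} -> partial i f x = partial i g x.
Proof. exact: near_eq_derive. Qed.

Section Ck.
Context {R : realType} {m : nat}.
Implicit Types (U V : set 'rV[R]_m) (f g : 'rV[R]_m -> R).

(** Finite order is enough, since the bump functions below are powers of positive parts. Continuity
    and differentiability are taken in the ambient space at the points of [U], and [partial i f] is
    a function on the whole space; the notion is meant for open [U]. *)
Fixpoint Ck (k : nat) U f : Prop :=
  if k is k'.+1 then
    (forall x, U x -> differentiable f x) /\ forall i, Ck k' U (partial i f)
  else forall x, U x -> {for x, continuous f}.

Lemma Ck_differentiable k U f x : Ck k.+1 U f -> U x -> differentiable f x.
Proof. by case=> + _; apply. Qed.

Lemma Ck_partial k U f i : Ck k.+1 U f -> Ck k U (partial i f).
Proof. by case=> _; apply. Qed.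

Lemma Ck_subset k U V f : V `<=` U -> Ck k U f -> Ck k V f.
Proof.
move=> VU; elim: k f => [|k IH] f /= => [H x /VU|[H1 H2]]; first exact: H.
by split=> [x /VU|i]; [exact: H1|exact: IH].
Qed.

Lemma Ck_continuous k U f : Ck k U f -> forall x, U x -> {for x, continuous f}.
Proof.
by case: k => [|k] //= [H _] x Ux; exact: differentiable_continuous (H x Ux).
Qed.

Lemma CkW k U f : Ck k.+1 U f -> Ck k U f.
Proof.
elim: k f => [|k IH] f; first exact: Ck_continuous.
by move=> [H1 H2]; split=> // i; exact: IH.
Qed.

(** Every clause of [Ck] is pointwise in [x], so each point may bring its own [V]. *)
Lemma Ck_local k U f :
  (forall x, U x -> exists2 V, V x & Ck k V f) -> Ck k U f.
Proof.
elim: k f => [|k IH] f H.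
  by move=> x Ux; have [V Vx Vf] := H x Ux; exact: Vf.
split=> [x Ux|i]; first by have [V Vx [Vf _]] := H x Ux; exact: Vf.
by apply: IH => x Ux; have [V Vx [_ Vf]] := H x Ux; exists V => //; exact: Vf.
Qed.

Lemma Ck_near k U f g : open U ->
  (forall x, U x -> {near x, f =1 g}) -> Ck k U f -> Ck k U g.
Proof.
move=> oU; elim: k f g => [|k IH] f g fg.
  move=> H x Ux; have fgx := fg x Ux; have gx := nbhs_singleton fgx.
  have := H x Ux; rewrite /prop_for /continuous_at gx.
  by move=> Hf; exact: cvg_trans (near_eq_cvg fgx) Hf.
move=> [H1 H2]; split=> [x Ux|i].
  by apply: near_eq_differentiable (H1 x Ux); exact: fg.
apply: IH (H2 i) => x Ux; have := fg x Ux.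
move=> /near_join; apply: filterS => y; exact: partial_near.
Qed.

Lemma Ck_eq k U f g : open U -> (forall x, U x -> f x = g x) ->
  Ck k U f -> Ck k U g.
Proof.
move=> oU fg; apply: Ck_near => // x Ux.
by move: (open_nbhs_nbhs (conj oU Ux)); apply: filterS.
Qed.

Lemma Ck_cst k U (a : R) : Ck k U (fun=> a).
Proof.
elim: k a => [|k IH] a; first by move=> x _; exact: cst_continuous.
split=> [x _|i]; first exact: differentiable_cst.
have -> : partial i (fun=> a) = fun=> 0; last exact: IH.
by apply/funext => x; rewrite /partial derive_cst.
Qed.

Lemma partialD f g x i : differentiable f x -> differentiable g x ->
  partial i (fun y => f y + g y) x = partial i f x + partial i g x.
Proof. by move=> df dg; rewrite /partial deriveD //; exact: diff_derivable. Qed.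

Lemma partialN f x i : differentiable f x ->
  partial i (fun y => - f y) x = - partial i f x.
Proof. by move=> df; rewrite /partial deriveN //; exact: diff_derivable. Qed.

Lemma partialM f g x i : differentiable f x -> differentiable g x ->
  partial i (fun y => f y * g y) x = partial i f x * g x + f x * partial i g x.
Proof.
move=> df dg; rewrite /partial deriveM //; try exact: diff_derivable.
by rewrite addrC; congr (_ + _); rewrite /GRing.scale /= mulrC.
Qed.

Lemma partialV f x i : differentiable f x -> f x != 0 ->
  partial i (fun y => (f y)^-1) x = - partial i f x * (f x)^-1 * (f x)^-1.
Proof.
move=> df f0; rewrite /partial deriveV //; last exact: diff_derivable.
by rewrite /GRing.scale /= -exprVn; ring.
Qed.

Lemma CkD k U f g : open U -> Ck k U f -> Ck k U g -> Ck k U (fun x => f x + g x).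
Proof.
move=> oU; elim: k f g => [|k IH] f g.
  by move=> /= cf cg x Ux; apply: continuousD; [exact: cf|exact: cg].
move=> [df Df] [dg Dg]; split=> [x Ux|i].
  by apply: differentiableD; [exact: df|exact: dg].
by apply: Ck_eq (IH _ _ (Df i) (Dg i)) => // x Ux; rewrite partialD //; auto.
Qed.

Lemma CkN k U f : open U -> Ck k U f -> Ck k U (fun x => - f x).
Proof.
move=> oU; elim: k f => [|k IH] f.
  by move=> /= cf x Ux; apply: continuousN; exact: cf.
move=> [df Df]; split=> [x Ux|i].
  by apply: differentiableN; exact: df.
by apply: Ck_eq (IH _ (Df i)) => // x Ux; rewrite partialN //; auto.
Qed.

Lemma CkB k U f g : open U -> Ck k U f -> Ck k U g -> Ck k U (fun x => f x - g x).
Proof. by move=> oU cf cg; apply: CkD => //; exact: CkN. Qed.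

Lemma CkM k U f g : open U -> Ck k U f -> Ck k U g -> Ck k U (fun x => f x * g x).
Proof.
move=> oU; elim: k f g => [|k IH] f g.
  by move=> /= cf cg x Ux; apply: continuousM; [exact: cf|exact: cg].
move=> F G; have [df Df] := F; have [dg Dg] := G; split=> [x Ux|i].
  by apply: differentiableM; [exact: df|exact: dg].
apply: (@Ck_eq _ _ (fun x => partial i f x * g x + f x * partial i g x)) => //.
  by move=> x Ux; rewrite partialM; [|exact: df|exact: dg].
apply: (CkD oU); apply: IH.
- exact: Df.
- exact: CkW.
- exact: CkW.
- exact: Dg.
Qed.

Lemma CkX k U f n : open U -> Ck k U f -> Ck k U (fun x => f x ^+ n).
Proof.
move=> oU cf; elim: n => [|n IH].
  by apply: Ck_eq (Ck_cst k U 1) => // x _; rewrite expr0.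
by apply: Ck_eq (CkM oU cf IH) => // x _; rewrite exprS.
Qed.

Lemma CkV k U f : open U -> (forall x, U x -> f x != 0) ->
  Ck k U f -> Ck k U (fun x => (f x)^-1).
Proof.
move=> oU f0; elim: k => [|k IH].
  by move=> /= cf x Ux; apply: continuousV; [exact: f0|exact: cf].
move=> F; have [df Df] := F; split=> [x Ux|i].
  by apply: differentiableV; [exact: df|exact: f0].
apply: (@Ck_eq _ _ (fun x => - partial i f x * (f x)^-1 * (f x)^-1)) => //.
  by move=> x Ux; rewrite partialV //; auto.
apply: (CkM oU); last by apply: IH; exact: CkW.
by apply: (CkM oU); [exact: CkN oU (Df i)|apply: IH; exact: CkW].
Qed.

Lemma Ck_sum k U (I : Type) (r : seq I) (P : pred I) (F : I -> 'rV[R]_m -> R) :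
  open U -> (forall i, P i -> Ck k U (F i)) ->
  Ck k U (fun x => \sum_(i <- r | P i) F i x).
Proof.
move=> oU H; elim: r => [|i r IH].
  by apply: Ck_eq (Ck_cst k U 0) => // x _; rewrite big_nil.
case Pi : (P i).
  by apply: Ck_eq (CkD oU (H i Pi) IH) => // x _; rewrite big_cons Pi.
by apply: Ck_eq IH => // x _; rewrite big_cons Pi.
Qed.

End Ck.

Arguments Ck : simpl never.

Lemma partial_compR (R : realType) (m : nat) (f : 'rV[R]_m -> R) (phi : R -> R)
    (x : 'rV[R]_m) : differentiable f x -> derivable phi (f x) 1 ->
  differentiable (phi \o f) x /\
  forall i, partial i (phi \o f) x = 'D_1 phi (f x) * partial i f x.
Proof.
move=> df /derivable1_diffP dphi; have dc := differentiable_comp df dphi.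
split=> // i; rewrite /partial !deriveE // diff_comp //=.
by rewrite -[X in 'd phi _ X = _]mulr1 [LHS]linearZ mulrC.
Qed.

(** The differential is assembled from those of the coordinates; for the sup norm, the remainder
    estimate holds once it holds in each of the finitely many coordinates. *)
Lemma differentiable_row (R : realType) (V : normedModType R) (n : nat)
    (F : V -> 'rV[R]_n) (x : V) :
  (forall j, differentiable (fun y => F y 0 j) x) -> differentiable F x.
Proof.
move=> dF.
pose df h : 'rV[R]_n := \row_j 'd (fun y => F y 0 j) x h.
have ldf : linear df.
  by move=> a u v; apply/rowP => j; rewrite !mxE linearP.
pose L : {linear V -> 'rV[R]_n} := HB.pack df (GRing.isLinear.Build _ _ _ _ _ ldf).
apply: (proj1 (@differentiable_epsP _ _ _ F x L _ _)).
  move=> v; apply/cvgrPdist_le => e e0.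
  have H (j : 'I_n) : \forall w \near v, `|df v 0 j - df w 0 j| <= e.
    have := diff_continuous (dF j); move=> /(_ v)/cvgrPdist_le/(_ e e0).
    by apply: filterS => w; rewrite !mxE.
  have := filter_forall (nbhs_filter v) H; apply: filterS => w Hw.
  rewrite [leLHS]/Num.Def.normr/= mx_normrE (bigmax_le _ (ltW e0))//= => -[i j] _.
  by have := Hw j; rewrite !mxE ord1.
move=> e e0.
have H (j : 'I_n) : \forall h \near 0,
    `|F (h + x) 0 j - (F x 0 j + df h 0 j)| <= e * `|h|.
  have := differentiable_eps (dF j) e0.
  by apply: filterS => w; rewrite !mxE.
have := filter_forall (nbhs_filter (0 : V)) H; apply: filterS => w Hw.
rewrite [leLHS]/Num.Def.normr/= mx_normrE bigmax_le ?mulr_ge0 ?(ltW e0)//= => -[i j] _.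
by have := Hw j; rewrite !mxE ord1.
Qed.

Lemma differentiable_coord_comp (R : realType) (V : normedModType R) (n : nat)
    (F : V -> 'rV[R]_n) (x : V) j :
  differentiable F x -> differentiable (fun y => F y 0 j) x.
Proof.
move=> dF; apply: (@differentiable_comp _ _ _ _ F (fun M : 'rV[R]_n => M 0 j)) => //.
exact: differentiable_coord.
Qed.

Lemma diff_coord (R : realType) (V : normedModType R) (n : nat)
    (F : V -> 'rV[R]_n) (x : V) (h : V) j : differentiable F x ->
  'd (fun y => F y 0 j) x h = ('d F x h) 0 j.
Proof.
move=> dF; have dj := differentiable_coord_comp j dF.
rewrite -!deriveE // derive_mx ?mxE //; exact: diff_derivable.
Qed.

Lemma derive_comp_row (R : realType) (V : normedModType R) (n : nat)
    (f : 'rV[R]_n -> R) (T : V -> 'rV[R]_n) (x v : V) :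
  differentiable T x -> differentiable f (T x) ->
  'D_v (f \o T) x = \sum_j partial j f (T x) * 'D_v (fun y => T y 0 j) x.
Proof.
move=> dT df; have dc := differentiable_comp dT df.
rewrite /partial deriveE // diff_comp //=.
rewrite [X in 'd f _ X]row_sum_delta linear_sum; apply: eq_bigr => j _.
have E2 : 'D_v (fun y => T y 0 j) x = ('d T x v) 0 j.
  by rewrite deriveE ?diff_coord //; exact: differentiable_coord_comp.
by rewrite linearZ /= E2 (deriveE _ df) mulrC.
Qed.

Lemma partial_comp (R : realType) (m n : nat) (f : 'rV[R]_n -> R)
    (T : 'rV[R]_m -> 'rV[R]_n) (x : 'rV[R]_m) (i : 'I_m) :
  differentiable T x -> differentiable f (T x) ->
  partial i (f \o T) x =
  \sum_j partial j f (T x) * partial i (fun y => T y 0 j) x.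
Proof. exact: derive_comp_row. Qed.

(** Continuity of [T] is asked for [k = 0] only: from [k = 1] on it follows from the
    differentiability of the coordinates. *)
Lemma Ck_comp (R : realType) (m n k : nat) (U : set 'rV[R]_m)
    (V : set 'rV[R]_n) (f : 'rV[R]_n -> R) (T : 'rV[R]_m -> 'rV[R]_n) :
  open U -> (forall x, U x -> V (T x)) ->
  (forall j, Ck k U (fun y => T y 0 j)) ->
  (k = 0%N -> forall x, U x -> {for x, continuous T}) ->
  Ck k V f -> Ck k U (f \o T).
Proof.
move=> oU UV; elim: k f => [|k IH] f CT CT0 Cf.
  move=> x Ux; apply: continuous_comp; first exact: CT0.
  exact/Cf/UV.
have dT x : U x -> differentiable T x.
  by move=> Ux; apply: differentiable_row => j; case: (CT j) => + _; apply.
have [df Df] := Cf.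
split=> [x Ux|i]; first by apply: differentiable_comp; [exact: dT|exact/df/UV].
apply: (@Ck_eq _ _ _ _ (fun x => \sum_j (partial j f \o T) x * partial i (fun y => T y 0 j) x)) => //.
  by move=> x Ux; rewrite partial_comp //; [exact: dT|exact/df/UV].
apply: Ck_sum => // j _; apply: CkM => //; last by case: (CT j) => _; apply.
apply: IH; [by move=> l; exact/CkW| |exact: Df].
by move=> _ x Ux; exact/differentiable_continuous/dT.
Qed.

Lemma Ck_coord (R : realType) (m k : nat) (U : set 'rV[R]_m) j : open U ->
  Ck k U (fun y => y 0 j).
Proof.
move=> oU; case: k => [|k]; first by move=> x _; exact: coord_continuous.
split=> [x _|i]; first exact: differentiable_coord.
apply: (@Ck_eq _ _ _ _ (fun=> (delta_mx 0 i : 'rV[R]_m) 0 j)) => //; last exact: Ck_cst.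
move=> x _; rewrite /partial deriveE; last exact: differentiable_coord.
by rewrite (@diff_coord _ _ _ id) // diff_val.
Qed.

Lemma derive_row (R : realType) (V : normedModType R) (n : nat)
    (F : V -> 'rV[R]_n) (x v : V) j : differentiable F x ->
  'D_v F x 0 j = 'D_v (fun y => F y 0 j) x.
Proof. by move=> dF; rewrite derive_mx ?mxE //; exact: diff_derivable. Qed.

Lemma Ck_of_smooth (R : realType) (m n k : nat) (U : set 'rV[R]_m)
    (F : 'rV[R]_m -> 'rV[R]_n) j : open U ->
  smooth_on U F -> Ck k U (fun y => F y 0 j).
Proof.
move=> oU; elim: k F => [|k IH] F sF.
  move=> x Ux; apply/differentiable_continuous/differentiable_coord_comp.
  exact: (sF [::]).
split=> [x Ux|i]; first by apply: differentiable_coord_comp; exact: (sF [::]).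
apply: (@Ck_eq _ _ _ _ (fun y => partial i F y 0 j)) => //.
  by move=> x Ux; rewrite /partial derive_row //; exact: (sF [::]).
(* The list of derivatives is read from the outside in, so appending [i] at its end differentiates
   [F] itself first. *)
apply: IH => l x Ux; have := sF (rcons l i) x Ux.
by rewrite foldr_rcons.
Qed.

(** The exponent [k + 1] makes the function of class C^k, and differentiation lowers [k] by one,
    which is the induction behind [Ck_pospow]. *)
Definition pospow (R : realType) (k : nat) (t : R) := (Num.max t 0) ^+ k.+1.

Lemma pospow_continuous (R : realType) k : continuous (@pospow R k).
Proof.
move=> t; apply: (@continuous_comp _ _ _ (fun t : R => Num.max t 0) (fun t => t ^+ k.+1)).
  by apply: continuous_max; [exact: cvg_id|exact: cst_continuous].
exact: exprn_continuous.
Qed.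

Lemma is_derive_pospow (R : realType) k (t : R) :
  is_derive t 1 (@pospow R k.+1) (k.+2%:R * pospow k t).
Proof.
have [t0|t0|->] := ltgtP t 0.
- apply: (@near_eq_is_derive _ _ _ (cst 0)).
    near=> s; rewrite /pospow max_r ?expr0n //.
    by apply: ltW; near: s; exact: lt_nbhsl.
  rewrite /pospow max_r ?(ltW t0)// expr0n /= mulr0; exact: is_derive_cst.
- apply: (@near_eq_is_derive _ _ _ (fun s : R => s ^+ k.+2)).
    near=> s; rewrite /pospow max_l //.
    by apply: ltW; near: s; exact: lt_nbhsr.
  rewrite /pospow max_l ?(ltW t0)//.
  apply: DeriveDef; first exact: exprn_derivable.
  by rewrite exp_derive /GRing.scale /= mulr1.
(* At the corner the function is at most [|h| ^+ 2] for [|h| <= 1], so the derivative is zero. *)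
- have c0 : continuous (\0 : R -> R) by exact: cst_continuous.
  have [] := @differentiable_epsP _ _ _ (@pospow R k.+1) 0 \0 c0.
    move=> e e0.
    have B (h : R) : `|h| <= 1 -> `|h| <= e -> `|pospow k.+1 h| <= e * `|h|.
      move=> h1 he; rewrite /pospow normrX exprS mulrC.
      have [h0|h0] := ltP 0 h; last first.
        by rewrite normr0 expr0n /= mul0r mulr_ge0 ?(ltW e0).
      rewrite ler_wpM2r //.
      by apply: (le_trans _ he); rewrite exprS ler_piMr // exprn_ile1.
    near=> h; rewrite addr0 {2}/pospow maxxx expr0n /= addr0 subr0.
    apply: B; near: h.
    - exact: (@nbhs0_le R R 1 ltr01).
    - exact: (@nbhs0_le R R e e0).
  move=> dp dE; apply: DeriveDef; first exact: diff_derivable.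
  by rewrite deriveE // dE /pospow maxxx expr0n /= mulr0.
Unshelve. all: by end_near. Qed.

Lemma Ck_pospow (R : realType) (m k : nat) (U : set 'rV[R]_m) (f : 'rV[R]_m -> R) :
  open U -> Ck k U f -> Ck k U (fun x => pospow k (f x)).
Proof.
move=> oU; elim: k f => [|k IH] f.
  move=> cf x Ux; apply: (@continuous_comp _ _ _ f (pospow 0)); first exact: cf.
  exact: pospow_continuous.
move=> F; have [df Df] := F.
have C x : U x -> differentiable (pospow k.+1 \o f) x /\ forall i,
    partial i (pospow k.+1 \o f) x = k.+2%:R * pospow k (f x) * partial i f x.
  move=> Ux; have D := is_derive_pospow k (f x).
  have [H1 H2] := partial_compR (df x Ux) (@ex_derive _ _ _ _ _ _ _ D).
  by split=> // i; rewrite H2 derive_val.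
split=> [x Ux|i]; first exact: (C x Ux).1.
apply: (@Ck_eq _ _ _ _ (fun x => k.+2%:R * pospow k (f x) * partial i f x)) => //.
  by move=> x Ux; rewrite (C x Ux).2.
apply: (CkM oU); last exact: Df.
by apply: (CkM oU); [exact: Ck_cst|exact/IH/CkW].
Qed.

Lemma Ck_sqrt (R : realType) (m k : nat) (U : set 'rV[R]_m) (f : 'rV[R]_m -> R) :
  open U -> (forall x, U x -> 0 < f x) -> Ck k U f ->
  Ck k U (fun x => Num.sqrt (f x)).
Proof.
move=> oU f0; elim: k f f0 => [|k IH] f f0.
  move=> cf x Ux; apply: (@continuous_comp _ _ _ f Num.sqrt); first exact: cf.
  exact: sqrt_continuous.
move=> F; have [df Df] := F.
have C x : U x -> differentiable (Num.sqrt \o f) x /\ forall i,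
    partial i (Num.sqrt \o f) x = (2 * Num.sqrt (f x))^-1 * partial i f x.
  move=> Ux; have D := is_derive1_sqrt (f0 x Ux).
  have [H1 H2] := partial_compR (df x Ux) (@ex_derive _ _ _ _ _ _ _ D).
  by split=> // i; rewrite H2 derive_val.
split=> [x Ux|i]; first exact: (C x Ux).1.
apply: (@Ck_eq _ _ _ _ (fun x => (2 * Num.sqrt (f x))^-1 * partial i f x)) => //.
  by move=> x Ux; rewrite (C x Ux).2.
apply: (CkM oU); last exact: Df.
apply: (CkV oU).
  by move=> x Ux; rewrite mulf_neq0 // gt_eqF // sqrtr_gt0 f0.
apply: (CkM oU); first exact: Ck_cst.
by apply: IH => //; exact/CkW.
Qed.

Lemma Ck_expR (R : realType) (m k : nat) (U : set 'rV[R]_m) (f : 'rV[R]_m -> R) :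
  open U -> Ck k U f -> Ck k U (fun x => expR (f x)).
Proof.
move=> oU; elim: k f => [|k IH] f.
  move=> cf x Ux; apply: (@continuous_comp _ _ _ f (@expR R)); first exact: cf.
  exact: continuous_expR.
move=> F; have [df Df] := F.
have C x : U x -> differentiable (@expR R \o f) x /\ forall i,
    partial i (@expR R \o f) x = expR (f x) * partial i f x.
  move=> Ux; have D := is_derive_expR (f x).
  have [H1 H2] := partial_compR (df x Ux) (@ex_derive _ _ _ _ _ _ _ D).
  by split=> // i; rewrite H2 derive_val.
split=> [x Ux|i]; first exact: (C x Ux).1.
apply: (@Ck_eq _ _ _ _ (fun x => expR (f x) * partial i f x)) => //.
  by move=> x Ux; rewrite (C x Ux).2.
by apply: (CkM oU); [exact/IH/CkW|exact: Df].
Qed.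

(** * Compactly supported integrals in the plane *)

Section Integral1.
Context {R : realType}.
Local Notation mu := (@lebesgue_measure R).
Implicit Types (f g Phi : R -> R).

Definition supp1 (M : R) f := forall x, M < `|x| -> f x = 0.

Definition integral1 f : R := \int[mu]_x f x.

Lemma integral1_itv (M : R) f : supp1 M f ->
  integral1 f = \int[mu]_(x in `[- M, M]) f x.
Proof.
move=> sf; rewrite [RHS]Rintegral_mkcond; congr (Rintegral _ _ _).
apply/funext => x; rewrite patchE; case: ifPn => //.
rewrite notin_setE /= in_itv /= -ler_norml => /negP; rewrite -ltNge.
exact: sf.
Qed.

Lemma integrable_itv f (a b : R) : continuous f ->
  mu.-integrable `[a, b] (EFin \o f).
Proof.
move=> cf; apply: continuous_compact_integrable; first exact: segment_compact.
exact: continuous_subspaceT.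
Qed.

Lemma integral1_primitive (M : R) f Phi : 0 < M -> continuous f -> supp1 M f ->
  (forall x : R, is_derive x (1 : R) Phi (f x)) -> integral1 f = Phi M - Phi (- M).
Proof.
move=> M0 cf sf dP; rewrite (integral1_itv sf) /Rintegral.
have cP x : {for x, continuous Phi}.
  apply/differentiable_continuous/derivable1_diffP.
  by have [] := dP x.
rewrite (@continuous_FTC2 _ f Phi) //.
- by rewrite gtrN.
- exact: continuous_subspaceT.
- split=> [x _| |].
  + by have [] := dP x.
  + by apply: cvg_at_right_filter; exact: cP.
  + by apply: cvg_at_left_filter; exact: cP.
- by move=> x _; rewrite derive1E; have [_ ->] := dP x.
Qed.

Lemma is_derive_primitive (M : R) f : 0 < M -> continuous f -> supp1 M f ->
  forall x : R, is_derive x (1 : R) (fun x => \int[mu]_(t in `]-oo, x]) f t) (f x).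
Proof.
move=> M0 cf sf x.
have If : mu.-integrable setT (EFin \o f).
  have -> : EFin \o f = (EFin \o f) \_ `[- M, M].
    apply/funext => y; rewrite patchE; case: ifPn => //.
    rewrite notin_setE /= in_itv /= -ler_norml => /negP; rewrite -ltNge.
    by move=> /sf ->.
  by apply/(integrable_mkcond _ _).1 => //; exact: integrable_itv.
have [] := @continuous_FTC1 R f -oo%O x (x + 1).
- by rewrite ltrDl.
- exact: integrableS If.
- exact: ltNyr.
- exact: cf.
move=> d1 d2; apply: DeriveDef; first exact: d1.
by rewrite -derive1E.
Qed.

Definition Cc1 f := continuous f /\ exists M : R, supp1 M f.

Lemma Cc1_bound f : Cc1 f -> exists2 M : R, 0 < M & supp1 M f.
Proof.
move=> [_ [M sf]]; exists (Num.max M 1); first by rewrite lt_max ltr01 orbT.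
by move=> x; rewrite gt_max => /andP[/sf].
Qed.

Lemma supp1_le (M N : R) f : M <= N -> supp1 M f -> supp1 N f.
Proof. by move=> MN sf x Nx; apply: sf; exact: le_lt_trans Nx. Qed.

(** With an antiderivative that computes the integral from all large bounds, linearity, positivity
    and affine substitution become rules about derivatives. *)
Lemma integral1P f : Cc1 f -> exists Phi, (forall x : R, is_derive x (1 : R) Phi (f x)) /\
  exists2 M : R, 0 < M & supp1 M f /\ forall N, M <= N -> integral1 f = Phi N - Phi (- N).
Proof.
move=> Cf; have [M M0 sf] := Cc1_bound Cf; have cf := Cf.1.
have dP := is_derive_primitive M0 cf sf.
exists (fun x => \int[mu]_(t in `]-oo, x]) f t); split => //.
exists M => //; split=> // N MN; apply: integral1_primitive => //.
  exact: lt_le_trans MN.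
exact: supp1_le sf.
Qed.

Lemma integral1D f g : Cc1 f -> Cc1 g ->
  integral1 (fun x => f x + g x) = integral1 f + integral1 g.
Proof.
move=> Cf Cg; have [F [dF [M M0 [sf EF]]]] := integral1P Cf.
have [G [dG [N N0 [sg EG]]]] := integral1P Cg.
rewrite (EF (Num.max M N)) ?le_max ?lexx //.
rewrite (EG (Num.max M N)) ?le_max ?lexx ?orbT //.
rewrite (@integral1_primitive (Num.max M N) _ (fun x => F x + G x)).
- by ring.
- by rewrite lt_max M0.
- by move=> x; apply: continuousD; [exact: Cf.1|exact: Cg.1].
- by move=> x; rewrite gt_max => /andP[/sf -> /sg ->]; rewrite addr0.
Qed.

Lemma integral1Z f (a : R) : Cc1 f ->
  integral1 (fun x => a * f x) = a * integral1 f.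
Proof.
move=> Cf; have [F [dF [M M0 [sf EF]]]] := integral1P Cf.
rewrite (EF M) // (@integral1_primitive M _ (fun x => a * F x)) //.
- by ring.
- by move=> x; apply: continuousM; [exact: cst_continuous|exact: Cf.1].
- by move=> x /sf ->; rewrite mulr0.
Qed.

(** The primitive [F] is nondecreasing. If its values at [- N] and [N] agreed, it would be constant
    near [x0] and its derivative [f x0] would vanish. *)
Lemma integral1_gt0 f (x0 : R) : Cc1 f -> (forall x, 0 <= f x) -> 0 < f x0 ->
  0 < integral1 f.
Proof.
move=> Cf f0 fx0; have [F [dF [M M0 [sf EF]]]] := integral1P Cf.
pose N := Num.max M (`|x0| + 1).
have N0 : 0 < N by rewrite lt_max M0.
rewrite (EF N) ?le_max ?lexx // subr_gt0.
have dF1 x : derivable F x 1 by have [] := dF x.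
have ndF x y : x <= y -> F x <= F y.
  rewrite le_eqVlt => /predU1P[-> //|xy].
  have [|c _] := @MVT R F f x y xy (fun z _ => dF z).
    apply: derivable_within_continuous => z _; exact: dF1.
  by move=> E; rewrite -subr_ge0 E mulr_ge0 // subr_ge0 ltW.
have xN : - N < x0 < N.
  by rewrite -ltr_norml lt_max ltrDl ltr01 orbT.
move: xN => /andP[xN1 xN2].
rewrite lt_neqAle ndF ?andbT ?gerN ?(ltW N0)//; last first.
  by rewrite (le_trans (ltW xN1)) // ltW.
apply/eqP => E.
have cstF (x : R) : - N < x -> x < N -> F x = F N.
  move=> h1 h2; apply/eqP; rewrite eq_le ndF ?(ltW h2)//= -E ndF // ltW //.
have : 'D_1 F x0 = 0.
  transitivity ('D_1 (cst (F N)) x0); last by rewrite derive_cst.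
  apply: near_eq_derive; near=> z; apply: cstF; near: z.
    exact: lt_nbhsr.
  exact: lt_nbhsl.
by have [_ ->] := dF x0 => fE; rewrite fE ltxx in fx0.
Unshelve. all: by end_near. Qed.

Lemma integral1_ge0 f : (forall x, 0 <= f x) -> 0 <= integral1 f.
Proof. by move=> f0; apply: Rintegral_ge0. Qed.

(** The primitive of [f] is constant on either side of [[- M, M]]; the sign of [a] decides which
    endpoint is sent to which side, and the absolute value makes up for it. *)
Lemma integral1_affine f (a b : R) : a != 0 -> Cc1 f ->
  integral1 (fun x => f (a * x + b)) * `|a| = integral1 f.
Proof.
move=> a0 Cf; have [F [dF [M M0 [sf EF]]]] := integral1P Cf.
have na : 0 < `|a| by rewrite normr_gt0.
(* Chosen so that [N < |x|] forces [M < |a * x + b|]. *)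
pose N := (M + `|b|) / `|a|.
have MN : M <= `|a| * N - `|b|.
  by rewrite /N mulrC divfK ?gt_eqF // addrK.
have N0 : 0 < N by rewrite divr_gt0 // ltr_wpDr.
have sN x : N < `|x| -> M < `|a * x + b|.
  move=> Nx; apply: (le_lt_trans MN).
  apply: (@lt_le_trans _ _ (`|a * x| - `|b|)).
    by rewrite ltrD2r normrM ltr_pM2l.
  by rewrite lerBlDr (le_trans _ (ler_normB _ _)) // addrK.
have FM y z : (forall t, y < t -> t < z -> f t = 0) -> y <= z -> F z = F y.
  move=> fyz; rewrite le_eqVlt => /predU1P[-> //|yz].
  have dF1 x : derivable F x 1 by have [] := dF x.
  have [|c] := @MVT R F f y z yz (fun t _ => dF t).
    by apply: derivable_within_continuous => t _; exact: dF1.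
  rewrite in_itv /= => /andP[yc cz] /eqP.
  by rewrite fyz // mul0r subr_eq0 => /eqP.
have FR y : M <= y -> F y = F M.
  move=> My; apply: FM => // t Mt _; apply: sf.
  by rewrite (lt_le_trans Mt) // ler_norm.
have FL y : y <= - M -> F y = F (- M).
  move=> My; apply/esym; apply: FM => // t _ tM; apply: sf.
  by rewrite -normrN (@lt_le_trans _ _ (- t)) ?ler_norm // ltrNr.
have EN : integral1 (fun x => f (a * x + b)) =
    a^-1 * F (a * N + b) - a^-1 * F (a * - N + b).
  apply: (@integral1_primitive N _ (fun x => a^-1 * F (a * x + b))) => //.
  - move=> x; apply: (@continuous_comp _ _ _ (fun x => a * x + b) f); last exact: Cf.1.
    apply: continuousD; last exact: cst_continuous.
    by apply: continuousM; [exact: cst_continuous|exact: cvg_id].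
  - by move=> x /sN/sf.
  - move=> x; have -> : f (a * x + b) = a^-1 * (a * f (a * x + b)) by rewrite mulKf.
    apply: is_deriveZ.
    have D1 : is_derive x (1 : R) (fun x => a * x + b) a.
      have DZ : is_derive x (1 : R) (fun x => a * x) (a * 1).
        exact: (@is_deriveZ _ _ _ id a x 1 1 (is_derive_id x 1)).
      have := @is_deriveD _ _ _ (fun x => a * x) (cst b) x 1 _ _ DZ (is_derive_cst b x 1).
      by rewrite mulr1 addr0.
    have [d1 E1] := D1.
    have [d2 E2] := dF (a * x + b).
    apply: DeriveDef.
      apply/derivable1_diffP/differentiable_comp; exact/derivable1_diffP.
    rewrite -derive1E (@derive1_comp _ (fun x => a * x + b) F) //.
    by rewrite !derive1E E2 E1 mulrC.
have MNn : `|a| * N - `|b| <= `|a| * N + b.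
  by rewrite lerD2l lerNl -normrN ler_norm.
have MNp : `|a| * N + b <= `|a| * N + `|b| by rewrite lerD2l ler_norm.
rewrite EN (EF M) //; have [a1|a1|/eqP] := ltgtP 0 a; last first.
- by rewrite eq_sym (negPf a0).
- rewrite ltr0_norm // in MN MNn MNp sN *.
  rewrite (FL (a * N + b)) ?(FR (a * - N + b)); first by field.
  + by rewrite mulrN -mulNr; exact: le_trans MN MNn.
  + have := ler_norm b; lra.
- rewrite gtr0_norm // in MN MNn MNp sN *.
  rewrite (FR (a * N + b)) ?(FL (a * - N + b)); first by field.
  + have := ler_norm b; lra.
  + exact: le_trans MN MNn.
Qed.

End Integral1.

(** * Parameter integrals over segments *)

Section Plane.
Context {R : realType}.
Local Notation mu := (@lebesgue_measure R).

Definition vec2 (x y : R) : 'rV[R]_2 := \row_i (if i == 0 then x else y).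

Lemma vec2_0 x y : vec2 x y 0 0 = x. Proof. by rewrite mxE. Qed.
Lemma vec2_1 x y : vec2 x y 0 1 = y. Proof. by rewrite mxE. Qed.

Lemma ord2P (P : 'I_2 -> Prop) : P 0 -> P 1 -> forall i, P i.
Proof.
move=> P0 P1 [[|[|//]] Hi].
- by rewrite (_ : Ordinal Hi = 0) //; exact: val_inj.
- by rewrite (_ : Ordinal Hi = 1) //; exact: val_inj.
Qed.

Lemma vec2_eta (u : 'rV[R]_2) : vec2 (u 0 0) (u 0 1) = u.
Proof. by apply/rowP; apply: ord2P; rewrite mxE. Qed.

Lemma normr_coord_le n (u : 'rV[R]_n) i : `|u 0 i| <= `|u|.
Proof.
rewrite [leRHS]/Num.Def.normr/= mx_normrE.
exact: (le_bigmax _ (fun k : 'I_1 * 'I_n => `|u k.1 k.2|) (0, i)).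
Qed.

Lemma normr_row_le n (u : 'rV[R]_n) M : 0 <= M ->
  (forall i, `|u 0 i| <= M) -> `|u| <= M.
Proof.
move=> M0 H; rewrite [leLHS]/Num.Def.normr/= mx_normrE.
by rewrite bigmax_le //= => -[i j] _; rewrite ord1.
Qed.

Lemma vec2_continuous (T : topologicalType) (f g : T -> R) (x : T) :
  {for x, continuous f} -> {for x, continuous g} ->
  {for x, continuous (fun t => vec2 (f t) (g t))}.
Proof.
move=> cf cg; apply/cvgrPdist_le => e e0.
move/cvgrPdist_le : cf => /(_ e e0) F1; move/cvgrPdist_le : cg => /(_ e e0) G1.
near=> t; apply: normr_row_le; first exact: ltW.
by apply: ord2P; rewrite !mxE /=; near: t.
Unshelve. all: by end_near. Qed.

Lemma continuous_bounded_ball (F : 'rV[R]_2 -> R) r : continuous F ->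
  exists C, forall u, `|u| <= r -> `|F u| <= C.
Proof.
move=> cF; pose A := [set u : 'rV[R]_2 | `|u| <= r].
have cA : compact A.
  apply: bounded_closed_compact.
    by exists r; split; rewrite ?num_real // => M rM u Au; exact: le_trans Au (ltW rM).
  have -> : A = (fun u : 'rV[R]_2 => `|u|) @^-1` [set x | x <= r] by [].
  by apply: closed_comp => [u _|]; [exact: norm_continuous|exact: closed_le].
have := continuous_compact (continuous_subspaceT cF) cA.
move=> /compact_bounded[M [_ HM]]; exists (M + 1) => u Au.
by apply: (HM (M + 1)); [rewrite ltrDl|exists u].
Qed.

Definition integral_y (a b : R) (F : 'rV[R]_2 -> R) (x : R) : R :=
  \int[mu]_(y in `[a, b]) F (vec2 x y).

Lemma slice_y_continuous (F : 'rV[R]_2 -> R) x : continuous F ->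
  continuous (fun y => F (vec2 x y)).
Proof.
move=> cF y; apply: (@continuous_comp _ _ _ (fun y => vec2 x y) F); last exact: cF.
by apply: vec2_continuous; [exact: cst_continuous|exact: cvg_id].
Qed.

Lemma slice_x_continuous (F : 'rV[R]_2 -> R) y : continuous F ->
  continuous (fun x => F (vec2 x y)).
Proof.
move=> cF x; apply: (@continuous_comp _ _ _ (fun x => vec2 x y) F); last exact: cF.
by apply: vec2_continuous; [exact: cvg_id|exact: cst_continuous].
Qed.

(** The constant dominating function required to pass limits and derivatives under the integral; the
    parameter ranges over a window of half-width 1 around [x]. *)
Lemma bounded_near (a b : R) (F : 'rV[R]_2 -> R) (x : R) : continuous F ->
  exists2 C, 0 <= C & forall x' y, `]x - 1, x + 1[%classic x' -> `[a, b]%classic y ->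
    `|F (vec2 x' y)| <= C.
Proof.
move=> cF; have [C HC] := @continuous_bounded_ball F (`|x| + 1 + (`|a| + `|b|)) cF.
exists `|C| => // x' y; rewrite /= !in_itv /= => /andP[x1 x2] /andP[ay yb].
apply: (le_trans _ (ler_norm C)); apply: HC; apply: normr_row_le.
  by rewrite !addr_ge0.
apply: ord2P; rewrite mxE /=.
  rewrite ler_wpDr // ler_norml; have := ler_norm x; have := ler_norm (- x).
  rewrite normrN; lra.
rewrite ler_wpDl ?addr_ge0 // ler_norml; have := ler_norm b; have := ler_norm (- a).
by rewrite normrN; have := normr_ge0 a; have := normr_ge0 b; lra.
Qed.

Lemma integral_y_continuous (a b : R) F : continuous F -> continuous (integral_y a b F).
Proof.
move=> cF x; have [C C0 HC] := bounded_near a b x cF.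
have := @continuity_under_integral R _ _ mu (fun x y => F (vec2 x y)) `[a, b]
  (measurable_itv _) (x - 1) (x + 1).
move=> /(_ _ _ (cst C)) H.
have xI : x \in `]x - 1, x + 1[%classic.
  by rewrite inE /= in_itv /= gtrBl ltrDl ltr01.
apply: H => //.
- move=> x' _; apply: integrable_itv; exact: slice_y_continuous.
- apply: aeW => y _ x' _; exact: slice_x_continuous.
- by apply: integrable_itv; exact: cst_continuous.
- by move=> x' Ix'; apply: aeW => y Iy; exact: HC.
Qed.

Lemma integral_y_derive (a b : R) F F' : continuous F -> continuous F' ->
  (forall x y : R, is_derive x (1 : R) (fun x => F (vec2 x y)) (F' (vec2 x y))) ->
  forall x : R, is_derive x (1 : R) (integral_y a b F) (integral_y a b F' x).
Proof.
move=> cF cF' dF x; have [C C0 HC] := bounded_near a b x cF'.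
pose f x y := F (vec2 x y).
have D x' y : partial1of2 f x' y = F' (vec2 x' y).
  by rewrite partial1of2E /f; have [_ ->] := dF x' y.
have xI : `]x - 1, x + 1[%classic x.
  by rewrite /= in_itv /= gtrBl ltrDl ltr01.
have A1 x' : `]x - 1, x + 1[%classic x' -> mu.-integrable `[a, b] (EFin \o f x').
  by move=> _; apply: integrable_itv; exact: slice_y_continuous.
have A2 x' y : `]x - 1, x + 1[%classic x' -> `[a, b]%classic y ->
    derivable (f ^~ y) x' 1.
  by move=> _ _; have [] := dF x' y.
have A3 : mu.-integrable `[a, b] (EFin \o cst C).
  by apply: integrable_itv; exact: cst_continuous.
have A4 x' y : `]x - 1, x + 1[%classic x' -> `[a, b]%classic y ->
    `|partial1of2 f x' y| <= cst C y.
  by move=> h1 h2; rewrite D; exact: HC.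
have mI := measurable_itv `[a, b].
apply: DeriveDef.
  exact: (@derivable_under_integral R _ _ mu f `[a, b] mI x _ _ xI A1 A2 (cst C) (fun=> C0) A3 A4).
rewrite -derive1E.
rewrite [LHS](@differentiation_under_integral R _ _ mu f `[a, b] mI x _ _ xI A1 A2 (cst C) (fun=> C0) A3 A4).
by rewrite /integral_y; congr (Rintegral _ _ _); apply/funext => y.
Qed.

End Plane.

(** * Iterated integrals of continuous functions of compact support *)

Section Integral2.
Context {R : realType}.
Implicit Types (F G : 'rV[R]_2 -> R).

Definition supp2 (M : R) F := forall u, M < `|u| -> F u = 0.
Definition Cc2 F := continuous (F : _ -> R) /\ exists M : R, supp2 M F.
(** The order is fixed, with the second coordinate inside; independence of the order is the content
    of [integral2_fubini]. *)
Definition integral2 F : R :=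
  integral1 (fun x => integral1 (fun y => F (vec2 x y))).

Lemma supp2_le (M N : R) F : M <= N -> supp2 M F -> supp2 N F.
Proof. by move=> MN sF u Nu; apply: sF; exact: le_lt_trans Nu. Qed.

Lemma Cc2_bound F : Cc2 F -> exists2 M : R, 0 < M & supp2 M F.
Proof.
move=> [_ [M sf]]; exists (Num.max M 1); first by rewrite lt_max ltr01 orbT.
by apply: supp2_le sf; rewrite le_max lexx.
Qed.

Lemma supp2_y M F x : supp2 M F -> supp1 M (fun y => F (vec2 x y)).
Proof.
move=> sF y My; apply: sF; apply: (lt_le_trans My).
by have := normr_coord_le (vec2 x y) 1; rewrite vec2_1.
Qed.

Lemma supp2_x M F y : supp2 M F -> supp1 M (fun x => F (vec2 x y)).
Proof.
move=> sF x My; apply: sF; apply: (lt_le_trans My).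
by have := normr_coord_le (vec2 x y) 0; rewrite vec2_0.
Qed.

Lemma Cc2_slice_y F x : Cc2 F -> Cc1 (fun y => F (vec2 x y)).
Proof.
move=> [cF [M sF]]; split; first exact: slice_y_continuous.
by exists M; exact: supp2_y.
Qed.

Lemma Cc2_slice_x F y : Cc2 F -> Cc1 (fun x => F (vec2 x y)).
Proof.
move=> [cF [M sF]]; split; first exact: slice_x_continuous.
by exists M; exact: supp2_x.
Qed.

Lemma inner_integral (M : R) F x : supp2 M F ->
  integral1 (fun y => F (vec2 x y)) = integral_y (- M) M F x.
Proof. by move=> sF; apply: integral1_itv; exact: supp2_y. Qed.

Lemma integral1_0 (f : R -> R) : (forall x, f x = 0) -> integral1 f = 0.
Proof.
move=> f0; have -> : f = cst 0 by apply/funext.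
by rewrite (@integral1_primitive _ 1 _ (cst 0)) ?subrr //; exact: cst_continuous.
Qed.

Lemma Cc2_inner F : Cc2 F -> Cc1 (fun x => integral1 (fun y => F (vec2 x y))).
Proof.
move=> [cF [M sF]]; split.
  have -> : (fun x => integral1 (fun y => F (vec2 x y))) = integral_y (- M) M F.
    by apply/funext => x; exact: inner_integral.
  exact: integral_y_continuous.
exists M => x Mx; apply: integral1_0 => y.
exact: (supp2_x y sF).
Qed.

Lemma Cc2D F G : Cc2 F -> Cc2 G -> Cc2 (fun u => F u + G u).
Proof.
move=> [cF [M sF]] [cG [N sG]]; split.
  by move=> x; apply: continuousD; [exact: cF|exact: cG].
exists (Num.max M N) => u; rewrite gt_max => /andP[/sF -> /sG ->].
by rewrite addr0.
Qed.

Lemma Cc2M F G : continuous F -> Cc2 G -> Cc2 (fun u => F u * G u).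
Proof.
move=> cF [cG [N sG]]; split.
  by move=> x; apply: continuousM; [exact: cF|exact: cG].
by exists N => u /sG ->; rewrite mulr0.
Qed.

Lemma Cc2Z G (a : R) : Cc2 G -> Cc2 (fun u => a * G u).
Proof. by apply: (Cc2M (F := fun=> a)); exact: cst_continuous. Qed.

Lemma integral2D F G : Cc2 F -> Cc2 G ->
  integral2 (fun u => F u + G u) = integral2 F + integral2 G.
Proof.
move=> CF CG; rewrite /integral2 -integral1D; try exact: Cc2_inner.
congr integral1; apply/funext => x; rewrite integral1D //; exact: Cc2_slice_y.
Qed.

Lemma integral2Z F (a : R) : Cc2 F ->
  integral2 (fun u => a * F u) = a * integral2 F.
Proof.
move=> CF; rewrite /integral2 -integral1Z; last exact: Cc2_inner.
congr integral1; apply/funext => x; rewrite integral1Z //; exact: Cc2_slice_y.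
Qed.

Lemma integral2_0 F : (forall u, F u = 0) -> integral2 F = 0.
Proof. by move=> F0; do 2![apply: integral1_0 => ?]. Qed.

Lemma Cc2_0 : Cc2 (fun=> 0).
Proof. by split; [exact: cst_continuous|exists 0]. Qed.

Lemma Cc2_sum (I : Type) (r : seq I) (F : I -> 'rV[R]_2 -> R) :
  (forall i, Cc2 (F i)) -> Cc2 (fun u => \sum_(i <- r) F i u).
Proof.
move=> CF; elim: r => [|i r IH].
  by under eq_fun do rewrite big_nil; exact: Cc2_0.
by under eq_fun do rewrite big_cons; exact: Cc2D.
Qed.

Lemma integral2_sum (I : Type) (r : seq I) (F : I -> 'rV[R]_2 -> R) :
  (forall i, Cc2 (F i)) ->
  integral2 (fun u => \sum_(i <- r) F i u) = \sum_(i <- r) integral2 (F i).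
Proof.
move=> CF; elim: r => [|i r IH].
  by rewrite big_nil; apply: integral2_0 => u; rewrite big_nil.
have -> : (fun u => \sum_(j <- i :: r) F j u) =
    (fun u => F i u + \sum_(j <- r) F j u).
  by apply/funext => u; rewrite big_cons.
rewrite big_cons -IH; exact: (integral2D (CF i) (Cc2_sum r CF)).
Qed.

Lemma integral2_ge0 F : (forall u, 0 <= F u) -> 0 <= integral2 F.
Proof. by move=> F0; do 2![apply: integral1_ge0 => ?]. Qed.

Lemma integral2_gt0 F u : Cc2 F -> (forall u, 0 <= F u) -> 0 < F u ->
  0 < integral2 F.
Proof.
move=> CF F0 Fu; apply: (@integral1_gt0 _ _ (u 0 0)); first exact: Cc2_inner.
  by move=> x; exact: integral1_ge0.
apply: (@integral1_gt0 _ _ (u 0 1)); [exact: Cc2_slice_y|by []|].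
by rewrite vec2_eta.
Qed.

Lemma is_derive_slice F x y : differentiable F (vec2 x y) ->
  is_derive x (1 : R) (fun x => F (vec2 x y)) (partial 0 F (vec2 x y)) /\
  is_derive y (1 : R) (fun y => F (vec2 x y)) (partial 1 F (vec2 x y)).
Proof.
move=> dF.
have dX : differentiable (fun x => vec2 x y) x.
  apply: differentiable_row; apply: ord2P; under eq_fun do rewrite mxE /=; by [].
have dY : differentiable (fun y => vec2 x y) y.
  apply: differentiable_row; apply: ord2P; under eq_fun do rewrite mxE /=; by [].
split; (apply: DeriveDef; first by apply/derivable1_diffP; exact: differentiable_comp).
  rewrite (@derive_comp_row _ R _ _ _ _ (1 : R) dX dF) big_ord_recl big_ord1.
  have -> : (fun t : R => vec2 t y 0 ord0) = id by apply/funext => t; rewrite mxE.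
  rewrite derive_id mulr1.
  have -> : (fun t : R => vec2 t y 0 (lift ord0 ord0)) = cst y.
    by apply/funext => t; rewrite mxE.
  by rewrite derive_cst mulr0 addr0.
rewrite (@derive_comp_row _ R _ _ _ _ (1 : R) dY dF) big_ord_recl big_ord1.
have -> : (fun t : R => vec2 x t 0 ord0) = cst x by apply/funext => t; rewrite mxE.
rewrite derive_cst mulr0 add0r.
have -> : (fun t : R => vec2 x t 0 (lift ord0 ord0)) = id.
  by apply/funext => t; rewrite mxE.
rewrite derive_id mulr1; congr (partial _ _ _); exact: val_inj.
Qed.

Lemma supp2_partial M F i : supp2 M F -> supp2 M (partial i F).
Proof.
move=> sF u Mu; transitivity (partial i (fun=> 0 : R) u); last first.
  by rewrite /partial derive_cst.
apply: partial_near.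
have : nbhs u [set v : 'rV[R]_2 | M < `|v|].
  apply: (@norm_continuous _ _ u [set x | M < x]); exact: lt_nbhsr.
by apply: filterS => v; exact: sF.
Qed.

Lemma Ck_continuousT k F : Ck k setT F -> continuous F.
Proof. by move=> CF u; exact: (Ck_continuous CF). Qed.

Lemma Cc2_partial F i : Ck 1 setT F -> (exists M, supp2 M F) -> Cc2 (partial i F).
Proof.
move=> [dF DF] [M sF]; split; first exact: (@Ck_continuousT 0 _ (DF i)).
by exists M; exact: supp2_partial.
Qed.

(** For the inner variable the inner integral already vanishes; for the outer one the derivative is
    first moved outside the inner integral. *)
Lemma integral2_partial G i : Ck 1 setT G -> (exists M, supp2 M G) ->
  integral2 (partial i G) = 0.
Proof.
move=> CG eG; have CcG : Cc2 G by split=> //; exact: Ck_continuousT CG.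
have [M M0 sG] := Cc2_bound CcG.
have D x y := is_derive_slice (CG.1 (vec2 x y) I).
have cP j := @Ck_continuousT 0 _ (CG.2 j).
have sP j := supp2_partial j sG.
(* [supp2 M] says nothing where [|u| = M], so the endpoints are taken at distance [M + 1]. *)
have N0 : M + 1 > M by rewrite ltrDl.
have N1 : 0 < M + 1 by rewrite (lt_trans M0).
have aN : `|M + 1| = M + 1 by rewrite gtr0_norm.
move: i; apply: ord2P.
  have E : integral2 (partial 0 G) = integral1 (integral_y (- M) M (partial 0 G)).
    by congr integral1; apply/funext => x; exact: inner_integral.
  have D1 x : is_derive x (1 : R) (integral_y (- M) M G) (integral_y (- M) M (partial 0 G) x).
    apply: integral_y_derive => //; first exact: Ck_continuousT CG.
    by move=> x' y; have [] := D x' y.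
  have s1 : supp1 (M + 1) (integral_y (- M) M (partial 0 G)).
    move=> x Mx; rewrite -inner_integral //; apply: integral1_0 => y.
    by rewrite (supp2_x y (sP 0)) // (lt_trans N0).
  rewrite E (integral1_primitive N1 (integral_y_continuous (cP 0)) s1 D1).
  by rewrite -!inner_integral // !integral1_0 ?subrr // => y;
    rewrite (supp2_x y sG) // ?normrN aN.
apply: integral1_0 => x.
have D1 y : is_derive y (1 : R) (fun y => G (vec2 x y)) (partial 1 G (vec2 x y)).
  by have [] := D x y.
have s1 : supp1 (M + 1) (fun y => partial 1 G (vec2 x y)).
  by apply: supp2_y; exact: supp2_le (ltW N0) _.
rewrite (integral1_primitive N1 (slice_y_continuous (cP 1)) s1 D1).
by rewrite !(supp2_y x sG) ?normrN ?aN // subrr.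
Qed.

End Integral2.

(** * Primitives in the first variable, and Fubini's theorem *)

Section Fubini.
Context {R : realType}.
Local Notation mu := (@lebesgue_measure R).
Implicit Types (F G h : 'rV[R]_2 -> R).

(** Changing one coordinate at a time, the mean value theorem turns the increment into partial
    derivatives at points within [|h|] of [u], where [p] and [q] are close to their values at
    [u]. *)
Lemma C1_differentiable F (p q : 'rV[R]_2 -> R) : continuous p -> continuous q ->
  (forall x y : R, is_derive x (1 : R) (fun x => F (vec2 x y)) (p (vec2 x y))) ->
  (forall x y : R, is_derive y (1 : R) (fun y => F (vec2 x y)) (q (vec2 x y))) ->
  forall u, differentiable F u /\ partial 0 F u = p u /\ partial 1 F u = q u.
Proof.
move=> cp cq dx dy u.
pose df (h : 'rV[R]_2) : R := p u * h 0 0 + q u * h 0 1.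
have ldf : linear df.
  by move=> a v w; rewrite /df !mxE /GRing.scale /=; ring.
pose L : {linear 'rV[R]_2 -> R} := HB.pack df (GRing.isLinear.Build _ _ _ _ _ ldf).
have cL : continuous L.
  move=> v; apply: (@continuousD _ _ _ (fun h : 'rV[R]_2 => p u * h 0 0)
    (fun h : 'rV[R]_2 => q u * h 0 1)).
    by apply: (@continuousM _ _ (fun=> p u) (fun h : 'rV[R]_2 => h 0 0));
      [exact: cst_continuous|exact: coord_continuous].
  by apply: (@continuousM _ _ (fun=> q u) (fun h : 'rV[R]_2 => h 0 1));
    [exact: cst_continuous|exact: coord_continuous].
have M1 (f df' : R -> R) (a b : R) : (forall x : R, is_derive x (1 : R) f (df' x)) ->
    exists2 c, `|c - a| <= `|b - a| & f b - f a = df' c * (b - a).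
  move=> H; have ct t : {for t, continuous f}.
    by apply/differentiable_continuous/derivable1_diffP; have [] := H t.
  have cW : continuous f by [].
  have [ab|ab|<-] := ltgtP a b.
  - have [c] := MVT ab (fun t _ => H t) (continuous_subspaceT cW).
    rewrite in_itv /= => /andP[ac cb] E; exists c => //.
    by rewrite !gtr0_norm ?subr_gt0 // lerD2r ltW.
  - have [c] := MVT ab (fun t _ => H t) (continuous_subspaceT cW).
    rewrite in_itv /= => /andP[ac cb] E; exists c.
      by rewrite !ltr0_norm ?subr_lt0 // lerN2 lerD2r ltW.
    by rewrite -[LHS]opprB E -mulrN opprB.
  - by exists a; rewrite ?subrr ?mulr0.
have [dF dFE] : differentiable F u /\ 'd F u = L :> (_ -> _).
  apply: differentiable_epsP => // e e0.
  have e2 : 0 < e / 2 by rewrite divr_gt0.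
  have /nbhs_ballP[r /= r0 Hr] : \forall v \near u, `|p u - p v| <= e / 2 /\ `|q u - q v| <= e / 2.
    near=> v; split; near: v.
      by move/cvgrPdist_le : (cp u) => /(_ _ e2).
    by move/cvgrPdist_le : (cq u) => /(_ _ e2).
  have H (h : 'rV[R]_2) : `|h| < r -> `|F (h + u) - (F u + L h)| <= e * `|h|.
    move=> hr.
    have [c1 Hc1 E1] := M1 (fun x => F (vec2 x ((h + u) 0 1))) _ (u 0 0) ((h + u) 0 0) (fun x => dx x ((h + u) 0 1)).
    have [c2 Hc2 E2] := M1 (fun y => F (vec2 (u 0 0) y)) _ (u 0 1) ((h + u) 0 1) (fun y => dy (u 0 0) y).
    rewrite vec2_eta in E1; rewrite vec2_eta in E2.
    have hu i : (h + u) 0 i - u 0 i = h 0 i by rewrite mxE addrK.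
    rewrite hu in E1 Hc1; rewrite hu in E2 Hc2.
    have -> : F (h + u) - (F u + L h) = (p (vec2 c1 ((h + u) 0 1)) - p u) * h 0 0
        + (q (vec2 (u 0 0) c2) - q u) * h 0 1.
      rewrite /L /= /df.
      have -> : F (h + u) = F u + q (vec2 (u 0 0) c2) * h 0 1 + p (vec2 c1 ((h + u) 0 1)) * h 0 0.
        rewrite -E1 -E2; ring.
      ring.
    have B1 : ball u r (vec2 c1 ((h + u) 0 1)).
      rewrite -ball_normE /=; apply: (le_lt_trans _ hr).
      apply: normr_row_le => //; apply: ord2P; rewrite !mxE /=.
        by rewrite distrC (le_trans Hc1) // normr_coord_le.
      by rewrite opprD addrCA subrr addr0 normrN normr_coord_le.
    have B2 : ball u r (vec2 (u 0 0) c2).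
      rewrite -ball_normE /=; apply: (le_lt_trans _ hr).
      apply: normr_row_le => //; apply: ord2P; rewrite !mxE /=.
        by rewrite subrr normr0.
      by rewrite distrC (le_trans Hc2) // normr_coord_le.
    have [P1 _] := Hr _ B1; have [_ P2] := Hr _ B2.
    apply: (le_trans (ler_normD _ _)); rewrite !normrM.
    rewrite [e]splitr mulrDl; apply: lerD; rewrite ler_pM // ?normr_coord_le // distrC //.
  apply/nbhs_ballP; exists r => //= h; rewrite -ball_normE /= sub0r normrN => hr.
  exact: H.
split=> //; rewrite /partial !deriveE // dFE /= /df !mxE /=.
by rewrite !mulr0 !mulr1 addr0 add0r.
Unshelve. all: by end_near. Qed.

(** The 1-form [primx h dy] is a primitive of the 2-form [h dx dy]. *)
Definition primx h (v : 'rV[R]_2) : R :=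
  \int[mu]_(s in `]-oo, v 0 0]) h (vec2 s (v 0 1)).

Lemma primx_derive_x h : Cc2 h -> forall x y : R,
  is_derive x (1 : R) (fun x => primx h (vec2 x y)) (h (vec2 x y)).
Proof.
move=> Ch x y; have [M M0 sf] := Cc1_bound (Cc2_slice_x y Ch).
have -> : (fun x => primx h (vec2 x y)) =
    (fun x => \int[mu]_(t in `]-oo, x]) h (vec2 t y)).
  by apply/funext => t; rewrite /primx vec2_0 vec2_1.
by apply: (is_derive_primitive M0 _ sf); exact: (Cc2_slice_x y Ch).1.
Qed.

(** Replaces the half-line by a bounded interval and exchanges the coordinates, so that the results
    on [integral_y] give the behaviour of [primx] in its second variable. *)
Lemma primx_itv M h (x y : R) : supp2 M h ->
  primx h (vec2 x y) = integral_y (- M) x (fun u : 'rV[R]_2 => h (vec2 (u 0 1) (u 0 0))) y.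
Proof.
move=> sh; rewrite /primx /integral_y vec2_0 vec2_1.
rewrite Rintegral_mkcond [RHS]Rintegral_mkcond; congr (Rintegral _ _ _).
apply/funext => t; rewrite !patchE vec2_0 vec2_1.
have [tM|tM] := ltP t (- M); last first.
  congr (if _ then _ else _); apply/idP/idP; rewrite !inE /= !in_itv /=.
    by move=> ->; rewrite tM.
  by move=> /andP[].
have -> : h (vec2 t y) = 0.
  by apply: (supp2_x y sh); rewrite -normrN (lt_le_trans _ (ler_norm _)) // ltrNr.
by rewrite !if_same.
Qed.

Lemma swap_continuous h : continuous h ->
  continuous (fun u : 'rV[R]_2 => h (vec2 (u 0 1) (u 0 0))).
Proof.
move=> ch u.
apply: (@continuous_comp _ _ _ (fun u : 'rV[R]_2 => vec2 (u 0 1) (u 0 0)) h); last exact: ch.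
by apply: vec2_continuous; exact: coord_continuous.
Qed.

Lemma Cc2_globally_bounded h : Cc2 h -> exists2 C, 0 <= C & forall u, `|h u| <= C.
Proof.
move=> Ch; have [M M0 sh] := Cc2_bound Ch.
have [C HC] := continuous_bounded_ball M Ch.1.
exists `|C| => // u; have [uM|uM] := leP `|u| M.
  by rewrite (le_trans (HC u uM)) // ler_norm.
by rewrite sh // normr0.
Qed.

(** Joint continuity: the function is Lipschitz in the first variable, with a constant [C]
    independent of the second, and continuous in the second for a fixed first. *)
Lemma primx_continuous h : Cc2 h -> continuous (primx h).
Proof.
move=> Ch; have [C C0 HC] := Cc2_globally_bounded Ch.
suff H (u : 'rV[R]_2) : primx h v @[v --> u] --> primx h u by move=> u; exact: H.
have [M M0 sh] := Cc2_bound Ch.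
have lip (x x' y : R) : `|primx h (vec2 x y) - primx h (vec2 x' y)| <= C * `|x - x'|.
  wlog xx' : x x' / x' < x => [H|].
    have [xx'|xx'|->] := ltgtP x x'; first by rewrite distrC (distrC x); exact: H.
    - exact: H.
    - by rewrite !subrr normr0 mulr0.
  have dP t := primx_derive_x Ch t y.
  have cW : continuous (fun x => primx h (vec2 x y)).
    move=> t; apply/differentiable_continuous/derivable1_diffP; by have [] := dP t.
  have [c _ ->] := MVT xx' (fun t _ => dP t) (continuous_subspaceT cW).
  by rewrite normrM ler_wpM2r.
have cy : continuous (fun y => primx h (vec2 (u 0 0) y)).
  under eq_fun do rewrite (primx_itv _ _ sh).
  by apply: integral_y_continuous; apply: swap_continuous; exact: Ch.1.
apply/(@cvgrPdist_le _ _ _ (nbhs u) (nbhs_filter u)) => e e0.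
have e2 : 0 < e / 2 by rewrite divr_gt0.
have C1 : 0 < C + 1 by rewrite ltr_wpDl.
have e3 : 0 < e / 2 / (C + 1) by rewrite divr_gt0.
have A1 : \forall v \near u, `|primx h u - primx h (vec2 (u 0 0) ((v : 'rV[R]_2) 0 1))| <= e / 2.
  apply: (@coord_continuous R 1 2 0 1 u [set y | `|primx h u - primx h (vec2 (u 0 0) y)| <= e / 2]).
  by move/cvgrPdist_le : (cy (u 0 1)) => /(_ _ e2); rewrite vec2_eta.
have A2 : \forall v \near u, `|u 0 0 - (v : 'rV[R]_2) 0 0| <= e / 2 / (C + 1).
  apply: (@coord_continuous R 1 2 0 0 u [set y | `|u 0 0 - y| <= e / 2 / (C + 1)]).
  have /cvgrPdist_le/(_ _ e3) := (@cvg_id _ (nbhs (u 0 0))); exact.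
apply: (@filterS2 _ _ (nbhs_filter u) _ _ _ _ A1 A2) => v H1 H2.
have -> : primx h u - primx h v =
    (primx h u - primx h (vec2 (u 0 0) (v 0 1))) +
    (primx h (vec2 (u 0 0) (v 0 1)) - primx h (vec2 (v 0 0) (v 0 1))).
  by rewrite (vec2_eta v) addrA subrK.
apply: (le_trans (ler_normD _ _)); rewrite [e]splitr; apply: (lerD H1).
apply: (le_trans (lip _ _ _)); apply: (@le_trans _ _ ((C + 1) * `|u 0 0 - v 0 0|)).
  by rewrite ler_wpM2r // lerDl.
by rewrite mulrC -ler_pdivlMr.
Qed.

Lemma primx_derive_y h : Ck 1 setT h -> Cc2 h -> forall x y : R,
  is_derive y (1 : R) (fun y => primx h (vec2 x y)) (primx (partial 1 h) (vec2 x y)).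
Proof.
move=> kh Ch x y; have [M M0 sh] := Cc2_bound Ch.
rewrite (primx_itv _ _ (supp2_partial 1 sh)).
have -> : (fun y => primx h (vec2 x y)) =
    integral_y (- M) x (fun u : 'rV[R]_2 => h (vec2 (u 0 1) (u 0 0))).
  by apply/funext => t; rewrite (primx_itv _ _ sh).
apply: integral_y_derive.
- by apply: swap_continuous; exact: Ch.1.
- by apply: swap_continuous; exact: (@Ck_continuousT _ 0 _ (kh.2 1)).
move=> a b; rewrite !vec2_0 !vec2_1.
have -> : (fun t => h (vec2 (vec2 t b 0 1) (vec2 t b 0 0))) = fun t => h (vec2 b t).
  by apply/funext => t; rewrite vec2_0 vec2_1.
by have [] := is_derive_slice (kh.1 (vec2 b a) I).
Qed.

Lemma primx_C1 h : Ck 1 setT h -> Cc2 h ->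
  Ck 1 setT (primx h) /\ forall u, partial 0 (primx h) u = h u.
Proof.
move=> kh Ch.
have Cp : Cc2 (partial 1 h) by apply: Cc2_partial => //; exact: Ch.2.
have D := C1_differentiable Ch.1 (primx_continuous Cp) (primx_derive_x Ch) (primx_derive_y kh Ch).
split; last by move=> u; have [_ []] := D u.
split=> [u _|]; first by have [] := D u.
apply: ord2P => u _.
  have -> : partial 0 (primx h) = h by apply/funext => v; have [_ []] := D v.
  exact: Ch.1.
have -> : partial 1 (primx h) = primx (partial 1 h).
  by apply/funext => v; have [_ []] := D v.
exact: primx_continuous.
Qed.

(** The [y]-integral of [primx F] is a primitive of the inner integral of [F]. At [x = - (M + 1)] it
    vanishes, and at [x = M + 1] it is the integral taken in the other order. *)
Lemma integral2_fubini F : Cc2 F ->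
  integral2 F = integral1 (fun y => integral1 (fun x => F (vec2 x y))).
Proof.
move=> CF; have [M M0 sF] := Cc2_bound CF.
have N0 : M < M + 1 by rewrite ltrDl.
have N1 : 0 < M + 1 by rewrite (lt_trans M0).
have aN : `|M + 1| = M + 1 by rewrite gtr0_norm.
have cP := primx_continuous CF.
have dP := integral_y_derive (- M) M cP CF.1 (primx_derive_x CF).
have sI : supp1 (M + 1) (integral_y (- M) M F).
  move=> x Mx; rewrite -inner_integral //; apply: integral1_0 => y.
  by rewrite (supp2_x y sF) // (lt_trans N0).
have -> : integral2 F = integral1 (integral_y (- M) M F).
  by congr integral1; apply/funext => x; exact: inner_integral.
rewrite (integral1_primitive N1 (integral_y_continuous CF.1) sI dP).
have z y : primx F (vec2 (- (M + 1)) y) = 0.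
  rewrite /primx vec2_0 vec2_1 Rintegral_mkcond.
  rewrite -[RHS](@integral1_0 R (fun=> 0)) //; congr (Rintegral _ _ _).
  apply/funext => t; rewrite patchE; case: ifPn => //; rewrite inE /= in_itv /= => tM.
  by rewrite (supp2_x y sF) // -normrN (lt_le_trans _ (ler_norm _)) // (lt_le_trans N0) // lerNr.
have sP x : supp1 M (fun y => primx F (vec2 x y)).
  move=> y My; rewrite /primx vec2_0 vec2_1 Rintegral_mkcond.
  rewrite -[RHS](@integral1_0 R (fun=> 0)) //; congr (Rintegral _ _ _).
  by apply/funext => t; rewrite patchE; case: ifPn => // _; rewrite (supp2_y t sF).
rewrite /integral_y -!integral1_itv // [X in _ - X]integral1_0 // subr0.
congr integral1; apply/funext => y.
rewrite /primx vec2_0 vec2_1 Rintegral_mkcond; congr (Rintegral _ _ _).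
apply/funext => t; rewrite patchE; case: ifPn => //.
rewrite notin_setE /= in_itv /= => /negP; rewrite -ltNge => tM.
by rewrite (supp2_x y sF) // (lt_le_trans _ (ler_norm _)) // (lt_trans N0).
Qed.

End Fubini.

(** * Affine changes of variables *)

Section Affine.
Context {R : realType}.
Implicit Types (F G h : 'rV[R]_2 -> R).

Lemma Cc2_comp F (T : 'rV[R]_2 -> 'rV[R]_2) (a b : R) : 0 <= a ->
  continuous T -> (forall u, `|u| <= a * `|T u| + b) -> Cc2 F -> Cc2 (F \o T).
Proof.
move=> a0 cT H [cF [M sF]]; split.
  by move=> u; apply: continuous_comp; [exact: cT|exact: cF].
exists (a * M + b) => u Mu /=; apply: sF; rewrite ltNge; apply/negP => TM.
by move: (lt_le_trans Mu (H u)); rewrite ltNge lerD2r ler_wpM2l.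
Qed.

(** The columns of the linear part are [(a, b)] and [(c, d)], the derivatives in the two coordinate
    directions. *)
Definition affine2 (a b c d e f : R) (u : 'rV[R]_2) : 'rV[R]_2 :=
  vec2 (a * u 0 0 + c * u 0 1 + e) (b * u 0 0 + d * u 0 1 + f).

(** Cramer's rule expresses [u] through its image; [k] bounds the entries of the inverse matrix. The
    estimate keeps supports compact under composition. *)
Lemma affine2_proper (a b c d e f : R) : a * d - b * c != 0 ->
  exists2 k, 0 <= k & forall u,
    `|u| <= k * `|affine2 a b c d e f u| + k * (`|e| + `|f|).
Proof.
set D := a * d - b * c => D0.
pose k := (`|a| + `|b| + `|c| + `|d|) / `|D|.
have k0 : 0 <= k by rewrite divr_ge0 // !addr_ge0.
exists k => // u.
set v := affine2 a b c d e f u.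
have v0 : v 0 0 = a * u 0 0 + c * u 0 1 + e by rewrite vec2_0.
have v1 : v 0 1 = b * u 0 0 + d * u 0 1 + f by rewrite vec2_1.
have E0 : u 0 0 = (d * (v 0 0 - e) - c * (v 0 1 - f)) / D.
  by rewrite v0 v1; move: D0; rewrite /D => D0; field.
have E1 : u 0 1 = (a * (v 0 1 - f) - b * (v 0 0 - e)) / D.
  by rewrite v0 v1; move: D0; rewrite /D => D0; field.
have N : 0 <= k * `|v| + k * (`|e| + `|f|) by rewrite addr_ge0 // mulr_ge0 // addr_ge0.
have B (p q x y : R) : `|p| + `|q| <= `|a| + `|b| + `|c| + `|d| ->
    `|x| <= `|v| + (`|e| + `|f|) -> `|y| <= `|v| + (`|e| + `|f|) ->
    `|(p * x - q * y) / D| <= k * `|v| + k * (`|e| + `|f|).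
  move=> pq xv yv; rewrite -mulrDr normrM normfV /k mulrAC ler_wpM2r ?invr_ge0 //.
  apply: (le_trans (ler_normB _ _)); rewrite !normrM.
  apply: (@le_trans _ _ ((`|p| + `|q|) * (`|v| + (`|e| + `|f|)))).
    by rewrite mulrDl lerD // ler_wpM2l.
  by rewrite ler_wpM2r // !addr_ge0.
have ve : `|v 0 0 - e| <= `|v| + (`|e| + `|f|).
  by apply: (le_trans (ler_normB _ _)); rewrite lerD ?normr_coord_le // lerDl.
have vf : `|v 0 1 - f| <= `|v| + (`|e| + `|f|).
  by apply: (le_trans (ler_normB _ _)); rewrite lerD ?normr_coord_le // lerDr.
have := (normr_ge0 a, normr_ge0 b, normr_ge0 c, normr_ge0 d) => -[[[a0 b0] c0] d0].
apply: normr_row_le => //; apply: ord2P; [rewrite E0|rewrite E1]; apply: B => //; lra.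
Qed.

Lemma affine2_continuous (a b c d e f : R) : continuous (affine2 a b c d e f).
Proof.
move=> u; have L (p q r : R) : {for u, continuous (fun u : 'rV[R]_2 => p * u 0 0 + q * u 0 1 + r)}.
  have C k i : Ck k setT (fun u : 'rV[R]_2 => u 0 i) by apply: Ck_coord; exact: openT.
  have oT := @openT 'rV[R]_2.
  apply: (@Ck_continuous _ _ 0 setT) => //.
  apply: CkD => //; last exact: (Ck_cst 0).
  by apply: CkD => //; apply: CkM => //; try exact: (Ck_cst 0); exact: (C 0%N).
exact: (vec2_continuous (L a c e) (L b d f)).
Qed.

Lemma Cc2_affine F (a b c d e f : R) : a * d - b * c != 0 -> Cc2 F ->
  Cc2 (F \o affine2 a b c d e f).
Proof.
move=> D0; have [k k0 H] := affine2_proper e f D0.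
by apply: Cc2_comp k0 _ H; exact: affine2_continuous.
Qed.

(** If [a] is nonzero, the map factors through [x |-> a * x + c * y + e] at fixed [y] and the
    triangular map defining [G], with [D = (a * d - b * c) / a]; each factor is a substitution in
    one variable, with Fubini in between. If [a = 0], then [b] and [c] are nonzero and the two
    substitutions are made after exchanging the order of integration. *)
Lemma integral2_affine F (a b c d e f : R) : a * d - b * c != 0 -> Cc2 F ->
  integral2 (F \o affine2 a b c d e f) * `|a * d - b * c| = integral2 F.
Proof.
move=> D0 CF; have CT := Cc2_affine e f D0 CF.
have [a0|a0] := eqVneq a 0.
  have b0 : b != 0 by apply: contra_neq D0 => ->; rewrite a0; ring.
  have c0 : c != 0 by apply: contra_neq D0 => ->; rewrite a0; ring.
  rewrite (integral2_fubini CT).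
  have E y : integral1 (fun x => (F \o affine2 a b c d e f) (vec2 x y)) =
      `|b|^-1 * integral1 (fun t => F (vec2 (c * y + e) t)).
    have := integral1_affine (d * y + f) b0 (Cc2_slice_y (c * y + e) CF).
    move=> <-; rewrite mulrC mulfK ?normr_eq0 //.
    congr integral1; apply/funext => x /=; congr F; rewrite /affine2 vec2_0 vec2_1 a0.
    by congr vec2; ring.
  have -> : (fun y => integral1 (fun x => (F \o affine2 a b c d e f) (vec2 x y))) =
      (fun y => `|b|^-1 * integral1 (fun t => F (vec2 (c * y + e) t))).
    by apply/funext.
  have C1 := Cc2_inner CF.
  have C2 : Cc1 (fun y => integral1 (fun t => F (vec2 (c * y + e) t))).
    have D1 : c * 1 - 0 * 0 != 0 by rewrite mulr1 mul0r subr0.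
    have := Cc2_inner (Cc2_affine e 0 D1 CF); congr Cc1; apply/funext => y.
    congr integral1; apply/funext => t /=; rewrite /affine2 vec2_0 vec2_1.
    by congr F; congr vec2; ring.
  rewrite integral1Z // -[RHS](integral1_affine e c0 C1) a0 mul0r sub0r normrN normrM.
  by rewrite mulrACA mulVf ?normr_eq0 // mul1r.
pose D := (a * d - b * c) / a.
have D1 : D != 0 by rewrite mulf_neq0 // invr_eq0.
pose G := F \o affine2 1 (b / a) 0 D 0 (f - b * e / a).
have CG : Cc2 G by apply: Cc2_affine => //; rewrite mul1r mulr0 subr0.
have -> : `|a * d - b * c| = `|a| * `|D| by rewrite -normrM; congr (`|_|); rewrite /D; field.
rewrite (integral2_fubini CT) mulrA.
have E y : integral1 (fun x => (F \o affine2 a b c d e f) (vec2 x y)) =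
    `|a|^-1 * integral1 (fun x => G (vec2 x y)).
  have := integral1_affine (c * y + e) a0 (Cc2_slice_x y CG).
  move=> <-; rewrite mulrC mulfK ?normr_eq0 //.
  congr integral1; apply/funext => x /=; congr F; rewrite /affine2 !vec2_0 !vec2_1.
  by congr vec2; rewrite /D; field.
have -> : (fun y => integral1 (fun x => (F \o affine2 a b c d e f) (vec2 x y))) =
    (fun y => `|a|^-1 * integral1 (fun x => G (vec2 x y))) by apply/funext.
rewrite integral1Z; last first.
  have S : 0 * 0 - 1 * 1 != 0 :> R by rewrite mulr0 mulr1 sub0r oppr_eq0 oner_neq0.
  have := Cc2_inner (Cc2_affine 0 0 S CG); congr Cc1; apply/funext => y.
  congr integral1; apply/funext => x; rewrite /comp /affine2 vec2_0 vec2_1.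
  by congr G; congr vec2; ring.
rewrite -integral2_fubini // [X in X * _ = _]mulrAC mulVf ?normr_eq0 // mul1r.
have I2 x : integral1 (fun y => G (vec2 x y)) =
    `|D|^-1 * integral1 (fun y => F (vec2 x y)).
  have := integral1_affine (b / a * x + (f - b * e / a)) D1 (Cc2_slice_y x CF).
  move=> <-; rewrite mulrC mulfK ?normr_eq0 //.
  congr integral1; apply/funext => y /=; congr F; rewrite /affine2 vec2_0 vec2_1.
  by congr vec2; ring.
rewrite /integral2.
have -> : (fun x => integral1 (fun y => G (vec2 x y))) =
    (fun x => `|D|^-1 * integral1 (fun y => F (vec2 x y))) by apply/funext.
by rewrite integral1Z; [rewrite mulrAC mulVf ?normr_eq0 ?mul1r|exact: Cc2_inner].
Qed.

End Affine.

(** * Change of variables *)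

Section Schwarz.
Context {R : realType}.

Lemma MVT_is_derive (f df : R -> R) (a b : R) : a < b ->
  (forall t, a <= t <= b -> is_derive t (1 : R) f (df t)) ->
  exists2 c, a < c < b & f b - f a = df c * (b - a).
Proof.
move=> ab H.
have cf : {within `[a, b], continuous f}.
  apply: derivable_within_continuous => t; rewrite in_itv /= => tab.
  by have [] := H t tab.
have [|c] := @MVT R f df a b ab _ cf.
  by move=> t; rewrite in_itv /= => /andP[at_ tb]; apply: H; rewrite !ltW.
by rewrite in_itv /= => cab E; exists c.
Qed.

Lemma ler_distD_half (a b z e : R) :
  `|a - z| <= e / 2 -> `|b - z| <= e / 2 -> `|a - b| <= e.
Proof.
move=> az bz; apply: (le_trans (ler_distD z a b)); rewrite [e]splitr.
by apply: lerD => //; rewrite distrC.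
Qed.

(** The second difference [Delta] over a square of side [h] is [h * h] times either mixed derivative
    at some point of the square, by the mean value theorem applied in the two orders; continuity of
    both derivatives at [u] concludes. *)
Lemma schwarz (U : set 'rV[R]_2) (f : 'rV[R]_2 -> R) (u : 'rV[R]_2) : open U -> Ck 2 U f -> U u ->
  partial 0 (partial 1 f) u = partial 1 (partial 0 f) u.
Proof.
move=> oU [df D2f] Uu.
have [d0 c0] := D2f 0; have [d1 c1] := D2f 1.
apply/eqP; rewrite -subr_eq0 -normr_eq0; apply/eqP/le_anti; rewrite normr_ge0 andbT.
apply/ler_addgt0Pl => e e0; rewrite addr0.
have e2 : 0 < e / 2 by rewrite divr_gt0.
have : \forall v \near u, U v /\ (`|partial 0 (partial 1 f) u - partial 0 (partial 1 f) v| <= e / 2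
    /\ `|partial 1 (partial 0 f) u - partial 1 (partial 0 f) v| <= e / 2).
  apply: filterI; first by apply: open_nbhs_nbhs.
  apply: filterI.
    by move/cvgrPdist_le : (c1 0 u Uu) => /(_ _ e2).
  by move/cvgrPdist_le : (c0 1 u Uu) => /(_ _ e2).
move=> /nbhs_ballP[r /= r0 Hr].
pose x := u 0 0; pose y := u 0 1; pose h := r / 2.
have h0 : 0 < h by rewrite divr_gt0.
have hr : h < r by rewrite /h; lra.
have inB s t : x <= s <= x + h -> y <= t <= y + h -> ball u r (vec2 s t).
  move=> sx ty; rewrite -ball_normE /=; apply: (le_lt_trans _ hr).
  apply: normr_row_le; first exact: ltW.
  by apply: ord2P; rewrite !mxE /= distrC ger0_norm; rewrite /x /y in sx ty; lra.
have slice s t (g : 'rV[R]_2 -> R) : x <= s <= x + h -> y <= t <= y + h ->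
    (forall v, U v -> differentiable g v) -> _ :=
  fun hs ht dg => is_derive_slice (dg _ (Hr _ (inB s t hs ht)).1).
have xx : x <= x <= x + h by rewrite lexx lerDl ltW.
have xh : x <= x + h <= x + h by rewrite lexx lerDl ltW.
have yy : y <= y <= y + h by rewrite lexx lerDl ltW.
have yh : y <= y + h <= y + h by rewrite lexx lerDl ltW.
have xl : x < x + h by rewrite ltrDl.
have yl : y < y + h by rewrite ltrDl.
have W a b : a < b < a + h -> a <= b <= a + h.
  by move=> /andP[? ?]; rewrite !ltW.
pose Delta := f (vec2 (x + h) (y + h)) - f (vec2 (x + h) y)
  - (f (vec2 x (y + h)) - f (vec2 x y)).
have [c /W xc E1] := @MVT_is_derive (fun s => f (vec2 s (y + h)) - f (vec2 s y))
  (fun s => partial 0 f (vec2 s (y + h)) - partial 0 f (vec2 s y)) _ _ xl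
  (fun s hs => is_deriveB (slice s (y + h) f hs yh df).1 (slice s y f hs yy df).1).
have [d /W yd E2] := @MVT_is_derive (fun t => partial 0 f (vec2 c t))
  (fun t => partial 1 (partial 0 f) (vec2 c t)) _ _ yl
  (fun t ht => (slice c t _ xc ht d0).2).
have [d' /W yd' E3] := @MVT_is_derive (fun t => f (vec2 (x + h) t) - f (vec2 x t))
  (fun t => partial 1 f (vec2 (x + h) t) - partial 1 f (vec2 x t)) _ _ yl
  (fun t ht => is_deriveB (slice (x + h) t f xh ht df).2 (slice x t f xx ht df).2).
have [c' /W xc' E4] := @MVT_is_derive (fun s => partial 1 f (vec2 s d'))
  (fun s => partial 0 (partial 1 f) (vec2 s d')) _ _ xl
  (fun s hs => (slice s d' _ hs yd' d1).1).
have hh : h * h != 0 by rewrite mulf_neq0 // gt_eqF.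
have E : partial 1 (partial 0 f) (vec2 c d) = partial 0 (partial 1 f) (vec2 c' d').
  apply: (mulIf hh); rewrite /= in E1 E2 E3 E4.
  transitivity Delta; first by rewrite /Delta E1 E2; ring.
  transitivity (f (vec2 (x + h) (y + h)) - f (vec2 x (y + h)) -
    (f (vec2 (x + h) y) - f (vec2 x y))); first by rewrite /Delta; ring.
  by rewrite E3 E4; ring.
have [_ [_ P1]] := Hr _ (inB _ _ xc yd); have [_ [P2 _]] := Hr _ (inB _ _ xc' yd').
by apply: (ler_distD_half P2); rewrite -E; exact: P1.
Qed.

End Schwarz.

(** * Pullbacks of 1-forms and invariance under compact perturbations *)

Section ChangeOfVariables.
Context {R : realType}.
Implicit Types (f F G : 'rV[R]_2 -> R) (T : 'rV[R]_2 -> 'rV[R]_2).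

Definition coord T (i : 'I_2) : 'rV[R]_2 -> R := fun u => T u 0 i.

Definition jac2 T u : R :=
  partial 0 (coord T 0) u * partial 1 (coord T 1) u
  - partial 1 (coord T 0) u * partial 0 (coord T 1) u.

(** The components of the pullback by [T] of the 1-form [g dy]. *)
Definition pulled_form (g : 'rV[R]_2 -> R) T (i : 'I_2) : 'rV[R]_2 -> R :=
  fun u => g (T u) * partial i (coord T 1) u.

Let oT := @openT 'rV[R]_2.

Lemma Ck_row_differentiable k U T : (forall i, Ck k.+1 U (coord T i)) ->
  forall u, U u -> differentiable T u.
Proof.
by move=> CT u Uu; apply: differentiable_row => j; exact: Ck_differentiable (CT j) Uu.
Qed.

Lemma Ck_row_continuous T : (forall i, Ck 1 setT (coord T i)) -> continuous T.
Proof.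
move=> CT u; exact/differentiable_continuous/(Ck_row_differentiable CT).
Qed.

Lemma pulled_form_C1 g T i : Ck 1 setT g -> (forall i, Ck 2 setT (coord T i)) ->
  Ck 1 setT (pulled_form g T i).
Proof.
move=> Cg CT; have CgT : Ck 1 setT (g \o T).
  apply: (@Ck_comp _ _ _ 1 setT setT g T oT _ _ _ Cg); [by []| |by []].
  by move=> j; apply: CkW; exact: (CT j).
exact: (CkM oT CgT (Ck_partial i (CT 1))).
Qed.

Lemma jac2_C1 T U : open U -> (forall i, Ck 2 U (coord T i)) -> Ck 1 U (jac2 T).
Proof.
move=> oU CT; have D i j : Ck 1 U (partial j (coord T i)) by exact: Ck_partial (CT i).
exact: (CkB oU (CkM oU (D 0 0) (D 1 1)) (CkM oU (D 0 1) (D 1 0))).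
Qed.

(** Exterior differentiation commutes with pullback, applied to [d (primx f dy) = f dx dy]; the
    second derivatives of [T] cancel by symmetry. *)
Lemma pulled_form_curl f T : Ck 1 setT f -> Cc2 f ->
  (forall i, Ck 2 setT (coord T i)) -> forall u,
  partial 0 (pulled_form (primx f) T 1) u - partial 1 (pulled_form (primx f) T 0) u =
  f (T u) * jac2 T u.
Proof.
move=> kf Cf CT u; have [kg dg] := primx_C1 kf Cf.
have dT : differentiable T u by apply: (Ck_row_differentiable CT (U := setT)).
have dgT : differentiable (primx f) (T u) by exact: (Ck_differentiable kg I).
have dG : differentiable (primx f \o T) u by exact: differentiable_comp.
have dH i : differentiable (partial i (coord T 1)) u.
  exact: (Ck_differentiable (Ck_partial i (CT 1)) I).
have E i j : partial i (pulled_form (primx f) T j) u =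
    partial i (primx f \o T) u * partial j (coord T 1) u +
    primx f (T u) * partial i (partial j (coord T 1)) u.
  by rewrite (partialM i dG (dH j)).
rewrite !E (schwarz oT (CT 1)) // !partial_comp // !big_ord_recl !big_ord0 /= dg.
have -> : lift ord0 ord0 = 1 :> 'I_2 by exact: val_inj.
rewrite /jac2 /coord; ring.
Qed.

Lemma integral2B F G : Cc2 F -> Cc2 G ->
  integral2 (fun u => F u - G u) = integral2 F - integral2 G.
Proof.
move=> CF CG; have CN := Cc2Z (-1) CG.
transitivity (integral2 (fun u => F u + -1 * G u)).
  by congr integral2; apply/funext => u; rewrite mulN1r.
by rewrite integral2D // integral2Z // mulN1r.
Qed.

(* Lax's trick: the integrand is the exterior derivative of a 1-form built from
   a primitive of [f], and the two 1-forms differ by one of compact support. *)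
Lemma integral2_compact_perturbation f T L (M : R) : Ck 1 setT f -> Cc2 f ->
  (forall i, Ck 2 setT (coord T i)) -> (forall i, Ck 2 setT (coord L i)) ->
  (forall u, M < `|u| -> T u = L u) -> Cc2 (fun u => f (L u) * jac2 L u) ->
  integral2 (fun u => f (T u) * jac2 T u) = integral2 (fun u => f (L u) * jac2 L u).
Proof.
move=> kf Cf CT CL TL CfL.
have [kg _] := primx_C1 kf Cf.
pose w i u := pulled_form (primx f) T i u - pulled_form (primx f) L i u.
have nearTL u : M < `|u| -> \forall v \near u, T v = L v.
  move=> Mu; have : nbhs u [set v : 'rV[R]_2 | M < `|v|].
    apply: (@norm_continuous _ _ u [set x | M < x]); exact: lt_nbhsr.
  by apply: filterS => v; exact: TL.
have nearp u i : M < `|u| -> partial i (coord T 1) u = partial i (coord L 1) u.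
  by move=> /nearTL H; apply: partial_near; apply: filterS H => v; rewrite /coord => ->.
have kw i : Ck 1 setT (w i) by exact: (CkB oT (pulled_form_C1 i kg CT) (pulled_form_C1 i kg CL)).
have sw i : exists M, supp2 M (w i).
  by exists M => u Mu; rewrite /w /pulled_form TL // nearp // subrr.
have E u : f (T u) * jac2 T u - f (L u) * jac2 L u =
    partial 0 (w 1) u + -1 * partial 1 (w 0) u.
  have d T' (CT' : forall i, Ck 2 setT (coord T' i)) i :
      differentiable (pulled_form (primx f) T' i) u.
    exact: (Ck_differentiable (pulled_form_C1 i kg CT') I).
  have dw i j : partial j (w i) u = partial j (pulled_form (primx f) T i) u
      - partial j (pulled_form (primx f) L i) u.
    rewrite -partialN; last exact: d.
    rewrite -partialD //; [exact: d|].
    by apply: differentiableN; exact: d.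
  rewrite -(pulled_form_curl kf Cf CT u) -(pulled_form_curl kf Cf CL u) (dw 1 0) (dw 0 1).
  have alg (p q r s : R) : p - q - (r - s) = p - r + -1 * (q - s) by ring.
  exact: alg.
have CfT : Cc2 (fun u => f (T u) * jac2 T u).
  split.
    have C0 : continuous (jac2 T) by exact/Ck_continuousT/jac2_C1.
    have C1 : continuous (f \o T).
      move=> u; apply: continuous_comp; last exact: Cf.1.
      by apply: Ck_row_continuous => i; exact: CkW.
    by move=> u; apply: (@continuousM _ _ (f \o T) (jac2 T)); [exact: C1|exact: C0].
  have [M' M'0 sL] := Cc2_bound CfL; exists (Num.max M M') => u.
  rewrite gt_max => /andP[Mu M'u]; rewrite -(sL u M'u) TL // /jac2.
  congr (_ * _); have nearp0 i : partial i (coord T 0) u = partial i (coord L 0) u.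
    by apply: partial_near; apply: filterS (nearTL u Mu) => v; rewrite /coord => ->.
  by rewrite !nearp0 !nearp.
apply/eqP; rewrite -subr_eq0 -integral2B //.
under eq_fun do rewrite E.
have Cp i j : Cc2 (partial j (w i)) by exact: Cc2_partial (kw i) (sw i).
have E0 : integral2 (partial 0 (w 1)) = 0 by exact: integral2_partial (kw 1) (sw 1).
have E1 : integral2 (partial 1 (w 0)) = 0 by exact: integral2_partial (kw 0) (sw 0).
have E2 := integral2Z (-1) (Cp 0 1); rewrite E1 mulr0 in E2.
apply/eqP; apply: (etrans (integral2D (Cp 1 0) (Cc2Z (-1) (Cp 0 1)))).
by apply: (etrans (congr2 +%R E0 E2)); rewrite addr0.
Qed.

End ChangeOfVariables.

(** * Change of variables near a point of nonzero Jacobian *)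

Section LocalChange.
Context {R : realType}.
Implicit Types (f F G : 'rV[R]_2 -> R) (T : 'rV[R]_2 -> 'rV[R]_2).

Let oT := @openT 'rV[R]_2.

Definition sqdist2 (u0 u : 'rV[R]_2) : R :=
  (u 0 0 - u0 0 0) ^+ 2 + (u 0 1 - u0 0 1) ^+ 2.

Lemma Ck_sqdist2 k U u0 : open U -> Ck k U (sqdist2 u0).
Proof.
move=> oU; apply: (CkD oU); apply: (CkX _ oU); apply: (CkB oU);
  by [exact: Ck_coord|exact: Ck_cst].
Qed.

Lemma sqdist2_ge0 u0 u : 0 <= sqdist2 u0 u.
Proof. by rewrite addr_ge0 // sqr_ge0. Qed.

Lemma sqdist2_norm u0 u : `|u - u0| ^+ 2 <= sqdist2 u0 u <= 2 * `|u - u0| ^+ 2.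
Proof.
have c i : (u 0 i - u0 0 i) ^+ 2 <= `|u - u0| ^+ 2.
  rewrite -real_normK ?num_real // ler_sqr ?nnegrE //.
  by have := normr_coord_le (u - u0) i; rewrite !mxE.
apply/andP; split; last by rewrite mulr_natl mulr2n lerD.
have s0 := sqdist2_ge0 u0 u.
rewrite -[leRHS]sqr_sqrtr // ler_sqr ?nnegrE ?sqrtr_ge0 //.
have cc i : `|(u - u0) 0 i| <= Num.sqrt (sqdist2 u0 u).
  rewrite -sqrtr_sqr ler_wsqrtr // !mxE /sqdist2.
  by move: i; apply: ord2P; rewrite ?lerDl ?lerDr sqr_ge0.
by apply: normr_row_le => //; exact: sqrtr_ge0.
Qed.

(* A C^2 function equal to 1 where [sqdist2 u0 u <= r] and to 0 where it is
   at least [2 * r] *)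
Definition cutoff (r : R) u0 u : R :=
  let b1 := pospow 2 (2 * r - sqdist2 u0 u) in
  let b2 := pospow 2 (sqdist2 u0 u - r) in b1 / (b1 + b2).

Lemma pospow_ge0 k (t : R) : 0 <= pospow k t.
Proof. by rewrite exprn_ge0 // le_max lexx orbT. Qed.

Lemma pospow_gt0 k (t : R) : (0 < pospow k t) = (0 < t).
Proof.
rewrite /pospow; have [t0|t0] := ltP 0 t.
  by rewrite exprn_gt0.
by rewrite expr0n ltxx.
Qed.

Lemma pospow_le0 k (t : R) : t <= 0 -> pospow k t = 0.
Proof. by move=> t0; rewrite /pospow max_r // expr0n. Qed.

Lemma cutoff_den (r : R) u0 u : 0 < r ->
  0 < pospow 2 (2 * r - sqdist2 u0 u) + pospow 2 (sqdist2 u0 u - r).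
Proof.
move=> r0; have [h|h] := ltP (sqdist2 u0 u) (2 * r).
  by rewrite ltr_pwDl ?pospow_ge0 // pospow_gt0 subr_gt0.
by rewrite ltr_wpDl ?pospow_ge0 // pospow_gt0 subr_gt0; lra.
Qed.

Lemma Ck_cutoff (r : R) u0 : 0 < r -> Ck 2 setT (cutoff r u0).
Proof.
move=> r0.
have q : Ck 2 setT (sqdist2 u0) by exact: Ck_sqdist2.
have b1 : Ck 2 setT (fun u => pospow 2 (2 * r - sqdist2 u0 u)).
  exact: (Ck_pospow oT (CkB oT (Ck_cst 2 setT (2 * r)) q)).
have b2 : Ck 2 setT (fun u => pospow 2 (sqdist2 u0 u - r)).
  exact: (Ck_pospow oT (CkB oT q (Ck_cst 2 setT r))).
apply: (CkM oT b1); apply: (CkV oT _ (CkD oT b1 b2)).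
by move=> u _; rewrite gt_eqF // cutoff_den.
Qed.

Lemma cutoff1 (r : R) u0 u : 0 < r -> sqdist2 u0 u <= r -> cutoff r u0 u = 1.
Proof.
move=> r0 h; rewrite /cutoff; have := cutoff_den u0 u r0.
rewrite [X in _ + X]pospow_le0 ?subr_le0 // addr0 => d0.
by rewrite divff // gt_eqF.
Qed.

Lemma cutoff0 (r : R) u0 u : 2 * r <= sqdist2 u0 u -> cutoff r u0 u = 0.
Proof. by move=> h; rewrite /cutoff pospow_le0 ?mul0r // subr_le0. Qed.

Lemma cutoff_itv (r : R) u0 u : 0 < r -> 0 <= cutoff r u0 u <= 1.
Proof.
move=> r0; have d0 := cutoff_den u0 u r0.
rewrite divr_ge0 ?pospow_ge0 ?(ltW d0) //= ler_pdivrMr // mul1r lerDl pospow_ge0 //.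
Qed.

Lemma coord_affine2 (a b c d e f : R) :
  coord (affine2 a b c d e f) 0 = (fun u => a * u 0 0 + c * u 0 1 + e) /\
  coord (affine2 a b c d e f) 1 = (fun u => b * u 0 0 + d * u 0 1 + f).
Proof. by split; apply/funext => u; rewrite /coord /affine2 ?vec2_0 ?vec2_1. Qed.

Lemma Ck_linear2 k U (p q r : R) : open U ->
  Ck k U (fun u : 'rV[R]_2 => p * u 0 0 + q * u 0 1 + r).
Proof.
move=> oU; apply: (CkD oU); last exact: Ck_cst.
by apply: (CkD oU); apply: (CkM oU); by [exact: Ck_cst|exact: Ck_coord].
Qed.

Lemma Ck_affine2 k U (a b c d e f : R) : open U ->
  forall i, Ck k U (coord (affine2 a b c d e f) i).
Proof.
move=> oU; have [E0 E1] := coord_affine2 a b c d e f.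
by apply: ord2P; rewrite ?E0 ?E1; exact: Ck_linear2.
Qed.

Lemma partial_linear2 (p q r : R) i u :
  partial i (fun u : 'rV[R]_2 => p * u 0 0 + q * u 0 1 + r) u = if i == 0 then p else q.
Proof.
have dc j : differentiable (fun u : 'rV[R]_2 => u 0 j) u by exact: differentiable_coord.
have pc j : partial i (fun u : 'rV[R]_2 => u 0 j) u = (i == j)%:R.
  rewrite /partial deriveE // (@diff_coord _ _ _ id) // diff_val mxE /=.
  by rewrite eq_sym.
have dM (s : R) j : differentiable (fun u : 'rV[R]_2 => s * u 0 j) u.
  exact: (differentiableM (differentiable_cst s u) (dc j)).
have pM (s : R) j : partial i (fun u : 'rV[R]_2 => s * u 0 j) u = s * (i == j)%:R.
  rewrite (partialM i (differentiable_cst s u) (dc j)) pc.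
  by rewrite /partial (derive_cst s) mul0r add0r.
rewrite (partialD i (differentiableD (dM p 0) (dM q 1)) (differentiable_cst r u)).
rewrite (partialD i (dM p 0) (dM q 1)) !pM /partial (derive_cst r) addr0.
by move: i {pc pM}; apply: ord2P; rewrite /= ?mulr1 ?mulr0 ?addr0 ?add0r.
Qed.

Lemma jac2_affine2 (a b c d e f : R) u : jac2 (affine2 a b c d e f) u = a * d - b * c.
Proof.
have [E0 E1] := coord_affine2 a b c d e f.
by rewrite /jac2 E0 E1 !partial_linear2 /=; ring.
Qed.

Lemma normr_same_sg (x y : R) : 0 < x * y -> `|x| = Num.sg y * x.
Proof.
move=> xy; rewrite normrEsg; congr (_ * _).
have [y0|y0|y0] := ltgtP y 0.
- by rewrite !ltr0_sg // -(nmulr_lgt0 _ y0).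
- by rewrite !gtr0_sg // -(pmulr_lgt0 _ y0).
- by rewrite y0 mulr0 ltxx in xy.
Qed.

Lemma ler_dist_far3 (u v : 'rV[R]_2) (r : R) : 0 < r ->
  `|v| + 3 * r < `|u| -> 3 * r <= `|u - v|.
Proof. by move=> r0 h; have := ler_distD v u 0; rewrite !subr0; lra. Qed.

Lemma ler_dist_far (u v : 'rV[R]_2) (r : R) : 0 < r ->
  `|v| + 3 * r < `|u| -> r / 2 <= `|u - v|.
Proof. by move=> r0 /(ler_dist_far3 r0); lra. Qed.

(** Let [L] be the affine tangent map of [T] at [u0]. The map [T' = L + chi * (T - L)] is [T] near
    [u0] and [L] away from it, and still expands distances from [u0] by a definite factor. Hence
    [f \o T'] vanishes outside [Om] when [f] is supported close to [T u0], so that [F] can be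
    computed with [T']; the compact perturbation lemma then replaces [T'] by [L]. *)
Lemma integral2_change_local (U : set 'rV[R]_2) T u0 : open U -> U u0 ->
  (forall i, Ck 2 U (coord T i)) -> jac2 T u0 != 0 ->
  exists Om rho, [/\ open Om, Om `<=` U, Om u0, 0 < rho &
    forall f F, Ck 1 setT f -> (forall v, rho <= `|v - T u0| -> f v = 0) ->
      (forall u, Om u -> F u = f (T u) * `|jac2 T u|) ->
      (forall u, ~ Om u -> F u = 0) -> integral2 F = integral2 f].
Proof.
move=> oU Uu0 CT J0.
pose a := partial 0 (coord T 0) u0; pose b := partial 0 (coord T 1) u0.
pose c := partial 1 (coord T 0) u0; pose d := partial 1 (coord T 1) u0.
have JE : jac2 T u0 = a * d - b * c by rewrite /jac2 -/a -/b -/c -/d; ring.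
have D0 : a * d - b * c != 0 by rewrite -JE.
pose e := T u0 0 0 - a * u0 0 0 - c * u0 0 1.
pose f0 := T u0 0 1 - b * u0 0 0 - d * u0 0 1.
pose L := affine2 a b c d e f0.
have [k k0 Hk] := affine2_proper 0 0 D0.
have Llin u : L u - T u0 = affine2 a b c d 0 0 (u - u0).
  by apply/rowP; apply: ord2P; rewrite /L /affine2 !mxE /= /e /f0; ring.
have Lk u : `|u - u0| <= (k + 1) * `|L u - T u0|.
  rewrite Llin (le_trans (Hk _)) // !normr0 addr0 mulr0 addr0.
  by rewrite ler_wpM2r // lerDl.
have k1 : 0 < k + 1 by rewrite ltr_wpDl.
(* Half of the factor [(k + 1)^-1] by which [L] expands distances at least, so that an error of
   [eps * |u - u0|] leaves the factor [eps]. *)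
pose eps := (2 * (k + 1))^-1.
have eps0 : 0 < eps by rewrite invr_gt0 mulr_gt0.
have dT : differentiable T u0 by exact: (Ck_row_differentiable CT).
have dTE i h : 'd T u0 h 0 i =
    h 0 0 * partial 0 (coord T i) u0 + h 0 1 * partial 1 (coord T i) u0.
  have e1 j : partial j (coord T i) u0 = 'd T u0 (delta_mx 0 j) 0 i.
    rewrite /partial deriveE; last exact: differentiable_coord_comp.
    by rewrite diff_coord.
  have e2 : h = h 0 0 *: delta_mx 0 0 + h 0 1 *: delta_mx 0 1.
    by apply/rowP; apply: ord2P; rewrite !mxE /= ?mulr1 ?mulr0 ?addr0 ?add0r.
  by rewrite {1}e2 linearD !linearZ !mxE !e1.
have dTL h : T u0 + 'd T u0 h = L (h + u0).
  apply/rowP; apply: ord2P; rewrite mxE dTE /L /affine2 !mxE /= /e /f0;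
    rewrite -/a -/b -/c -/d; ring.
(* The radius [3 * r] leaves room around the region [sq u < 2 * r ^+ 2], the only one where [T'] may
   differ from [L]. *)
have [r r0 Hr] : exists2 r, 0 < r & forall u, `|u - u0| < 3 * r ->
    [/\ U u, `|T u - L u| <= eps * `|u - u0| & 0 < jac2 T u * jac2 T u0].
  have N2 : \forall u \near u0, `|T u - (T u0 + 'd T u0 (u - u0))| <= eps * `|u - u0|.
    have := differentiable_eps dT eps0; rewrite [X in _ -> X](near_shift 0) /=.
    by apply: filterS => h /=; rewrite subr0 addrK.
  have N3 : \forall u \near u0, 0 < jac2 T u * jac2 T u0.
    have J2 : 0 < jac2 T u0 * jac2 T u0 by rewrite -expr2 exprn_even_gt0.
    have cJ2 := Ck_continuous (CkM oU (jac2_C1 oU CT) (Ck_cst 1 U (jac2 T u0))) Uu0.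
    exact: (cJ2 [set x | 0 < x] (lt_nbhsr J2)).
  have N : \forall u \near u0, U u /\ (`|T u - (T u0 + 'd T u0 (u - u0))| <= eps * `|u - u0| /\
      0 < jac2 T u * jac2 T u0).
    exact: filterI (open_nbhs_nbhs (conj oU Uu0)) (filterI N2 N3).
  move: N => /nbhs_ballP[r /= r0 H].
  exists (r / 3); first by rewrite divr_gt0.
  move=> u; rewrite mulrC divfK // => ur.
  have [|h1 [h2 h3]] := H u; first by rewrite -ball_normE /= distrC.
  by split => //; rewrite dTL subrK in h2.
have r2 : 0 < r ^+ 2 by rewrite exprn_gt0.
have r9 : r ^+ 2 < 9 * r ^+ 2 by lra.
have lt_sq (x y : R) : 0 <= x -> 0 < y -> x ^+ 2 < y ^+ 2 -> x < y.
  by move=> x0 y0; rewrite ltr_sqr ?nnegrE // ltW.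
pose sq := sqdist2 u0; pose chi := cutoff (r ^+ 2) u0.
have sqb u : sq u < 9 * r ^+ 2 -> `|u - u0| < 3 * r.
  have /andP[s1 _] := sqdist2_norm u0 u => s2.
  apply: lt_sq; rewrite ?mulr_gt0 //; apply: (le_lt_trans s1).
  by apply: (lt_le_trans s2); rewrite exprMn; lra.
pose T' u : 'rV[R]_2 := \row_i (L u 0 i + chi u * (T u 0 i - L u 0 i)).
have T'L u : 2 * r ^+ 2 <= sq u -> T' u = L u.
  by move=> h; apply/rowP => i; rewrite mxE /chi cutoff0 // mul0r addr0.
have T'T u : sq u <= r ^+ 2 -> T' u = T u.
  by move=> h; apply/rowP => i; rewrite mxE /chi cutoff1 // mul1r addrC subrK.
have T'E u : `|T' u - L u| <= eps * `|u - u0|.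
  have e1 : 0 <= eps * `|u - u0| by rewrite mulr_ge0 // ltW.
  have [h|h] := leP (2 * r ^+ 2) (sq u); first by rewrite T'L // subrr normr0.
  have [_ hT _] := Hr u (sqb u ltac:(lra)).
  apply: normr_row_le => // i; rewrite !mxE addrAC subrr add0r normrM.
  have /andP[c0 c1] := @cutoff_itv (r ^+ 2) u0 u r2.
  rewrite ger0_norm // -[leRHS]mul1r ler_pM //.
  by apply: (le_trans _ hT); have := normr_coord_le (T u - L u) i; rewrite !mxE.
have far u : eps * `|u - u0| <= `|T' u - T u0|.
  have := ler_distD (T' u) (L u) (T u0); rewrite (distrC (L u) (T' u)) => t1.
  have t2 : 2 * eps * `|u - u0| <= `|L u - T u0|.
    have -> : 2 * eps = (k + 1)^-1 by rewrite /eps; field; rewrite gt_eqF.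
    by rewrite ler_pdivrMl.
  by have := T'E u; lra.
pose Om := [set u | sq u < r ^+ 2].
have csq : continuous sq by apply: (@Ck_continuousT _ 2); exact: (Ck_sqdist2 2 u0 oT).
have oOm : open Om by apply: (open_comp (D := [set x | x < r ^+ 2])) => [u _|]; [exact: csq|exact: open_lt].
(* The [r / 2] absorbs the factor 2 between [sqdist2] and the square of the sup norm. *)
have sq_small u : `|T' u - T u0| < eps * (r / 2) -> sq u < r ^+ 2.
  move=> h; have : `|u - u0| < r / 2.
    by rewrite -(ltr_pM2l eps0); exact: le_lt_trans h.
  rewrite -(@ltr_sqr _ (`|u - u0|)) ?nnegrE //; last by rewrite divr_ge0 // ltW.
  have /andP[_ s2] := sqdist2_norm u0 u.
  have -> : (r / 2) ^+ 2 = r ^+ 2 / 4 by field.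
  by rewrite /sq => h2; lra.
have CL i : Ck 2 setT (coord L i) by exact: Ck_affine2.
(* [T] is regular on [U] only, so the plane is covered by the open sets [2 * r ^+ 2 < sq], where
   [T' = L], and [sq < 9 * r ^+ 2], which lies in [U]. *)
have CT' i : Ck 2 setT (coord T' i).
  apply: Ck_local => u _.
  have [h|h] := ltP (2 * r ^+ 2) (sq u).
    pose V := [set u | 2 * r ^+ 2 < sq u].
    have oV : open V by apply: (open_comp (D := [set x | 2 * r ^+ 2 < x])) => [v _|];
      [exact: csq|exact: open_gt].
    exists V => //; apply: (Ck_eq oV _ (Ck_subset (@subsetT _ V) (CL i))) => v Vv.
    by rewrite /coord T'L // ltW.
  pose V := [set u | sq u < 9 * r ^+ 2].
  have oV : open V by apply: (open_comp (D := [set x | x < 9 * r ^+ 2])) => [v _|];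
    [exact: csq|exact: open_lt].
  have VU : V `<=` U by move=> v /sqb/Hr[].
  exists V; first by rewrite /V /=; lra.
  have CTV := Ck_subset VU (CT i); have CLV := Ck_subset (@subsetT _ V) (CL i).
  have CchiV := Ck_subset (@subsetT _ V) (Ck_cutoff u0 r2).
  apply: (Ck_eq oV _ (CkD oV CLV (CkM oV CchiV (CkB oV CTV CLV)))) => v _.
  by rewrite /coord [RHS]mxE.
have sq0 : sq u0 = 0 by rewrite /sq /sqdist2 !subrr expr0n addr0.
clearbody T' chi sq.
exists Om, (eps * (r / 2)); split.
- exact: oOm.
- move=> u; rewrite /Om /= => Omu; have h : sq u < 9 * r ^+ 2 by lra.
  by have [] := Hr u (sqb u h).
- by rewrite /Om /= sq0.
- by rewrite mulr_gt0 // divr_gt0.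
move=> f F kf sf EF EF0.
have Cf : Cc2 f.
  split; first exact: Ck_continuousT kf.
  exists (`|T u0| + eps * (r / 2)) => v hv; apply: sf.
  have := ler_distD (T u0) v 0; rewrite !subr0; lra.
have CfL : Cc2 (fun u => f (L u) * jac2 L u).
  have := Cc2Z (a * d - b * c) (Cc2_affine e f0 D0 Cf); congr Cc2.
  by apply/funext => u; rewrite /L jac2_affine2 mulrC.
have farL u : `|u0| + 3 * r < `|u| -> T' u = L u.
  move=> hu; apply: T'L; rewrite leNgt; apply/negP => h.
  have h9 : sq u < 9 * r ^+ 2 by apply: (lt_le_trans h); rewrite ler_wpM2r ?ler_nat // ltW.
  by have := ler_dist_far3 r0 hu; rewrite leNgt (sqb u h9).
have key := integral2_compact_perturbation kf Cf CT' CL farL CfL.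
(* On [Om] the Jacobian keeps the sign it has at [u0], so its absolute value is [s] times itself;
   off [Om] both sides of [FE] vanish. *)
pose s := Num.sg (jac2 T u0).
have sE : s * (a * d - b * c) = `|a * d - b * c| by rewrite /s JE -normrEsg.
have FE u : F u = s * (f (T' u) * jac2 T' u).
  have [h|h] := ltP (sq u) (r ^+ 2).
    have JJ : jac2 T' u = jac2 T u.
      have nu : \forall v \near u, T' v = T v.
        have := open_nbhs_nbhs (conj oOm (h : Om u)); apply: filterS => v Omv.
        by apply: T'T; exact: ltW.
      have np i j : partial j (coord T' i) u = partial j (coord T i) u.
        by apply: partial_near; apply: filterS nu => v; rewrite /coord => ->.
      by rewrite /jac2 !np.
    rewrite (EF u h) JJ (T'T u (ltW h)) mulrCA; congr (_ * _).
    have h9 : sq u < 9 * r ^+ 2 by exact: lt_trans h r9.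
    have [_ _ Jp] := Hr u (sqb u h9); rewrite /s.
    exact: normr_same_sg.
  rewrite (EF0 u); last by rewrite /Om /= => h'; move: (lt_le_trans h' h); rewrite ltxx.
  have fz : f (T' u) = 0.
    apply: sf; rewrite leNgt; apply/negP => /sq_small h'.
    by move: (lt_le_trans h' h); rewrite ltxx.
  by rewrite fz mul0r mulr0.
have -> : F = fun u => s * (f (T' u) * jac2 T' u) by apply/funext.
have CT'c : Cc2 (fun u => f (T' u) * jac2 T' u).
  split; last first.
    exists (`|u0| + 3 * r) => u hu.
    have fz : f (T' u) = 0.
      apply: sf; apply: (le_trans _ (far u)); rewrite (ler_pM2l eps0).
      exact: ler_dist_far r0 hu.
    by rewrite fz mul0r.
  apply: (@Ck_continuousT _ 1).
  apply: (CkM oT _ (jac2_C1 oT CT')).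
  apply: (@Ck_comp _ _ _ 1 setT setT f T' oT _ _ _ kf); [by []| |by []].
  by move=> i; exact: CkW (CT' i).
rewrite (integral2Z s CT'c) key -(integral2_affine e f0 D0 Cf).
have -> : (fun u => f (L u) * jac2 L u) = (fun u => (a * d - b * c) * (f \o L) u).
  by apply/funext => u; rewrite /L jac2_affine2 mulrC.
rewrite (integral2Z _ (Cc2_affine e f0 D0 Cf)) mulrA mulrC; congr (_ * _).
exact: sE.
Qed.

End LocalChange.

(** * Charts and partitions of unity *)

(** [compact_cover] speaks of pointed spaces; the point [t] supplies that structure. *)
Lemma compact_cover_pointed (T : topologicalType) (t : T) :
  compact [set: T] -> cover_compact [set: T].
Proof.
pose T' : ptopologicalType := HB.pack (Topological.sort T) (isPointed.Build T t).
move=> cT; exact: (eq_ind _ id cT _ (congr1 (fun P => P [set: T']) (@compact_cover T'))).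
Qed.

Section Charts.
Context {R : realType} {S : surface R}.
Implicit Types (c d : chart R S) (p q : S) (F G : S -> R).

Lemma chart_invP c u : chart_codom c u -> chart_dom c (chart_inv c u) /\ c (chart_inv c u) = u.
Proof.
move=> [p dp <-]; rewrite (chart_mapK (c := c)) ?inE //.
Qed.

Lemma chart_mapE c p : chart_dom c p -> chart_inv c (c p) = p.
Proof. by move=> dp; rewrite (chart_mapK (c := c)) ?inE. Qed.

Lemma chart_codom_map c p : chart_dom c p -> chart_codom c (c p).
Proof. by move=> dp; exists p. Qed.

Lemma chart_cvg c p : chart_dom c p -> {for p, continuous c}.
Proof.
move=> dp; have := @chart_map_continuous _ _ c.
rewrite continuous_open_subspace; last exact: chart_dom_open.
by apply; rewrite inE.
Qed.

Lemma chart_inv_cvg c u : chart_codom c u -> {for u, continuous (chart_inv c)}.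
Proof.
move=> cu; have := @chart_inv_continuous _ _ c.
rewrite continuous_open_subspace; last exact: chart_codom_open.
by apply; rewrite inE.
Qed.

Lemma chart_image_open c (V : set S) : open V -> V `<=` chart_dom c -> open (c @` V).
Proof.
move=> oV Vd.
have -> : c @` V = [set u | chart_codom c u /\ V (chart_inv c u)].
  apply/seteqP; split=> [u [p Vp <-]|u [cu Vu]].
    by split; [exact/chart_codom_map/Vd|rewrite chart_mapE //; exact: Vd].
  by exists (chart_inv c u) => //; have [] := chart_invP cu.
rewrite openE => u [cu Vu]; rewrite /interior.
apply: filterI; first by apply: open_nbhs_nbhs; split => //; exact: chart_codom_open.
exact: (chart_inv_cvg cu (open_nbhs_nbhs (conj oV Vu))).
Qed.

Lemma chart_preimage_open c (W : set 'rV[R]_2) : open W ->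
  open [set p | chart_dom c p /\ W (c p)].
Proof.
move=> oW; rewrite openE => p [dp Wp]; rewrite /interior.
apply: filterI; first by apply: open_nbhs_nbhs; split => //; exact: chart_dom_open.
exact: (chart_cvg dp (open_nbhs_nbhs (conj oW Wp))).
Qed.

Lemma codom_open c : open (chart_codom c).
Proof. exact: chart_codom_open. Qed.

Definition overlap c d : set 'rV[R]_2 := c @` (chart_dom c `&` chart_dom d).

Lemma overlap_open c d : open (overlap c d).
Proof.
apply: chart_image_open; last by move=> p [].
by apply: openI; exact: chart_dom_open.
Qed.

Lemma overlapP c d u : overlap c d u ->
  [/\ chart_codom c u, chart_dom c (chart_inv c u), chart_dom d (chart_inv c u) &
     c (chart_inv c u) = u].
Proof.
by move=> [p [cp dp] <-]; rewrite chart_mapE //; split => //; exact: chart_codom_map.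
Qed.

Lemma overlap_map c d p : chart_dom c p -> chart_dom d p -> overlap c d (c p).
Proof. by move=> cp dp; exists p. Qed.

Definition transition c d : 'rV[R]_2 -> 'rV[R]_2 := d \o chart_inv c.

Lemma Ck_transition k c d i : atlas c -> atlas d ->
  Ck k (overlap c d) (coord (transition c d) i).
Proof.
move=> ac ad; apply: Ck_of_smooth; first exact: overlap_open.
exact: atlas_compatible.
Qed.

Definition SCk k F := forall c, atlas c -> Ck k (chart_codom c) (F \o chart_inv c).

Lemma SCk_continuous k F : SCk k F -> continuous F.
Proof.
move=> CF p; have [c ac dp] := atlas_cover p.
have cp := chart_codom_map dp.
have H : {for p, continuous ((F \o chart_inv c) \o c)}.
  by apply: continuous_comp; [exact: chart_cvg|exact: (Ck_continuous (CF c ac) cp)].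
have E : {near p, (F \o chart_inv c) \o c =1 F}.
  have := open_nbhs_nbhs (conj (chart_dom_open c) dp).
  by apply: filterS => q dq /=; rewrite chart_mapE.
have Fp := nbhs_singleton E; rewrite /= in Fp.
move: H; rewrite /prop_for /continuous_at /= Fp => H.
exact: cvg_trans (near_eq_cvg E) H.
Qed.

Definition off (C : set S) F := forall q, ~ C q -> F q = 0.

Definition ext c F (u : 'rV[R]_2) : R :=
  if `[< chart_codom c u >] then F (chart_inv c u) else 0.

Lemma extE c F u : chart_codom c u -> ext c F u = F (chart_inv c u).
Proof. by move=> cu; rewrite /ext asboolT. Qed.

Lemma ext_off c F (C : set S) u : off C F -> ~ (c @` (C `&` chart_dom c)) u -> ext c F u = 0.
Proof.
move=> oF nu; rewrite /ext; case: ifPn => // /asboolP cu.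
apply: oF => Cu; apply: nu; have [du ue] := chart_invP cu.
by exists (chart_inv c u).
Qed.

Hypothesis cS : compact [set: S].

Lemma closed_image c (C : set S) : closed C -> C `<=` chart_dom c -> compact (c @` C).
Proof.
move=> clC Cd; apply: continuous_compact; last exact: (subclosed_compact clC cS).
apply: continuous_subspaceW Cd _; exact: chart_map_continuous.
Qed.

(** As [S] is compact, the image of [C] is compact, hence closed in the plane. Its complement, where
    the extension is zero, and the codomain of the chart are then two open sets covering the
    plane. *)
Lemma ext_Ck k c F (C : set S) : closed C -> C `<=` chart_dom c -> off C F ->
  Ck k (chart_codom c) (F \o chart_inv c) ->
  Ck k setT (ext c F) /\ exists M : R, supp2 M (ext c F).
Proof.
move=> clC Cd oF CF; have cC := closed_image clC Cd.
have z u : ~ (c @` C) u -> ext c F u = 0.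
  by move=> nu; apply: (ext_off oF) => -[q [Cq _] qu]; apply: nu; exists q.
split; last first.
  have [M [_ HM]] := compact_bounded cC; exists (M + 1) => u Mu; apply: z => Cu.
  have h : `|u| <= M + 1 by apply: (HM (M + 1)); [rewrite ltrDl|].
  by rewrite leNgt Mu in h.
apply: Ck_local => u _; have [cu|ncu] := pselect (chart_codom c u).
  exists (chart_codom c) => //; apply: (Ck_eq (@codom_open c) _ CF) => v cv.
  by rewrite extE.
have oC : open (~` (c @` C)).
  by apply: closed_openC; apply: compact_closed => //; exact: norm_hausdorff.
exists (~` (c @` C)).
  by move=> [q Cq qu]; apply: ncu; exists q => //; exact: Cd.
by apply: (Ck_eq oC _ (Ck_cst k _ 0)) => v nv; rewrite z.
Qed.

Lemma bump_exists p (N : set S) : open N -> N p ->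
  exists (b : S -> R) (C : set S), [/\ SCk 2 b, (forall q, 0 <= b q), 0 < b p,
    closed C & C `<=` N /\ off C b].
Proof.
move=> oN Np; have [c ac dp] := atlas_cover p.
pose W := c @` (chart_dom c `&` N).
have oW : open W.
  by apply: chart_image_open; [apply: openI => //; exact: chart_dom_open|move=> q []].
have Wp : W (c p) by exists p.
have /nbhs_ballP[e /= e0 He] := open_nbhs_nbhs (conj oW Wp).
pose r := (e / 2) ^+ 2; have r0 : 0 < r by rewrite exprn_gt0 // divr_gt0.
pose B := [set u | sqdist2 (c p) u <= r].
have BW : B `<=` W.
  move=> u Bu; apply: He; rewrite -ball_normE /= distrC.
  have /andP[s1 _] := sqdist2_norm (c p) u.
  have : `|u - c p| <= e / 2.
    by rewrite -ler_sqr ?nnegrE ?divr_ge0 ?(ltW e0)//; exact: le_trans s1 Bu.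
  by move=> h; apply: (le_lt_trans h); lra.
have csq : continuous (sqdist2 (c p)).
  by apply: (@Ck_continuousT _ 2); exact: (Ck_sqdist2 2 (c p) (@openT _)).
have cB : compact B.
  apply: bounded_closed_compact.
    exists (`|c p| + e); split; first by rewrite num_real.
    move=> M hM u Bu; have /andP[s1 _] := sqdist2_norm (c p) u.
    have h : `|u - c p| <= e / 2.
      by rewrite -ler_sqr ?nnegrE ?divr_ge0 ?(ltW e0)//; exact: le_trans s1 Bu.
    have := ler_distD (c p) u 0; rewrite !subr0 => t; apply: ltW.
    apply: (le_lt_trans t); apply: (lt_trans _ hM); rewrite addrC ltrD2l.
    by apply: (le_lt_trans h); lra.
  have -> : B = sqdist2 (c p) @^-1` [set x | x <= r] by [].
  by apply: closed_comp => [u _|]; [exact: csq|exact: closed_le].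
pose C := chart_inv c @` B.
have Wc : W `<=` chart_codom c by move=> u [q [dq _] <-]; exists q.
(* The Hausdorff property enters here: the closed support is what makes the extension of [b] by zero
   regular in the other charts. *)
have clC : closed C.
  apply: compact_closed; first exact: surface_hausdorff.
  apply: continuous_compact => //; apply: continuous_subspaceW (@chart_inv_continuous _ _ c).
  by move=> u /BW/Wc.
have CN : C `<=` N `&` chart_dom c.
  by move=> q [u /BW[q' [dq' Nq'] <-] <-]; rewrite chart_mapE.
pose b q := if `[< chart_dom c q >] then pospow 2 (r - sqdist2 (c p) (c q)) else 0.
have bE q : chart_dom c q -> b q = pospow 2 (r - sqdist2 (c p) (c q)).
  by move=> dq; rewrite /b asboolT.
have offb : off C b.
  move=> q nC; rewrite /b; case: ifPn => // /asboolP dq.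
  rewrite pospow_le0 // subr_le0 leNgt; apply/negP => h; apply: nC.
  by exists (c q); [exact: ltW|rewrite chart_mapE].
exists b, C; split => //.
- move=> d ad; apply: Ck_local => u du; have [dq ue] := chart_invP du.
  have [cq|ncq] := pselect (chart_dom c (chart_inv d u)).
    have oo := @overlap_open d c.
    exists (overlap d c); first by exists (chart_inv d u).
    have CT := fun i => Ck_transition 2 i ad ac.
    have E v : overlap d c v -> pospow 2 (r - sqdist2 (c p) (transition d c v)) = (b \o chart_inv d) v.
      by move=> /overlapP[_ _ cv _]; rewrite /= bE.
    apply: (Ck_eq oo E); apply: (Ck_pospow oo); apply: (CkB oo (Ck_cst _ _ _)).
    have C2 := Ck_sqdist2 2 (c p) (@openT _).
    exact: (Ck_comp (V := setT) oo (fun _ _ => I) CT ltac:(discriminate) C2).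
  have nC : ~ C (chart_inv d u) by move=> /CN[].
  have oV : open (d @` (~` C `&` chart_dom d)).
    apply: chart_image_open; last by move=> q [].
    by apply: openI; [exact: closed_openC|exact: chart_dom_open].
  exists (d @` (~` C `&` chart_dom d)); first by exists (chart_inv d u).
  apply: (Ck_eq oV _ (Ck_cst 2 _ 0)) => v [q [nCq dq'] <-].
  by rewrite /= chart_mapE // offb.
- by move=> q; rewrite /b; case: ifP => // _; exact: pospow_ge0.
- by rewrite bE // pospow_gt0 /sqdist2 !subrr expr0n /= addr0 subr0.
- by split=> // q /CN[].
Qed.

Lemma SCkM k F G : SCk k F -> SCk k G -> SCk k (fun q => F q * G q).
Proof. by move=> CF CG c ac; exact: (CkM (@codom_open c) (CF c ac) (CG c ac)). Qed.

Lemma SCkD k F G : SCk k F -> SCk k G -> SCk k (fun q => F q + G q).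
Proof. by move=> CF CG c ac; exact: (CkD (@codom_open c) (CF c ac) (CG c ac)). Qed.

Lemma SCk_sum k (I : Type) (r : seq I) (F : I -> S -> R) :
  (forall i, SCk k (F i)) -> SCk k (fun q => \sum_(i <- r) F i q).
Proof.
by move=> CF c ac; apply: (Ck_sum _ (@codom_open c)) => i _; exact: CF.
Qed.

(** The functions are indexed by all points, and a finite list selects those that are summed, so
    that the properties of [s p] can be used without checking membership in [r]. *)
Lemma partition_of_unity (N : S -> set S) : (forall p, open (N p) /\ N p p) ->
  exists (r : seq S) (s : S -> S -> R),
    (forall p, [/\ SCk 2 (s p), forall q, 0 <= s p q &
      exists C, closed C /\ C `<=` N p /\ off C (s p)]) /\
    forall q, \sum_(p <- r) s p q = 1.
Proof.
move=> oN.
have H p : exists bC : (S -> R) * set S, [/\ SCk 2 bC.1, (forall q, 0 <= bC.1 q), 0 < bC.1 p,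
    closed bC.2 & bC.2 `<=` N p /\ off bC.2 bC.1].
  have [oNp Np] := oN p; have [b [C bC]] := bump_exists oNp Np.
  by exists (b, C).
have [f Hf] := choice H.
pose b p := (f p).1; pose C p := (f p).2.
have ob p : open [set q | 0 < b p q].
  have [Cb _ _ _ _] := Hf p.
  by apply: (open_comp (f := b p) (D := [set x | 0 < x])) => [q _|];
    [exact: SCk_continuous Cb q|exact: open_gt].
have cov : [set: S] `<=` \bigcup_(p in [set: S]) [set q | 0 < b p q].
  by move=> q _; exists q => //; have [] := Hf q.
have [p0 _] := @surface_nonempty _ S.
have cc := compact_cover_pointed p0 cS.
have [D _ covD] := cc _ _ _ (fun p _ => ob p) cov.
pose r := finmap.enum_fset D; pose B q := \sum_(p <- r) b p q.
have b0 p q : 0 <= b p q by have [_ h _ _ _] := Hf p; exact: h.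
have B0 q : 0 < B q.
  have [p /= pD bq] := covD q I; rewrite /B (big_rem p) //=.
  by rewrite ltr_pwDl // sumr_ge0.
exists r, (fun p q => b p q / B q); split=> [p|q]; last first.
  by rewrite -mulr_suml -/(B q) divff // gt_eqF // B0.
have [Cb _ _ clC [CN oC]] := Hf p; split.
- move=> c ac; rewrite /comp /=.
  have CB := SCk_sum (F := b) r (fun i => let: And5 h _ _ _ _ := Hf i in h).
  apply: (CkM (@codom_open c) (Cb c ac)).
  by apply: (CkV (@codom_open c) _ (CB c ac)) => u _; rewrite gt_eqF //; exact: B0.
- by move=> q; rewrite divr_ge0 // ltW // B0.
- by exists (C p); split=> //; split=> // q nC; rewrite /b oC // mul0r.
Qed.

End Charts.

(** * Stokes on a compact surface *)

Lemma Ck_norm (R : realType) (m k : nat) (U : set 'rV[R]_m) (f : 'rV[R]_m -> R) :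
  open U -> (forall x, U x -> f x != 0) -> Ck k U f -> Ck k U (fun x => `|f x|).
Proof.
move=> oU f0 Cf; have Cf2 := CkX 2 oU Cf.
apply: (Ck_eq oU _ (Ck_sqrt oU _ Cf2)) => x Ux; first exact: sqrtr_sqr.
by rewrite exprn_even_gt0 //= f0.
Qed.

(** * Integration in a chart against the absolute value of a nowhere zero 2-form *)

Section Density.
Context {R : realType} {S : surface R} (cS : compact [set: S]).
Context (w : chart R S -> S -> R).
Implicit Types (c d : chart R S) (p q : S) (F G : S -> R).

Context (w_C1 : forall c, atlas c -> Ck 1 (chart_codom c) (w c \o chart_inv c)).
Context (w_neq0 : forall c p, atlas c -> chart_dom c p -> w c p != 0).
Context (w_change : forall c d p, atlas c -> atlas d -> chart_dom c p -> chart_dom d p ->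
  w c p = jac2 (transition c d) (c p) * w d p).

Definition chart_integral c F : R := integral2 (ext c (fun q => F q * `|w c q|)).

Lemma density_C1 c F (C : set S) : atlas c -> closed C -> C `<=` chart_dom c ->
  off C F -> SCk 1 F ->
  Ck 1 setT (ext c (fun q => F q * `|w c q|)) /\ Cc2 (ext c (fun q => F q * `|w c q|)).
Proof.
move=> ac clC Cd oF CF; have oc := @codom_open _ _ c.
have oFw : off C (fun q => F q * `|w c q|) by move=> q /oF ->; rewrite mul0r.
have Cw : Ck 1 (chart_codom c) (fun u => `|w c (chart_inv c u)|).
  apply: (Ck_norm oc _ (w_C1 ac)) => u /chart_invP[du _]; exact: w_neq0.
have CFw : Ck 1 (chart_codom c) ((fun q => F q * `|w c q|) \o chart_inv c).
  exact: (CkM oc (CF c ac) Cw).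
have [H1 H2] := ext_Ck cS clC Cd oFw CFw.
by split=> //; split => //; exact: Ck_continuousT H1.
Qed.

Lemma chart_integral_off c F : (forall q, F q = 0) -> chart_integral c F = 0.
Proof.
by move=> F0; apply: integral2_0 => u; rewrite /ext F0 mul0r; case: ifP.
Qed.

Lemma chart_integral_sum c (I : Type) (r : seq I) (F : I -> S -> R) (C : I -> set S) :
  atlas c -> (forall i, closed (C i) /\ C i `<=` chart_dom c) ->
  (forall i, off (C i) (F i)) -> (forall i, SCk 1 (F i)) ->
  chart_integral c (fun q => \sum_(i <- r) F i q) =
  \sum_(i <- r) chart_integral c (F i).
Proof.
move=> ac HC oF CF; rewrite /chart_integral -integral2_sum.
  congr integral2; apply/funext => u; rewrite /ext.
  case: ifP => _; first by rewrite mulr_suml.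
  by rewrite big1.
by move=> i; have [clC Cd] := HC i; have [] := density_C1 ac clC Cd (oF i) (CF i).
Qed.

(** For [N] small, the support of [F] is read inside [Om] in the chart [c] and within [rho] of [d p]
    in the chart [d]; by [w_change], the density of [c] is that of [d] times the Jacobian of the
    transition. *)
Lemma chart_integral_change_local c d p : atlas c -> atlas d ->
  chart_dom c p -> chart_dom d p ->
  exists N : set S, [/\ open N, N p & forall (C : set S) F, closed C -> C `<=` N ->
    C `<=` chart_dom d -> off C F -> SCk 1 F ->
    chart_integral c F = chart_integral d F].
Proof.
move=> ac ad cp dp; have oo := @overlap_open _ _ c d.
have op := overlap_map cp dp.
have J0 : jac2 (transition c d) (c p) != 0.
  have := w_neq0 ac cp; rewrite (w_change ac ad cp dp); apply: contra_neq => ->.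
  by rewrite mul0r.
have Tp : transition c d (c p) = d p by rewrite /transition /= chart_mapE.
have [Om [rho [oOm OmU Omp rho0 H]]] :=
  integral2_change_local oo op (fun i => Ck_transition 2 i ac ad) J0.
rewrite Tp in H.
pose B := [set v : 'rV[R]_2 | `|v - d p| < rho].
have oB : open B.
  have -> : B = ball (d p) rho by apply/seteqP; split=> v; rewrite /B -ball_normE /= distrC.
  exact: ball_open.
exists ([set q | chart_dom c q /\ Om (c q)] `&` [set q | chart_dom d q /\ B (d q)]).
split.
- by apply: openI; exact: chart_preimage_open.
- by split; split => //; rewrite /B /= subrr normr0.
move=> C F clC CN Cd oF CF; apply: H.
- by have [] := density_C1 ad clC Cd oF CF.
- move=> v hv; rewrite /ext; case: ifPn => // /asboolP dv.
  have [dq qv] := chart_invP dv; have [Cq|nC] := pselect (C (chart_inv d v)).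
    have [_ [_]] := CN _ Cq; rewrite /B /= qv => h.
    by move: (lt_le_trans h hv); rewrite ltxx.
  by rewrite oF // mul0r.
- move=> u Omu; have [cu cq dq qu] := overlapP (OmU _ Omu).
  rewrite extE // /transition /= extE ?chart_mapE //; last exact: chart_codom_map.
  rewrite (w_change ac ad cq dq) qu normrM mulrA mulrAC; congr (_ * _).
- move=> u nOm; rewrite /ext; case: ifPn => // /asboolP cu.
  have [cq qu] := chart_invP cu; have [Cq|nC] := pselect (C (chart_inv c u)).
    by have [[_ h] _] := CN _ Cq; rewrite qu in h.
  by rewrite oF // mul0r.
Qed.

(** A partition of unity cuts [F] into pieces small enough for the local statement. *)
Lemma chart_integral_change c d (C : set S) F : atlas c -> atlas d -> closed C ->
  C `<=` chart_dom c -> C `<=` chart_dom d -> off C F -> SCk 1 F ->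
  chart_integral c F = chart_integral d F.
Proof.
move=> ac ad clC Cc Cd oF CF.
have HN p : exists N : set S, [/\ open N, N p & forall (C' : set S) G, closed C' ->
    C' `<=` N -> C' `<=` C -> off C' G -> SCk 1 G ->
    chart_integral c G = chart_integral d G].
  have [Cp|nCp] := pselect (C p).
    have [N [oN Np H]] := chart_integral_change_local ac ad (Cc _ Cp) (Cd _ Cp).
    exists N; split; [exact: oN|exact: Np|move=> C' G clC' C'N C'C oG CG].
    by apply: (H C' G clC' C'N _ oG CG) => q /C'C/Cd.
  (* At a point outside [C] the complement of [C] will do, since pieces supported both there and in
     [C] are zero. *)
  exists (~` C); split; [exact: closed_openC|exact: nCp|move=> C' G clC' C'N C'C oG CG].
  have G0 q : G q = 0 by apply: oG => h; exact: C'N h (C'C _ h).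
  by rewrite !chart_integral_off.
have [N HN'] := choice HN.
have [r [s [Hs s1]]] := partition_of_unity cS (fun p => let: And3 h1 h2 _ := HN' p in conj h1 h2).
have Hs' p : exists D : set S, closed D /\ D `<=` N p /\ off D (s p).
  by have [_ _] := Hs p.
have [D HD] := choice Hs'.
have E : F = fun q => \sum_(p <- r) s p q * F q.
  by apply/funext => q; rewrite -mulr_suml s1 mul1r.
have CsF p : SCk 1 (fun q => s p q * F q).
  have [h _ _] := Hs p; exact: (SCkM (fun e ae => CkW (h e ae)) CF).
have osF p : off (C `&` D p) (fun q => s p q * F q).
  move=> q nCD; have [Cq|nC] := pselect (C q); last by rewrite oF ?mulr0.
  have [_ [_ oD]] := HD p; rewrite oD ?mul0r // => Dq; exact: nCD.
have clCD p : closed (C `&` D p) by have [clD _] := HD p; exact: closedI.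
have HC p : closed (C `&` D p) /\ C `&` D p `<=` chart_dom c.
  by split; [exact: clCD|move=> q [/Cc]].
have Hd p : closed (C `&` D p) /\ C `&` D p `<=` chart_dom d.
  by split; [exact: clCD|move=> q [/Cd]].
rewrite E (chart_integral_sum r ac HC osF CsF) (chart_integral_sum r ad Hd osF CsF).
apply: eq_bigr => p _; have [_ _ H] := HN' p.
have CDN : C `&` D p `<=` N p by have [_ [DN _]] := HD p => q [_ /DN].
exact: (H (C `&` D p) _ (clCD p) CDN (fun q h => h.1) (osF p) (CsF p)).
Qed.

Lemma chart_integral_ge0 c F : (forall q, 0 <= F q) -> 0 <= chart_integral c F.
Proof.
move=> F0; apply: integral2_ge0 => u; rewrite /ext; case: ifP => // _.
by rewrite mulr_ge0.
Qed.

Lemma chart_integral_eq0 c F (C : set S) : atlas c -> closed C -> C `<=` chart_dom c ->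
  off C F -> SCk 1 F -> (forall q, 0 <= F q) -> chart_integral c F = 0 ->
  forall q, F q = 0.
Proof.
move=> ac clC Cd oF CF F0 I0 q.
have [Cq|nC] := pselect (C q); last exact: oF.
apply: contrapT => /eqP Fq; have dq := Cd q Cq.
suff : 0 < chart_integral c F by rewrite I0 ltxx.
have [_ Cc] := density_C1 ac clC Cd oF CF.
apply: (integral2_gt0 (u := c q) Cc).
  by move=> u; rewrite /ext; case: ifP => // _; rewrite mulr_ge0.
rewrite extE ?chart_mapE //; last exact: chart_codom_map.
by rewrite mulr_gt0 ?normr_gt0 ?w_neq0 // lt_neqAle eq_sym Fq F0.
Qed.

End Density.

Lemma partial_sum (R : realType) (m : nat) (I : Type) (r : seq I) (F : I -> 'rV[R]_m -> R)
    (x : 'rV[R]_m) (i : 'I_m) : (forall j, differentiable (F j) x) ->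
  partial i (fun y => \sum_(j <- r) F j y) x = \sum_(j <- r) partial i (F j) x.
Proof.
move=> dF; have H : differentiable (fun y => \sum_(j <- r) F j y) x /\
    partial i (fun y => \sum_(j <- r) F j y) x = \sum_(j <- r) partial i (F j) x.
  elim: r => [|j r [IH1 IH2]].
    have -> : (fun y => \sum_(j <- [::]) F j y) = cst 0 by apply/funext => y; rewrite big_nil.
    by rewrite big_nil /partial derive_cst; split => //; exact: differentiable_cst.
  have -> : (fun y => \sum_(k <- j :: r) F k y) = (fun y => F j y + \sum_(k <- r) F k y).
    by apply/funext => y; rewrite big_cons.
  rewrite big_cons -IH2 -partialD //; split => //; exact: (differentiableD (dF j) IH1).
exact: H.2.
Qed.

(** * A 1-form whose exterior derivative is a nonnegative multiple of the area form *)

Section Stokes.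
Context {R : realType} {S : surface R} (cS : compact [set: S]).
Context (w : chart R S -> S -> R) (eta : chart R S -> S -> 'I_2 -> R) (K : S -> R).
Implicit Types (c d : chart R S) (p q : S) (F G : S -> R).

Context (w_C1 : forall c, atlas c -> Ck 1 (chart_codom c) (w c \o chart_inv c)).
Context (w_neq0 : forall c p, atlas c -> chart_dom c p -> w c p != 0).
Context (w_change : forall c d p, atlas c -> atlas d -> chart_dom c p -> chart_dom d p ->
  w c p = jac2 (transition c d) (c p) * w d p).
Context (eta_C1 : forall c i, atlas c ->
  Ck 1 (chart_codom c) (fun u => eta c (chart_inv c u) i)).
Context (eta_change : forall c d p i, atlas c -> atlas d -> chart_dom c p -> chart_dom d p ->
  eta c p i = partial i (coord (transition c d) 0) (c p) * eta d p 0
    + partial i (coord (transition c d) 1) (c p) * eta d p 1).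
Context (K_C1 : SCk 1 K) (K_ge0 : forall q, 0 <= K q).
Context (eta_curl : forall c p, atlas c -> chart_dom c p ->
  partial 0 (fun u => eta c (chart_inv c u) 1) (c p)
  - partial 1 (fun u => eta c (chart_inv c u) 0) (c p) = K p * w c p).

(** The quotient of the 2-form [dF /\ eta] by the 2-form [w], hence a function that does not depend
    on the chart. *)
Definition wedge c F p : R :=
  (partial 0 (F \o chart_inv c) (c p) * eta c p 1
   - partial 1 (F \o chart_inv c) (c p) * eta c p 0) / w c p.

Lemma partial_transition c d F p i : atlas c -> atlas d -> chart_dom c p -> chart_dom d p ->
  SCk 1 F -> partial i (F \o chart_inv c) (c p) =
    partial 0 (F \o chart_inv d) (d p) * partial i (coord (transition c d) 0) (c p)
    + partial 1 (F \o chart_inv d) (d p) * partial i (coord (transition c d) 1) (c p).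
Proof.
move=> ac ad cp dp CF; have op := overlap_map cp dp; have oo := @overlap_open _ _ c d.
have Tp : transition c d (c p) = d p by rewrite /transition /= chart_mapE.
have E : {near c p, F \o chart_inv c =1 (F \o chart_inv d) \o transition c d}.
  have := open_nbhs_nbhs (conj oo op); apply: filterS => u /overlapP[_ _ dq _].
  by rewrite /transition /= chart_mapE.
have dT : differentiable (transition c d) (c p).
  exact: (Ck_row_differentiable (fun i => Ck_transition 1 i ac ad) op).
have dF : differentiable (F \o chart_inv d) (transition c d (c p)).
  rewrite Tp; exact: (Ck_differentiable (CF d ad) (chart_codom_map dp)).
rewrite (partial_near i E) (partial_comp i dT dF) Tp big_ord_recl big_ord1.
by have -> : lift ord0 ord0 = 1 :> 'I_2 by exact: val_inj.
Qed.

Lemma wedge_change c d F p : atlas c -> atlas d -> chart_dom c p -> chart_dom d p ->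
  SCk 1 F -> wedge c F p = wedge d F p.
Proof.
move=> ac ad cp dp CF; rewrite /wedge.
have wc := w_neq0 ac cp; have wd := w_neq0 ad dp.
rewrite (w_change ac ad cp dp) in wc *; rewrite mulf_eq0 negb_or in wc.
case/andP: wc => J0 _.
rewrite !(partial_transition _ ac ad cp dp CF) !(eta_change _ ac ad cp dp).
rewrite /jac2 in J0 *.
move: (partial 0 (coord (transition c d) 0) (c p)) (partial 1 (coord (transition c d) 0) (c p))
  (partial 0 (coord (transition c d) 1) (c p)) (partial 1 (coord (transition c d) 1) (c p))
  J0 => a b a' b' J0.
move: (partial 0 (F \o chart_inv d) (d p)) (partial 1 (F \o chart_inv d) (d p))
  (eta d p 0) (eta d p 1) (w d p) wd => x y z t v v0.
by field; rewrite v0 J0.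
Qed.

Let chart_at p : {c : chart R S | atlas c /\ chart_dom c p}.
Proof. by apply: cid; have [c ac dp] := atlas_cover p; exists c. Qed.

Let at_atlas p : atlas (sval (chart_at p)) := (svalP (chart_at p)).1.
Let at_dom p : chart_dom (sval (chart_at p)) p := (svalP (chart_at p)).2.

Definition wedge_at F p : R := wedge (sval (chart_at p)) F p.

Lemma wedge_atE c F p : atlas c -> chart_dom c p -> SCk 1 F -> wedge_at F p = wedge c F p.
Proof. move=> ac cp CF; exact: (wedge_change (at_atlas p) ac (at_dom p) cp CF). Qed.

Lemma SCkW k F : SCk k.+1 F -> SCk k F.
Proof. by move=> CF c ac; exact: CkW (CF c ac). Qed.

Lemma wedge_at_C1 F : SCk 2 F -> SCk 1 (wedge_at F).
Proof.
move=> CF c ac; have oc := @codom_open _ _ c.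
have wn u : chart_codom c u -> (w c \o chart_inv c) u != 0.
  by move=> /chart_invP[du _]; exact: w_neq0.
have H := CkM oc (CkB oc (CkM oc (Ck_partial 0 (CF c ac)) (eta_C1 1 ac))
  (CkM oc (Ck_partial 1 (CF c ac)) (eta_C1 0 ac))) (CkV oc wn (w_C1 ac)).
apply: (Ck_eq oc _ H) => u cu; have [du ue] := chart_invP cu.
by rewrite /= (wedge_atE ac du (SCkW CF)) /wedge ue.
Qed.

Lemma wedge_at_off F (C : set S) : closed C -> off C F -> off C (wedge_at F).
Proof.
move=> clC oF q nC; rewrite /wedge_at /wedge; set c := sval _.
have dq : chart_dom c q := at_dom q.
have z i : partial i (F \o chart_inv c) (c q) = 0.
  transitivity (partial i (cst 0 : 'rV[R]_2 -> R) (c q)); last by rewrite /partial derive_cst.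
  apply: partial_near.
  have oV : open (c @` (~` C `&` chart_dom c)).
    apply: chart_image_open; last by move=> x [].
    by apply: openI; [exact: closed_openC|exact: chart_dom_open].
  have Vq : (c @` (~` C `&` chart_dom c)) (c q) by exists q.
  have := open_nbhs_nbhs (conj oV Vq); apply: filterS => u [x [nCx dx] <-].
  by rewrite /= chart_mapE // oF.
by rewrite !z !mul0r subrr mul0r.
Qed.

(** The differentials of functions of constant sum add up to zero. *)
Lemma wedge_at_sum (I : Type) (r : seq I) (F : I -> S -> R) q :
  (forall i, SCk 1 (F i)) -> (forall p, \sum_(i <- r) F i p = 1) ->
  \sum_(i <- r) wedge_at (F i) q = 0.
Proof.
move=> CF F1; rewrite /wedge_at /wedge; set c := sval _.
have ac : atlas c := at_atlas q; have dq : chart_dom c q := at_dom q.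
have cq := chart_codom_map dq.
have z i : \sum_(j <- r) partial i (F j \o chart_inv c) (c q) = 0.
  rewrite -(partial_sum r i (fun j => Ck_differentiable (CF j c ac) cq)).
  transitivity (partial i (cst 1 : 'rV[R]_2 -> R) (c q)); last by rewrite /partial derive_cst.
  by congr (partial i _ _); apply/funext => u; rewrite /= F1.
by rewrite -mulr_suml sumrB -!mulr_suml !z !mul0r subrr mul0r.
Qed.

(** By the product rule the integrand is, up to the sign of [w c p], the exterior derivative of
    [F eta], a form with compact support in the chart. *)
Lemma chart_integral_curl c F (C : set S) p : atlas c -> closed C ->
  C `<=` [set q | chart_dom c q /\ 0 < w c q * w c p] -> off C F -> SCk 2 F ->
  chart_integral w c (fun q => F q * K q + wedge_at F q) = 0.
Proof.
move=> ac clC CN oF CF; have oc := @codom_open _ _ c.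
have Cd : C `<=` chart_dom c by move=> q /CN[].
pose X i := ext c (fun q => F q * eta c q i).
have oX i : off C (fun q => F q * eta c q i) by move=> q /oF ->; rewrite mul0r.
have CX i : Ck 1 setT (X i) /\ exists M : R, supp2 M (X i).
  apply: (ext_Ck cS clC Cd (oX i)).
  exact: (CkM oc (CkW (CF c ac)) (eta_C1 i ac)).
pose s := Num.sg (w c p).
have E u : ext c (fun q => (F q * K q + wedge_at F q) * `|w c q|) u =
    s * (partial 0 (X 1) u - partial 1 (X 0) u).
  have [cu|ncu] := pselect (chart_codom c u); last first.
    have z i j : partial j (X i) u = 0.
      transitivity (partial j (cst 0 : 'rV[R]_2 -> R) u); last by rewrite /partial derive_cst.
      apply: partial_near.
      have oV : open (~` (c @` C)).
        apply: closed_openC; apply: compact_closed; first exact: norm_hausdorff.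
        exact: closed_image.
      have Vu : (~` (c @` C)) u by move=> [q /Cd dq qu]; apply: ncu; exists q.
      have := open_nbhs_nbhs (conj oV Vu); apply: filterS => v nv.
      by apply: (ext_off (oX i)) => -[q [Cq _] qv]; apply: nv; exists q.
    by rewrite !z subrr mulr0 /ext asboolF.
  rewrite extE //; have [dq ue] := chart_invP cu; set q := chart_inv c u in dq ue *.
  have XE i : {near u, X i =1 (fun v => (F \o chart_inv c) v * eta c (chart_inv c v) i)}.
    have := open_nbhs_nbhs (conj oc cu); apply: filterS => v cv.
    by rewrite /X extE.
  have dF : differentiable (F \o chart_inv c) u := Ck_differentiable (CF c ac) cu.
  have de i : differentiable (fun u => eta c (chart_inv c u) i) u.
    exact: (Ck_differentiable (eta_C1 i ac) cu).
  have XP i j : partial j (X i) u = partial j (F \o chart_inv c) u * eta c q i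
      + F q * partial j (fun u => eta c (chart_inv c u) i) u.
    by rewrite (partial_near j (XE i)) (partialM j dF (de i)).
  have W0 := w_neq0 ac dq.
  have curl := eta_curl ac dq; rewrite ue in curl.
  have WE : wedge_at F q * w c q = partial 0 (F \o chart_inv c) u * eta c q 1
      - partial 1 (F \o chart_inv c) u * eta c q 0.
    by rewrite (wedge_atE ac dq (SCkW CF)) /wedge divfK // ue.
  have DE : partial 0 (X 1) u - partial 1 (X 0) u = (F q * K q + wedge_at F q) * w c q.
    rewrite mulrDl -mulrA -curl WE !XP.
    have alg (a b e f g h i : R) : a * b + e * f - (g * h + e * i) = e * (f - i) + (a * b - g * h).
      by ring.
    exact: alg.
  rewrite DE; have [Cq|nC] := pselect (C q).
    have [_ pos] := CN _ Cq; rewrite (normr_same_sg pos) /s mulrCA //.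
  by rewrite oF // (wedge_at_off clC oF) // mul0r addr0 !mul0r mulr0.
rewrite /chart_integral.
have -> : ext c (fun q => (F q * K q + wedge_at F q) * `|w c q|) =
  (fun u => s * (partial 0 (X 1) u - partial 1 (X 0) u)) by apply/funext.
have CP i j : Cc2 (partial j (X i)) by exact: Cc2_partial (CX i).1 (CX i).2.
have CB : Cc2 (fun u => partial 0 (X 1) u - partial 1 (X 0) u).
  have := Cc2D (CP 1 0) (Cc2Z (-1) (CP 0 1)); congr Cc2; apply/funext => u.
  by rewrite mulN1r.
rewrite (integral2Z s CB) (integral2B (CP 1 0) (CP 0 1)).
have z i j : integral2 (partial j (X i)) = 0 by exact: integral2_partial (CX i).1 (CX i).2.
by rewrite (z 1 0) (z 0 1) subrr mulr0.
Qed.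

(** The function [D p] is [d (s p * eta)] divided by [w]: it has integral zero in the chart [c p],
    and the [D p] add up to [K]. The partition is used a second time to compare charts. Each
    [s l * D k] is supported in both [c l] and [c k], so in the double sum it may be integrated in
    [c k] instead of [c l], where summing over [l] restores [D k]. The nonnegative functions
    [s l * K] thus have integrals of sum zero. *)
Theorem stokes_eq0 q : K q = 0.
Proof.
pose c p := sval (chart_at p).
pose N p := [set q | chart_dom (c p) q /\ 0 < w (c p) q * w (c p) p].
have ac p : atlas (c p) := at_atlas p.
have oN p : open (N p) /\ N p p.
  split; last first.
    split; first exact: at_dom.
    by rewrite -expr2 exprn_even_gt0 //= (w_neq0 (ac p) (at_dom p)).
  rewrite openE => x [dx wx]; rewrite /interior.
  have cx := chart_codom_map dx.
  have cw := Ck_continuous (CkM (@codom_open _ _ (c p)) (w_C1 (ac p)) (Ck_cst 1 _ (w (c p) p))) cx.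
  have H : {for x, continuous ((fun u => (w (c p) \o chart_inv (c p)) u * w (c p) p) \o c p)}.
    by apply: continuous_comp => //; exact: chart_cvg.
  have G : nbhs x [set y | 0 < ((fun u => (w (c p) \o chart_inv (c p)) u * w (c p) p) \o c p) y].
    by apply: (H [set t | 0 < t]); apply: lt_nbhsr; rewrite /= chart_mapE.
  apply: (filterS _ (filterI G (open_nbhs_nbhs (conj (@chart_dom_open _ _ (c p)) dx)))).
  by move=> y [/= + dy]; rewrite chart_mapE.
have [r [s [Hs s1]]] := partition_of_unity cS oN.
have Hs' p : exists D : set S, closed D /\ D `<=` N p /\ off D (s p).
  by have [_ _] := Hs p.
have [C HC] := choice Hs'.
have Cs p : SCk 2 (s p) by have [] := Hs p.
have s0 p x : 0 <= s p x by have [_ h _] := Hs p; exact: h.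
have Cd p : C p `<=` chart_dom (c p) by have [_ [CN _]] := HC p => x /CN[].
have clC p : closed (C p) by have [] := HC p.
have os p : off (C p) (s p) by have [_ []] := HC p.
pose D p x := s p x * K x + wedge_at (s p) x.
have CD p : SCk 1 (D p).
  apply: SCkD; last exact: wedge_at_C1.
  exact: (SCkM (SCkW (Cs p)) K_C1).
have oD p : off (C p) (D p).
  by move=> x nx; rewrite /D (os p) // (wedge_at_off (clC p) (os p)) // mul0r addr0.
have ID p : chart_integral w (c p) (D p) = 0.
  by have [_ [CN _]] := HC p; exact: (chart_integral_curl (ac p) (clC p) CN (os p) (Cs p)).
have SD x : \sum_(p <- r) D p x = K x.
  rewrite big_split /= -mulr_suml s1 mul1r (wedge_at_sum x (fun p => SCkW (Cs p)) s1).
  by rewrite addr0.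
pose G l k x := s l x * D k x.
have CG l k : SCk 1 (G l k) by exact: (SCkM (SCkW (Cs l)) (CD k)).
have oG l k : off (C l `&` C k) (G l k).
  move=> x nx; rewrite /G; have [h|h] := pselect (C l x); last by rewrite (os l) // mul0r.
  by rewrite (oD k) ?mulr0 // => h'; exact: nx.
have clG l k : closed (C l `&` C k) by exact: closedI.
have sK l x : s l x * K x = \sum_(k <- r) G l k x by rewrite -mulr_sumr SD.
have CsK l : SCk 1 (fun x => s l x * K x) by exact: (SCkM (SCkW (Cs l)) K_C1).
have osK l : off (C l) (fun x => s l x * K x) by move=> x /os ->; rewrite mul0r.
have sK0 l x : 0 <= s l x * K x by rewrite mulr_ge0.
have tot : \sum_(l <- r) chart_integral w (c l) (fun x => s l x * K x) = 0.
  have E1 l : chart_integral w (c l) (fun x => s l x * K x) =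
      \sum_(k <- r) chart_integral w (c k) (G l k).
    have -> : (fun x => s l x * K x) = (fun x => \sum_(k <- r) G l k x) by apply/funext.
    rewrite (chart_integral_sum cS w_C1 w_neq0 r (ac l) (C := fun k => C l `&` C k)).
    - apply: eq_bigr => k _.
      apply: (chart_integral_change cS w_C1 w_neq0 w_change (ac l) (ac k) (clG l k)).
      + by move=> x [/Cd].
      + by move=> x [_ /Cd].
      + exact: oG.
      + exact: CG.
    - by move=> k; split; [exact: clG|move=> x [/Cd]].
    - by move=> k; exact: oG.
    - by move=> k; exact: CG.
  under eq_bigr => l _ do rewrite E1.
  rewrite exchange_big /= big1 // => k _; rewrite -{2}(ID k).
  have -> : D k = (fun x => \sum_(l <- r) G l k x).
    by apply/funext => x; rewrite -mulr_suml s1 mul1r.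
  have HkD l : closed (C l `&` C k) /\ C l `&` C k `<=` chart_dom (c k).
    by split; [exact: clG|move=> x [_ /Cd]].
  by rewrite (chart_integral_sum cS w_C1 w_neq0 r (ac k) HkD (oG ^~ k) (CG ^~ k)).
have each l : l \in r -> s l q * K q = 0.
  move=> lr; apply: (chart_integral_eq0 cS w_C1 w_neq0 (ac l) (clC l) (Cd l) (osK l) (CsK l)) => //.
  apply/le_anti; rewrite chart_integral_ge0 // andbT -tot (big_rem l) //=.
  by rewrite lerDl sumr_ge0 // => k _; exact: chart_integral_ge0.
by rewrite -[LHS]mul1r -(s1 q) mulr_suml big_seq big1 // => l /each.
Qed.

End Stokes.

(** * Algebra of orthonormal frames in dimension three *)

Section VectorAlgebra.
Context {R : realType}.

Definition dot3 (a0 a1 a2 b0 b1 b2 : R) := a0 * b0 + a1 * b1 + a2 * b2.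
Definition det3 (a0 a1 a2 b0 b1 b2 c0 c1 c2 : R) :=
  a0 * (b1 * c2 - b2 * c1) + a1 * (b2 * c0 - b0 * c2) + a2 * (b0 * c1 - b1 * c0).

(** The vector [f] is [n x e], which completes [e] and [n] to an orthonormal basis. *)
Lemma orthonormal_expand (e0 e1 e2 n0 n1 n2 v0 v1 v2 : R) :
  dot3 e0 e1 e2 e0 e1 e2 = 1 -> dot3 n0 n1 n2 n0 n1 n2 = 1 ->
  dot3 e0 e1 e2 n0 n1 n2 = 0 ->
  let f0 := n1 * e2 - n2 * e1 in let f1 := n2 * e0 - n0 * e2 in
  let f2 := n0 * e1 - n1 * e0 in
  let a := dot3 v0 v1 v2 e0 e1 e2 in let b := dot3 v0 v1 v2 f0 f1 f2 in
  let c := dot3 v0 v1 v2 n0 n1 n2 in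
  [/\ v0 = a * e0 + b * f0 + c * n0, v1 = a * e1 + b * f1 + c * n1 &
      v2 = a * e2 + b * f2 + c * n2].
Proof.
move=> ee nn en f0 f1 f2 a b c.
(* Multiplying by the Gram determinant of [e] and [n], equal to 1, makes the expansion a polynomial
   identity free of side conditions. *)
have H (x y : R) : (dot3 n0 n1 n2 n0 n1 n2 * dot3 e0 e1 e2 e0 e1 e2
    - dot3 e0 e1 e2 n0 n1 n2 ^+ 2) * x = y -> x = y.
  by rewrite ee nn en expr0n /= mulr1 subr0 mul1r.
have C (x y e n f : R) : x =
    (dot3 e0 e1 e2 e0 e1 e2 * c - dot3 e0 e1 e2 n0 n1 n2 * a) * n +
    (dot3 n0 n1 n2 n0 n1 n2 * a - dot3 e0 e1 e2 n0 n1 n2 * c) * e + b * f ->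
    x = a * e + b * f + c * n.
  by rewrite ee nn en => ->; ring.
split; apply: C => //; apply: H; rewrite /a /b /c /f0 /f1 /f2 /dot3; ring.
Qed.

(** Here [p], [q] stand for the two partial derivatives of [e] and [m], [l] for those of [n].
    Expanded in the basis [e], [n x e], [n], they leave six independent coefficients, in which the
    identity is polynomial. *)
Lemma frame_curl_alg (e0 e1 e2 n0 n1 n2 p0 p1 p2 q0 q1 q2 m0 m1 m2 l0 l1 l2 : R) :
  dot3 e0 e1 e2 e0 e1 e2 = 1 -> dot3 n0 n1 n2 n0 n1 n2 = 1 ->
  dot3 e0 e1 e2 n0 n1 n2 = 0 ->
  dot3 p0 p1 p2 e0 e1 e2 = 0 -> dot3 q0 q1 q2 e0 e1 e2 = 0 ->
  dot3 m0 m1 m2 n0 n1 n2 = 0 -> dot3 l0 l1 l2 n0 n1 n2 = 0 ->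
  dot3 m0 m1 m2 e0 e1 e2 = - dot3 p0 p1 p2 n0 n1 n2 ->
  dot3 l0 l1 l2 e0 e1 e2 = - dot3 q0 q1 q2 n0 n1 n2 ->
  det3 q0 q1 q2 m0 m1 m2 e0 e1 e2 + det3 q0 q1 q2 n0 n1 n2 p0 p1 p2
  - (det3 p0 p1 p2 l0 l1 l2 e0 e1 e2 + det3 p0 p1 p2 n0 n1 n2 q0 q1 q2)
  = - det3 n0 n1 n2 m0 m1 m2 l0 l1 l2.
Proof.
move=> ee nn en pe qe mn ln me le.
have := orthonormal_expand p0 p1 p2 ee nn en.
have := orthonormal_expand q0 q1 q2 ee nn en.
have := orthonormal_expand m0 m1 m2 ee nn en.
have := orthonormal_expand l0 l1 l2 ee nn en.
rewrite /= pe qe mn ln me le !mul0r !add0r !addr0.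
set f0 := n1 * e2 - _; set f1 := n2 * e0 - _; set f2 := n0 * e1 - _.
move: (dot3 p0 p1 p2 n0 n1 n2) (dot3 q0 q1 q2 n0 n1 n2)
  (dot3 p0 p1 p2 f0 f1 f2) (dot3 q0 q1 q2 f0 f1 f2)
  (dot3 m0 m1 m2 f0 f1 f2) (dot3 l0 l1 l2 f0 f1 f2) => b b' a a' c c'.
move=> [-> -> ->] [-> -> ->] [-> -> ->] [-> -> ->].
rewrite /det3; ring.
Qed.

(** Here [a], [b] are the tangent vectors, [m], [l] the plain derivatives of the normal and [s], [t]
    its covariant derivatives in Sol_3. Passing from the former to the latter produces the sectional
    curvature [2 * n2 ^+ 2 - 1] of the tangent plane. *)
Lemma gauss_alg (a0 a1 a2 b0 b1 b2 n0 n1 n2 m0 m1 m2 l0 l1 l2 w : R) :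
  let s0 := m0 + a0 * n2 in let s1 := m1 - a1 * n2 in let s2 := m2 - a0 * n0 + a1 * n1 in
  let t0 := l0 + b0 * n2 in let t1 := l1 - b1 * n2 in let t2 := l2 - b0 * n0 + b1 * n1 in
  dot3 n0 n1 n2 n0 n1 n2 = 1 ->
  dot3 m0 m1 m2 n0 n1 n2 = 0 -> dot3 l0 l1 l2 n0 n1 n2 = 0 ->
  a1 * b2 - a2 * b1 = w * n0 -> a2 * b0 - a0 * b2 = w * n1 -> a0 * b1 - a1 * b0 = w * n2 ->
  det3 n0 n1 n2 m0 m1 m2 l0 l1 l2 -
  ((a1 * b2 - a2 * b1) * n0 + (a2 * b0 - a0 * b2) * n1
   + b1 * m0 + b0 * m1 - a1 * l0 - a0 * l1) =
  det3 n0 n1 n2 s0 s1 s2 t0 t1 t2 + (2 * n2 ^+ 2 - 1) * w.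
Proof.
move=> s0 s1 s2 t0 t1 t2 nn mn ln w0 w1 w2.
(* An identity without hypotheses: the terms that are to vanish appear as multiples of [|n|^2 - 1],
   [m . n] and [l . n]. *)
have E : det3 n0 n1 n2 m0 m1 m2 l0 l1 l2 -
    ((a1 * b2 - a2 * b1) * n0 + (a2 * b0 - a0 * b2) * n1
     + b1 * m0 + b0 * m1 - a1 * l0 - a0 * l1) =
    det3 n0 n1 n2 s0 s1 s2 t0 t1 t2
    + (dot3 n0 n1 n2 n0 n1 n2 - 1) *
      (s0 * b1 + s1 * b0 - t0 * a1 - t1 * a0 - n2 * (a0 * b1 - a1 * b0))
    - (b1 * n0 + b0 * n1) * dot3 m0 m1 m2 n0 n1 n2
    + (a1 * n0 + a0 * n1) * dot3 l0 l1 l2 n0 n1 n2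
    + n2 * (a0 * b1 - a1 * b0)
    - (a1 * b2 - a2 * b1) * n0 - (a2 * b0 - a0 * b2) * n1.
  by rewrite /det3 /dot3 /s0 /s1 /s2 /t0 /t1 /t2; ring.
rewrite E nn mn ln w0 w1 w2 subrr mul0r !mulr0 subr0 !addr0.
have -> : 2 * n2 ^+ 2 - 1 = 2 * n2 ^+ 2 - dot3 n0 n1 n2 n0 n1 n2 by rewrite nn.
rewrite /dot3; ring.
Qed.

(** The vector [a x b] is a multiple of the unit vector [n] orthogonal to [a] and [b], and the
    factor is its scalar product with [n]. Multiplication by [|n|^2 = 1] makes this polynomial. *)
Lemma cross_normal (a0 a1 a2 b0 b1 b2 n0 n1 n2 : R) :
  dot3 n0 n1 n2 n0 n1 n2 = 1 -> dot3 a0 a1 a2 n0 n1 n2 = 0 -> dot3 b0 b1 b2 n0 n1 n2 = 0 ->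
  let w := det3 n0 n1 n2 a0 a1 a2 b0 b1 b2 in
  [/\ a1 * b2 - a2 * b1 = w * n0, a2 * b0 - a0 * b2 = w * n1 & a0 * b1 - a1 * b0 = w * n2].
Proof.
move=> nn an bn w.
have C (x y : R) : dot3 n0 n1 n2 n0 n1 n2 * x = y -> x = y by rewrite nn mul1r.
split; apply: C.
- transitivity (w * n0 + dot3 a0 a1 a2 n0 n1 n2 * (b2 * n1 - b1 * n2)
    - dot3 b0 b1 b2 n0 n1 n2 * (a2 * n1 - a1 * n2)).
    by rewrite /w /det3 /dot3; ring.
  by rewrite an bn !mul0r subr0 addr0.
- transitivity (w * n1 + dot3 a0 a1 a2 n0 n1 n2 * (b0 * n2 - b2 * n0)
    - dot3 b0 b1 b2 n0 n1 n2 * (a0 * n2 - a2 * n0)).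
    by rewrite /w /det3 /dot3; ring.
  by rewrite an bn !mul0r subr0 addr0.
- transitivity (w * n2 + dot3 a0 a1 a2 n0 n1 n2 * (b1 * n0 - b0 * n1)
    - dot3 b0 b1 b2 n0 n1 n2 * (a1 * n0 - a0 * n1)).
    by rewrite /w /det3 /dot3; ring.
  by rewrite an bn !mul0r subr0 addr0.
Qed.

Lemma det3_combination (n0 n1 n2 a0 a1 a2 b0 b1 b2 x y z t : R) :
  det3 n0 n1 n2 (x * a0 + y * b0) (x * a1 + y * b1) (x * a2 + y * b2)
    (z * a0 + t * b0) (z * a1 + t * b1) (z * a2 + t * b2)
  = (x * t - z * y) * det3 n0 n1 n2 a0 a1 a2 b0 b1 b2.
Proof. rewrite /det3; ring. Qed.

Lemma dot3_combination (a0 a1 a2 b0 b1 b2 n0 n1 n2 x y : R) :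
  dot3 (x * a0 + y * b0) (x * a1 + y * b1) (x * a2 + y * b2) n0 n1 n2 =
  x * dot3 a0 a1 a2 n0 n1 n2 + y * dot3 b0 b1 b2 n0 n1 n2.
Proof. rewrite /dot3; ring. Qed.

Lemma det3_combination_l (n0 n1 n2 a0 a1 a2 b0 b1 b2 m0 m1 m2 x y : R) :
  det3 (x * a0 + y * b0) (x * a1 + y * b1) (x * a2 + y * b2) n0 n1 n2 m0 m1 m2 =
  x * det3 a0 a1 a2 n0 n1 n2 m0 m1 m2 + y * det3 b0 b1 b2 n0 n1 n2 m0 m1 m2.
Proof. rewrite /det3; ring. Qed.

(** With [p] the derivative of [e], the part of the derivative of [e (x) e] proportional to [e]
    gives a determinant with two parallel rows; the other parts carry the squares of the components
    of [e], of sum 1. *)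
Lemma rotation_alg (e0 e1 e2 n0 n1 n2 p0 p1 p2 : R) : dot3 e0 e1 e2 e0 e1 e2 = 1 ->
  let D (e p : R) := det3 (p0 * e + e0 * p) (p1 * e + e1 * p) (p2 * e + e2 * p) n0 n1 n2
    (e0 * e) (e1 * e) (e2 * e) in
  D e0 p0 + D e1 p1 + D e2 p2 = det3 p0 p1 p2 n0 n1 n2 e0 e1 e2.
Proof.
move=> ee D; rewrite -[RHS]mul1r -ee /D /dot3 /det3; ring.
Qed.

End VectorAlgebra.

Lemma ord3P (P : 'I_3 -> Prop) : P 0 -> P 1 -> P ord_max -> forall i, P i.
Proof.
move=> P0 P1 P2 [[|[|[|//]]] Hi].
- by rewrite (_ : Ordinal Hi = 0) //; exact: val_inj.
- by rewrite (_ : Ordinal Hi = 1) //; exact: val_inj.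
- by rewrite (_ : Ordinal Hi = ord_max) //; exact: val_inj.
Qed.

Lemma sum3 (R : realType) (F : 'I_3 -> R) : \sum_i F i = F 0 + F 1 + F ord_max.
Proof.
rewrite !big_ord_recl big_ord0 addr0 addrA.
by congr (_ + F _ + F _); exact: val_inj.
Qed.

(** * Curl of the rotation form of a unit field orthogonal to a unit normal *)

Section LineField.
Context {R : realType}.
Implicit Types (e n a b c : 'I_3 -> 'rV[R]_2 -> R) (i : 'I_2).

Definition dotv a b u : R := dot3 (a 0 u) (a 1 u) (a ord_max u) (b 0 u) (b 1 u) (b ord_max u).
Definition detv a b c u : R :=
  det3 (a 0 u) (a 1 u) (a ord_max u) (b 0 u) (b 1 u) (b ord_max u)
    (c 0 u) (c 1 u) (c ord_max u).
Definition pv i a : 'I_3 -> 'rV[R]_2 -> R := fun k => partial i (a k).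

Lemma partialB (f g : 'rV[R]_2 -> R) u i : differentiable f u -> differentiable g u ->
  partial i (fun v => f v - g v) u = partial i f u - partial i g u.
Proof.
move=> df dg; rewrite (partialD i df (differentiableN dg)).
by rewrite (partialN i dg).
Qed.

Lemma partial_dotv a b u i : (forall k, differentiable (a k) u) ->
  (forall k, differentiable (b k) u) ->
  partial i (dotv a b) u = dotv (pv i a) b u + dotv a (pv i b) u.
Proof.
move=> da db; have dM k l : differentiable (fun v => a k v * b l v) u.
  exact: (differentiableM (da k) (db l)).
rewrite /dotv /dot3 (partialD i (differentiableD (dM 0 0) (dM 1 1)) (dM ord_max ord_max)).
rewrite (partialD i (dM 0 0) (dM 1 1)) !(partialM i (da _) (db _)) /pv; ring.
Qed.

Lemma partial_detv a b c u i : (forall k, differentiable (a k) u) ->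
  (forall k, differentiable (b k) u) -> (forall k, differentiable (c k) u) ->
  partial i (detv a b c) u =
    detv (pv i a) b c u + detv a (pv i b) c u + detv a b (pv i c) u.
Proof.
move=> da db dc; pose m k l v := b k v * c l v - b l v * c k v.
have dM k l : differentiable (fun v => b k v * c l v) u.
  exact: (differentiableM (db k) (dc l)).
have dm k l : differentiable (m k l) u by exact: (differentiableB (dM k l) (dM l k)).
have pm k l : partial i (m k l) u = partial i (b k) u * c l u + b k u * partial i (c l) u
    - (partial i (b l) u * c k u + b l u * partial i (c k) u).
  by rewrite (partialB i (dM k l) (dM l k)) !(partialM i (db _) (dc _)).
have dA k l l' : differentiable (fun v => a k v * m l l' v) u.
  exact: (differentiableM (da k) (dm l l')).
have -> : detv a b c = (fun v => a 0 v * m 1 ord_max v + a 1 v * m ord_max 0 v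
    + a ord_max v * m 0 1 v) by apply/funext.
rewrite (partialD i (differentiableD (dA 0 1 ord_max) (dA 1 ord_max 0)) (dA ord_max 0 1)).
rewrite (partialD i (dA 0 1 ord_max) (dA 1 ord_max 0)) !(partialM i (da _) (dm _ _)).
by rewrite !pm /detv /det3 /m /pv; ring.
Qed.

Lemma dotvC a b : dotv a b = dotv b a.
Proof. by apply/funext => u; rewrite /dotv /dot3; ring. Qed.

Lemma partial_dotv_cst (V : set 'rV[R]_2) a b (t : R) u i : open V -> V u ->
  (forall v, V v -> dotv a b v = t) ->
  (forall k, differentiable (a k) u) -> (forall k, differentiable (b k) u) ->
  dotv (pv i a) b u + dotv a (pv i b) u = 0.
Proof.
move=> oV Vu H da db; rewrite -(partial_dotv i da db).
transitivity (partial i (cst t : 'rV[R]_2 -> R) u); last by rewrite /partial derive_cst.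
by apply: partial_near; apply: filterS (open_nbhs_nbhs (conj oV Vu)) => v /H.
Qed.

Lemma partial_unit_orthogonal (V : set 'rV[R]_2) a (t : R) u i : open V -> V u ->
  (forall v, V v -> dotv a a v = t) -> (forall k, differentiable (a k) u) ->
  dotv (pv i a) a u = 0.
Proof.
move=> oV Vu H da; have := partial_dotv_cst i oV Vu H da da.
by rewrite (dotvC a) => h; lra.
Qed.

(** The form [<D_i e, n x e>] has as curl minus the pullback by [n] of the area form of the sphere.
    The second derivatives of [e] cancel by symmetry and the rest is [frame_curl_alg]. *)
Lemma line_field_curl (V : set 'rV[R]_2) e n u : open V -> V u ->
  (forall k, Ck 2 V (e k)) -> (forall k, Ck 2 V (n k)) ->
  (forall v, V v -> dotv e e v = 1) -> (forall v, V v -> dotv n n v = 1) ->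
  (forall v, V v -> dotv e n v = 0) ->
  partial 0 (detv (pv 1 e) n e) u - partial 1 (detv (pv 0 e) n e) u =
  - detv n (pv 0 n) (pv 1 n) u.
Proof.
move=> oV Vu Ce Cn ee nn en.
have de k : differentiable (e k) u := Ck_differentiable (Ce k) Vu.
have dn k : differentiable (n k) u := Ck_differentiable (Cn k) Vu.
have dpe i k : differentiable (pv i e k) u := Ck_differentiable (Ck_partial i (Ce k)) Vu.
have pe i := partial_unit_orthogonal i oV Vu ee de.
have mn i := partial_unit_orthogonal i oV Vu nn dn.
have me i : dotv (pv i n) e u = - dotv (pv i e) n u.
  by have := partial_dotv_cst i oV Vu en de dn; rewrite (dotvC e) => h; lra.
rewrite !(partial_detv _ (dpe _) dn de).
have sw k : pv 0 (pv 1 e) k u = pv 1 (pv 0 e) k u by exact: (schwarz oV (Ce k) Vu).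
have E : detv (pv 0 (pv 1 e)) n e u = detv (pv 1 (pv 0 e)) n e u by rewrite /detv !sw.
have alg (x y z s t : R) : x + y + z - (x + s + t) = y + z - (s + t) by ring.
apply: (etrans (congr1 (fun x => x + _ + _ - _) E)).
apply: (etrans (alg _ _ _ _ _)).
exact: frame_curl_alg (ee u Vu) (nn u Vu) (en u Vu) (pe 0) (pe 1) (mn 0) (mn 1) (me 0) (me 1).
Qed.

End LineField.

(** * The connection of Sol_3 *)

Section Sol3.
Context {R : realType}.

Lemma jacobian_entry (m n : nat) (F : 'rV[R]_m -> 'rV[R]_n) u i k :
  differentiable F u -> ('J F u) i k = partial i (fun v => F v 0 k) u.
Proof.
move=> dF; rewrite /partial deriveE; last exact: differentiable_coord_comp.
by rewrite diff_coord // /jacobian mxE.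
Qed.

Definition sol3_diag (p : 'rV[R]_3) (k : 'I_3) : R :=
  [:: expR (2 * p 0 ord_max); expR (- (2 * p 0 ord_max)); 1]`_k.
(** Logarithmic derivatives in [z] of the diagonal entries of the metric. *)
Definition sol3_rate (k : 'I_3) : R := [:: 2; -2; 0]`_k.

Lemma sol3_metricE (p : 'rV[R]_3) a b : sol3_metric p a b = sol3_diag p a *+ (a == b).
Proof. by rewrite !mxE; case: eqP => [->|]. Qed.

Lemma sol3_diag_neq0 (p : 'rV[R]_3) k : sol3_diag p k != 0.
Proof. by move: k; apply: ord3P; rewrite /sol3_diag /= ?gt_eqF ?expR_gt0 ?oner_neq0. Qed.

Lemma sol3_inv (p : 'rV[R]_3) k l :
  invmx (sol3_metric p) k l = (sol3_diag p k)^-1 *+ (k == l).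
Proof.
pose h : 'M[R]_3 := \matrix_(i, j) ((sol3_diag p i)^-1 *+ (i == j)).
have E : h *m sol3_metric p = 1%:M.
  apply/matrixP => i j; rewrite mxE (bigD1 i) //= big1 ?addr0 => [|s si].
    by rewrite mxE sol3_metricE eqxx mulr1n mulrnAr mulVf ?sol3_diag_neq0 ?mxE.
  by rewrite mxE eq_sym (negPf si) mulr0n mul0r.
have -> : invmx (sol3_metric p) = h.
  by rewrite -[LHS]mul1mx -E -mulmxA mulmxV ?mulmx1 //; exact: sol3_metric_unit.
by rewrite mxE.
Qed.

Lemma partial_sol3_diag (p : 'rV[R]_3) l k :
  partial l (sol3_diag ^~ k) p = (l == ord_max)%:R * sol3_rate k * sol3_diag p k.
Proof.
have dc : differentiable (fun q : 'rV[R]_3 => q 0 ord_max) p by exact: differentiable_coord.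
have pc : partial l (fun q : 'rV[R]_3 => q 0 ord_max) p = (l == ord_max)%:R.
  rewrite /partial deriveE // (@diff_coord _ _ _ id) // diff_val mxE /=.
  by rewrite eq_sym.
have E (t : R) : partial l (fun q : 'rV[R]_3 => expR (t * q 0 ord_max)) p =
    (l == ord_max)%:R * t * expR (t * p 0 ord_max).
  have dt : differentiable (fun q : 'rV[R]_3 => t * q 0 ord_max) p.
    exact: (differentiableM (differentiable_cst t p) dc).
  have D := is_derive_expR (t * p 0 ord_max).
  have [_ H] := partial_compR dt (@ex_derive _ _ _ _ _ _ _ D).
  rewrite (H l) derive_val (partialM l (differentiable_cst t p) dc) pc.
  by rewrite /partial derive_cst /cst; ring.
move: k; apply: ord3P; rewrite /sol3_diag /sol3_rate /=.
- exact: E.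
- have := E (-2); rewrite mulNr => <-; congr (partial l _ p).
  by apply/funext => q; rewrite mulNr.
- by rewrite /partial derive_cst mulr0 mul0r.
Qed.

Lemma christoffel_sol3 (p : 'rV[R]_3) k a b :
  christoffel (@sol3_metric R) p k a b = 2^-1 * (sol3_diag p k)^-1 *
    ((b == k)%:R * (a == ord_max)%:R * sol3_rate b * sol3_diag p b
     + (a == k)%:R * (b == ord_max)%:R * sol3_rate a * sol3_diag p a
     - (a == b)%:R * (k == ord_max)%:R * sol3_rate a * sol3_diag p a).
Proof.
have P l i j : partial l (fun q => sol3_metric q i j) p =
    (i == j)%:R * (l == ord_max)%:R * sol3_rate i * sol3_diag p i.
  have -> : (fun q => sol3_metric q i j) = (fun q => (i == j)%:R * sol3_diag q i).
    by apply/funext => q; rewrite sol3_metricE mulr_natl.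
  have [ij|ij] := eqVneq i j; last first.
    have -> : (fun q => false%:R * sol3_diag q i) = cst 0 by apply/funext => q; rewrite mul0r.
    by rewrite /partial derive_cst !mul0r.
  have -> : (fun q => true%:R * sol3_diag q i) = sol3_diag ^~ i by apply/funext => q; rewrite mul1r.
  by rewrite partial_sol3_diag mul1r.
rewrite /christoffel (bigD1 k) //= big1 ?addr0 => [|l lk].
  by rewrite sol3_inv eqxx mulr1n !P.
by rewrite sol3_inv eq_sym (negPf lk) mulr0n mulr0 mul0r.
Qed.

(** Kronecker symbols, metric entries and rates are replaced by scalars with the relevant values,
    which turns the double sums into field identities. *)
Lemma diagonal_christoffel_sum (d : 'I_3 -> 'I_3 -> R) (g r x y : 'I_3 -> R) :
  (forall i, d i i = 1) -> d 0 1 = 0 -> d 0 ord_max = 0 -> d 1 0 = 0 ->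
  d 1 ord_max = 0 -> d ord_max 0 = 0 -> d ord_max 1 = 0 ->
  g 0 != 0 -> g 1 != 0 -> g ord_max = 1 -> r 0 = 2 -> r 1 = -2 -> r ord_max = 0 ->
  let G k := \sum_a \sum_b 2^-1 * (g k)^-1 *
    (d b k * d a ord_max * r b * g b + d a k * d b ord_max * r a * g a
     - d a b * d k ord_max * r a * g a) * x a * y b in
  [/\ G 0 = x ord_max * y 0 + x 0 * y ord_max,
      G 1 = - (x ord_max * y 1) - x 1 * y ord_max &
      G ord_max = - g 0 * x 0 * y 0 + g 1 * x 1 * y 1].
Proof.
move=> dd d01 d02 d10 d12 d20 d21 g0 g1 g2 r0 r1 r2 G.
rewrite /G !sum3 !dd d01 d02 d10 d12 d20 d21 r0 r1 r2 g2.
by move: (g 0) (g 1) g0 g1 => h0 h1 g0 g1; split; field.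
Qed.

Lemma christoffel_sol3_sum (p : 'rV[R]_3) (x y : 'I_3 -> R) :
  let z := p 0 ord_max in
  let G k := \sum_a \sum_b christoffel (@sol3_metric R) p k a b * x a * y b in
  [/\ G 0 = x ord_max * y 0 + x 0 * y ord_max,
      G 1 = - (x ord_max * y 1) - x 1 * y ord_max &
      G ord_max = - expR (2 * z) * x 0 * y 0 + expR (- (2 * z)) * x 1 * y 1].
Proof.
move=> z G; pose d (i j : 'I_3) : R := (i == j)%:R.
have dd i : d i i = 1 by rewrite /d eqxx.
have [H0 H1 H2] := diagonal_christoffel_sum (d := d) (r := sol3_rate) x y dd erefl erefl
  erefl erefl erefl erefl (sol3_diag_neq0 p 0) (sol3_diag_neq0 p 1) erefl erefl erefl erefl.
have E k : G k = _ := eq_bigr _ (fun a _ => eq_bigr _ (fun b _ =>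
  congr1 (fun t => t * x a * y b) (christoffel_sol3 p k a b))).
by split; rewrite E.
Qed.

Lemma covariant_sol3 (psi V : 'rV[R]_2 -> 'rV[R]_3) u i :
  differentiable psi u -> differentiable V u ->
  let X k := partial i (fun v => psi v 0 k) u in
  let Y k := partial i (fun v => V v 0 k) u in
  let z := psi u 0 ord_max in
  let cov := covariant_jacobian (@sol3_metric R) psi V u in
  [/\ cov i 0 = Y 0 + X ord_max * V u 0 0 + X 0 * V u 0 ord_max,
      cov i 1 = Y 1 - X ord_max * V u 0 1 - X 1 * V u 0 ord_max &
      cov i ord_max = Y ord_max - expR (2 * z) * X 0 * V u 0 0
        + expR (- (2 * z)) * X 1 * V u 0 1].
Proof.
move=> dpsi dV X Y z cov.
have E k : cov i k = Y k +
    \sum_a \sum_b christoffel (@sol3_metric R) (psi u) k a b * X a * V u 0 b.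
  have addE (A B : 'M[R]_(2, 3)) : (A + B) i k = A i k + B i k by rewrite mxE.
  apply: (etrans (addE _ _)); congr (_ + _); first exact: jacobian_entry.
  apply: (etrans (mxE _ _ _ _)); apply: eq_bigr => a _; apply: eq_bigr => b _.
  exact: (congr1 (fun t => _ * t * _) (jacobian_entry i a dpsi)).
have [G0 G1 G2] := christoffel_sol3_sum (psi u) X (fun k => V u 0 k).
split; rewrite E ?G0 ?G1 ?G2.
- by rewrite addrA.
- by rewrite addrA.
- by rewrite -/z !mulNr addrA.
Qed.

End Sol3.

(** * Surfaces in Sol_3 *)

Lemma partial_product_expR (R : realType) (x z : 'rV[R]_2 -> R) (t : R) u (i : 'I_2) :
  differentiable x u -> differentiable z u ->
  partial i (fun v => expR (t * z v) * x v) u =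
  expR (t * z u) * (t * partial i z u * x u + partial i x u).
Proof.
move=> dx dz; have dt : differentiable (fun v => t * z v) u.
  exact: (differentiableM (differentiable_cst t u) dz).
have [dE H] := partial_compR dt (@ex_derive _ _ _ _ _ _ _ (is_derive_expR (t * z u))).
rewrite (partialM i dE dx) (H i) derive_val (partialM i (differentiable_cst t u) dz).
rewrite {1}/partial derive_cst /= mul0r add0r.
by move: (partial i z u) (partial i x u) => a b; ring.
Qed.

Lemma Ck_open_pos (R : realType) (m k : nat) (U : set 'rV[R]_m) (g : 'rV[R]_m -> R) :
  open U -> Ck k U g -> open [set v | U v /\ 0 < g v].
Proof.
move=> oU Cg; rewrite openE => x [Ux gx]; rewrite /interior.
have cg : {for x, continuous g} := Ck_continuous Cg Ux.
have G : nbhs x [set y | 0 < g y] by apply: (cg [set t | 0 < t]); exact: lt_nbhsr.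
by apply: filterS (filterI G (open_nbhs_nbhs (conj oU Ux))) => y [].
Qed.

Lemma partial_at_max (R : realType) (V : set 'rV[R]_2) (F : 'rV[R]_2 -> R) u i :
  open V -> V u -> (forall v, V v -> differentiable F v) ->
  (forall v, V v -> F v <= F u) -> partial i F u = 0.
Proof.
move=> oV Vu dF Fu; rewrite -(vec2_eta u) in Vu Fu *.
move: (u 0 0) (u 0 1) Vu Fu => x y Vu Fu.
have /nbhs_ballP[r /= r0 rV] := open_nbhs_nbhs (conj oV Vu).
have inV s t : `|x - s| < r -> `|y - t| < r -> V (vec2 s t).
  move=> hs ht; apply: rV; split=> // j k; rewrite /ball /= !mxE.
  by case: ifP.
have itv (a s : R) : s \in `]a - r, a + r[ -> `|a - s| < r.
  by rewrite in_itv /= => h; rewrite distrC ltr_distl.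
have self (a : R) : a \in `]a - r, a + r[ by rewrite in_itv /= ltrBlDr ltrDl r0.
have dist0 (a : R) : `|a - a| < r by rewrite subrr normr0.
have le (a : R) : a - r <= a + r by rewrite lerD2l; lra.
have [D0 D1] := is_derive_slice (dF _ Vu).
move: i; apply: ord2P.
- have H := @derive1_at_max R (fun s => F (vec2 s y)) _ _ x (le x)
    (fun s hs => @ex_derive _ _ _ _ _ _ _ (is_derive_slice (dF _ (inV s y (itv _ _ hs) (dist0 y)))).1)
    (self x) (fun s hs => Fu _ (inV s y (itv _ _ hs) (dist0 y))).
  by rewrite -(@derive_val _ _ _ _ _ _ _ D0) (@derive_val _ _ _ _ _ _ _ H).
- have H := @derive1_at_max R (fun s => F (vec2 x s)) _ _ y (le y)
    (fun s hs => @ex_derive _ _ _ _ _ _ _ (is_derive_slice (dF _ (inV x s (dist0 x) (itv _ _ hs)))).2)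
    (self y) (fun s hs => Fu _ (inV x s (dist0 x) (itv _ _ hs))).
  by rewrite -(@derive_val _ _ _ _ _ _ _ D1) (@derive_val _ _ _ _ _ _ _ H).
Qed.

(** * Tangent vectors and normal in an orthonormal frame of Sol_3 *)

Section FrameData.
Context {R : realType} {S : surface R}.
Context (phi xi : S -> 'rV[R]_3) (A : chart R S -> S -> 'M[R]_2).
Implicit Types (c d : chart R S) (p q : S) (F : S -> R) (i j : 'I_2) (k l : 'I_3).

Context (phi_smooth : smooth_map phi) (xi_smooth : smooth_map xi).
Context (phi_free : forall c p, atlas c -> chart_dom c p -> row_free (chart_diff phi c p)).
Context (xi_unit : forall p, xi p *m sol3_metric (phi p) *m (xi p)^T = 1%:M).
Context (xi_orth : forall c p, atlas c -> chart_dom c p ->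
  chart_diff phi c p *m sol3_metric (phi p) *m (xi p)^T = 0).
Context (shapeA : shape_operator phi xi A).

(* [E_x = e^-z d/dx], [E_y = e^z d/dy], [E_z = d/dz] is an orthonormal frame of
   Sol_3; [frame_scale] converts coordinates of vectors to this frame. *)
Definition frame_exp (k : 'I_3) : R := [:: 1; -1; 0]`_k.
Definition frame_scale k q : R := expR (frame_exp k * phi q 0 ord_max).
Definition position k q : R := phi q 0 k.
Definition normal k q : R := frame_scale k q * xi q 0 k.
Definition chart_partial c F i p : R := partial i (F \o chart_inv c) (c p).
Definition tangent c i k p : R := frame_scale k p * chart_partial c (position k) i p.
(* The frame components of the covariant derivative of the normal; the correction
   terms are those of [D_(E_x) E_z = E_x], [D_(E_y) E_z = - E_y],
   [D_(E_x) E_x = - E_z] and [D_(E_y) E_y = E_z]. *)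
Definition nabla_normal c i k p : R := chart_partial c (normal k) i p +
  [:: tangent c i 0 p * normal ord_max p; - (tangent c i 1 p * normal ord_max p);
      - (tangent c i 0 p * normal 0 p) + tangent c i 1 p * normal 1 p]`_k.
(** Triple product of the normal and the coordinate tangent vectors: the area density of the chart,
    signed by its orientation relative to [xi]. *)
Definition area c p : R :=
  det3 (normal 0 p) (normal 1 p) (normal ord_max p)
    (tangent c 0 0 p) (tangent c 0 1 p) (tangent c 0 ord_max p)
    (tangent c 1 0 p) (tangent c 1 1 p) (tangent c 1 ord_max p).

Lemma position_C m k : SCk m (position k).
Proof. by move=> c ac; apply: Ck_of_smooth; [exact: codom_open|exact: phi_smooth]. Qed.

Lemma xi_C m k : SCk m (fun q => xi q 0 k).
Proof. by move=> c ac; apply: Ck_of_smooth; [exact: codom_open|exact: xi_smooth]. Qed.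

Lemma frame_scale_C m k : SCk m (frame_scale k).
Proof.
move=> c ac; have oc := @codom_open _ _ c.
exact: (Ck_expR oc (CkM oc (Ck_cst m _ (frame_exp k)) (position_C m ord_max ac))).
Qed.

Lemma normal_C m k : SCk m (normal k).
Proof. exact: (SCkM (frame_scale_C m k) (xi_C m k)). Qed.

Lemma chart_partial_C m c F i : atlas c -> SCk m.+1 F ->
  Ck m (chart_codom c) (fun u => chart_partial c F i (chart_inv c u)).
Proof.
move=> ac CF; apply: (Ck_eq (@codom_open _ _ c) _ (Ck_partial i (CF c ac))) => u cu.
by have [_ ue] := chart_invP cu; rewrite /chart_partial ue.
Qed.

Lemma tangent_C m c i k : atlas c ->
  Ck m (chart_codom c) (fun u => tangent c i k (chart_inv c u)).
Proof.
move=> ac; have oc := @codom_open _ _ c.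
exact: (CkM oc (frame_scale_C m k ac) (chart_partial_C i ac (position_C m.+1 k))).
Qed.

Lemma nabla_normal_C m c i k : atlas c ->
  Ck m (chart_codom c) (fun u => nabla_normal c i k (chart_inv c u)).
Proof.
move=> ac; have oc := @codom_open _ _ c.
have Cn l := normal_C m l ac; have Ct l := tangent_C m i l ac.
apply: (CkD oc (chart_partial_C i ac (normal_C m.+1 k))).
move: k; apply: ord3P => /=.
- exact: (CkM oc (Ct 0) (Cn ord_max)).
- exact: (CkN oc (CkM oc (Ct 1) (Cn ord_max))).
- exact: (CkD oc (CkN oc (CkM oc (Ct 0) (Cn 0))) (CkM oc (Ct 1) (Cn 1))).
Qed.

Lemma Ck_det3 m (U : set 'rV[R]_2) (a b c : 'I_3 -> 'rV[R]_2 -> R) : open U ->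
  (forall k, Ck m U (a k)) -> (forall k, Ck m U (b k)) -> (forall k, Ck m U (c k)) ->
  Ck m U (detv a b c).
Proof.
move=> oU Ca Cb Cc; have M k l := CkM oU (Cb k) (Cc l).
have B k l := CkB oU (M k l) (M l k).
exact: (CkD oU (CkD oU (CkM oU (Ca 0) (B 1 ord_max)) (CkM oU (Ca 1) (B ord_max 0)))
  (CkM oU (Ca ord_max) (B 0 1))).
Qed.

Lemma area_C m c : atlas c -> Ck m (chart_codom c) (area c \o chart_inv c).
Proof.
move=> ac; have oc := @codom_open _ _ c.
exact: (Ck_det3 oc (fun k => normal_C m k ac) (fun k => tangent_C m 0 k ac)
  (fun k => tangent_C m 1 k ac)).
Qed.

Lemma frame_scale_sq k q : frame_scale k q * frame_scale k q = sol3_diag (phi q) k.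
Proof.
rewrite /frame_scale -expRD; move: k; apply: ord3P;
  rewrite /frame_exp /sol3_diag /=.
- by congr expR; ring.
- by congr expR; ring.
- by rewrite !mul0r addr0 expR0.
Qed.

(** In frame components the metric of Sol_3 is the Euclidean scalar product. *)
Lemma sol3_form (m n : nat) (M : 'M[R]_(m, 3)) (N : 'M[R]_(n, 3)) q
    (i : 'I_m) (j : 'I_n) :
  (M *m sol3_metric (phi q) *m N^T) i j =
  \sum_k (frame_scale k q * M i k) * (frame_scale k q * N j k).
Proof.
rewrite mxE; apply: eq_bigr => k _; rewrite !mxE (bigD1 k) //= big1 ?addr0 => [|l lk].
  rewrite sol3_metricE eqxx mulr1n -frame_scale_sq; ring.
by rewrite sol3_metricE (negPf lk) mulr0n mulr0.
Qed.

Lemma normal_norm q : dot3 (normal 0 q) (normal 1 q) (normal ord_max q)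
  (normal 0 q) (normal 1 q) (normal ord_max q) = 1.
Proof.
transitivity ((1%:M : 'M[R]_1) 0 0); last by rewrite mxE.
by rewrite -(xi_unit q) sol3_form sum3.
Qed.

Lemma phi_differentiable c u : atlas c -> chart_codom c u ->
  differentiable (phi \o chart_inv c) u.
Proof. by move=> ac cu; exact: (phi_smooth ac [::] cu). Qed.

Lemma xi_differentiable c u : atlas c -> chart_codom c u ->
  differentiable (xi \o chart_inv c) u.
Proof. by move=> ac cu; exact: (xi_smooth ac [::] cu). Qed.

Lemma chart_diffE c p i k : atlas c -> chart_dom c p ->
  chart_diff phi c p i k = chart_partial c (position k) i p.
Proof.
move=> ac dp; exact: (jacobian_entry i k (phi_differentiable ac (chart_codom_map dp))).
Qed.

Lemma tangent_orthogonal c p i : atlas c -> chart_dom c p ->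
  dot3 (tangent c i 0 p) (tangent c i 1 p) (tangent c i ord_max p)
    (normal 0 p) (normal 1 p) (normal ord_max p) = 0.
Proof.
move=> ac dp; transitivity ((0 : 'M[R]_(2, 1)) i 0); last by rewrite mxE.
by rewrite -(xi_orth ac dp) sol3_form sum3 !(chart_diffE _ _ ac dp).
Qed.

(** If it vanished, so would the cross product of the coordinate tangent vectors, which would then
    be linearly dependent, against the immersion property. *)
Lemma area_neq0 c p : atlas c -> chart_dom c p -> area c p != 0.
Proof.
move=> ac dp; apply/eqP => w0.
have [] := cross_normal (normal_norm p) (tangent_orthogonal 0 ac dp) (tangent_orthogonal 1 ac dp).
rewrite -/(area c p) w0 !mul0r.
move=> /eqP; rewrite subr_eq0 => /eqP e12 /eqP; rewrite subr_eq0 => /eqP e20 /eqP.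
rewrite subr_eq0 => /eqP e01.
have e l k : tangent c 0 l p * tangent c 1 k p = tangent c 0 k p * tangent c 1 l p.
  by move: l k; apply: ord3P; apply: ord3P.
have g0 k : frame_scale k p != 0 by rewrite gt_eqF // expR_gt0.
have free (x y : R) : (forall k, x * tangent c 0 k p + y * tangent c 1 k p = 0) ->
    x = 0 /\ y = 0.
  move=> H; pose v := vec2 x y.
  have vM : v *m chart_diff phi c p = 0.
    apply/matrixP => i k; rewrite ord1 mxE big_ord_recl big_ord1 [RHS]mxE.
    have -> : lift ord0 ord0 = 1 :> 'I_2 by exact: val_inj.
    rewrite vec2_0 vec2_1 !(chart_diffE _ _ ac dp).
    by apply: (mulfI (g0 k)); rewrite mulr0 -(H k) /tangent; ring.
  have /eqP v0 : v == 0 by rewrite -(mulmx_free_eq0 _ (phi_free ac dp)) vM.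
  by split; [rewrite -(vec2_0 x y)|rewrite -(vec2_1 x y)]; rewrite -/v v0 mxE.
(* The vanishing minors give, for each [k], a relation between the two tangent vectors with
   coefficients their own [k]-th components. *)
have t0 k : tangent c 0 k p = 0.
  have [_ /eqP] := free (tangent c 1 k p) (- tangent c 0 k p)
    (fun l => ltac:(rewrite mulNr (e k l); ring)).
  by rewrite oppr_eq0 => /eqP.
have [/eqP] := free 1 0 (fun k => ltac:(rewrite t0; ring)).
by rewrite oner_eq0.
Qed.

(** The derivative of [frame_scale] accounts for the connection terms that contain the derivative of
    [z] in the first two components; the remaining ones are the corrections in [nabla_normal]. *)
Lemma nabla_normalE c p i k : atlas c -> chart_dom c p ->
  frame_scale k p * covariant_jacobian (@sol3_metric R)
        (phi \o chart_inv c) (xi \o chart_inv c) (c p) i k = nabla_normal c i k p.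
Proof.
move=> ac dp; have cp := chart_codom_map dp.
have dphi := phi_differentiable ac cp; have dxi := xi_differentiable ac cp.
have [C0 C1 C2] := covariant_sol3 i dphi dxi.
have dz : differentiable (position ord_max \o chart_inv c) (c p).
  exact: (differentiable_coord_comp ord_max dphi).
have dx l : differentiable (fun v => (xi \o chart_inv c) v 0 l) (c p).
  exact: (differentiable_coord_comp l dxi).
have N l := partial_product_expR (frame_exp l) i (dx l) dz.
have ip : chart_inv c (c p) = p by exact: chart_mapE.
rewrite /nabla_normal /chart_partial.
have NE l : partial i (normal l \o chart_inv c) (c p) =
    frame_scale l p * (frame_exp l * chart_partial c (position ord_max) i p * xi p 0 l
      + partial i (fun v => (xi \o chart_inv c) v 0 l) (c p)).
  rewrite (_ : normal l \o chart_inv c = (fun v => expR (frame_exp l *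
    (position ord_max \o chart_inv c) v) * (xi \o chart_inv c) v 0 l)) //.
  by rewrite N /= ip.
have ipc : (phi \o chart_inv c) (c p) = phi p by rewrite /= ip.
have ixc : (xi \o chart_inv c) (c p) = xi p by rewrite /= ip.
rewrite ixc ipc in C0 C1 C2.
rewrite NE /tangent /normal -/(chart_partial c (position ord_max) i p).
have PE l : partial i (fun v => (phi \o chart_inv c) v 0 l) (c p) =
    chart_partial c (position l) i p by [].
rewrite !PE in C0 C1 C2; have sq l := frame_scale_sq l p.
have s2 : frame_scale ord_max p = 1 by rewrite /frame_scale mul0r expR0.
have f0 : frame_exp 0 = 1 by []. have f1 : frame_exp 1 = -1 by [].
have f2 : frame_exp ord_max = 0 by [].
have q0 : expR (2 * phi p 0 ord_max) = frame_scale 0 p * frame_scale 0 p by rewrite sq.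
have q1 : expR (- (2 * phi p 0 ord_max)) = frame_scale 1 p * frame_scale 1 p by rewrite sq.
rewrite q0 q1 in C2.
move: (chart_partial c (position 0) i p) (chart_partial c (position 1) i p)
  (chart_partial c (position ord_max) i p) C0 C1 C2 => x0 x1 x2 C0 C1 C2.
move: k; apply: ord3P; rewrite ?C0 ?C1 ?C2 /= ?s2 ?f0 ?f1 ?f2;
  move: (partial i (fun v => (xi \o chart_inv c) v 0 _) (c p)) => y; ring.
Qed.

Lemma shape_frame c p i k : atlas c -> chart_dom c p ->
  A c p i 0 * tangent c 0 k p + A c p i 1 * tangent c 1 k p = - nabla_normal c i k p.
Proof.
move=> ac dp; rewrite -(nabla_normalE i k ac dp).
have E : (A c p *m chart_diff phi c p) i k = - (covariant_jacobian (@sol3_metric R)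
        (phi \o chart_inv c) (xi \o chart_inv c) (c p) i k).
  by rewrite (shapeA ac dp) mxE.
rewrite -mulrN -E mxE big_ord_recl big_ord1 !(chart_diffE _ _ ac dp).
have -> : lift ord0 ord0 = 1 :> 'I_2 by exact: val_inj.
rewrite /tangent; ring.
Qed.

(** * Principal curvatures and directions *)

Context (N : S -> R) (f : R).
Context (trA : forall c p, atlas c -> chart_dom c p -> f = 2^-1 * \tr (A c p)).
Context (trA2 : forall c p, atlas c -> chart_dom c p -> N p = \tr (A c p *m A c p)).
Context (N_bounds : forall p, 2 * f ^+ 2 + 2 <= N p <= 4 * f ^+ 2 - 2).

Definition extrinsic p : R := 2 * f ^+ 2 - N p / 2.
Definition half_gap p : R := Num.sqrt (f ^+ 2 - extrinsic p).
(* Gauss equation: [2 n_z^2 - 1] is the sectional curvature of Sol_3 on the plane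
   orthogonal to [n]. *)
Definition curvature p : R := extrinsic p + 2 * normal ord_max p ^+ 2 - 1.

Lemma extrinsic_ge1 p : 1 <= extrinsic p.
Proof. by rewrite /extrinsic; have /andP[_ h] := N_bounds p; lra. Qed.

Lemma half_gap_gt0 p : 0 < half_gap p.
Proof.
by rewrite sqrtr_gt0 /extrinsic; have /andP[h _] := N_bounds p; lra.
Qed.

Lemma half_gap_sq p : half_gap p ^+ 2 = f ^+ 2 - extrinsic p.
Proof.
by rewrite sqr_sqrtr //; have := half_gap_gt0 p; rewrite sqrtr_gt0 => /ltW.
Qed.

Lemma trace2 (M : 'M[R]_2) : \tr M = M 0 0 + M 1 1.
Proof.
rewrite /mxtrace big_ord_recl big_ord1.
by have -> : lift ord0 ord0 = 1 :> 'I_2 by exact: val_inj.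
Qed.

Lemma mulmx2 (M M' : 'M[R]_2) i j : (M *m M') i j = M i 0 * M' 0 j + M i 1 * M' 1 j.
Proof.
rewrite mxE big_ord_recl big_ord1.
by have -> : lift ord0 ord0 = 1 :> 'I_2 by exact: val_inj.
Qed.

Lemma shape_trace c p : atlas c -> chart_dom c p -> A c p 0 0 + A c p 1 1 = 2 * f.
Proof. by move=> ac dp; rewrite (trA ac dp) trace2 mulrA divff // mul1r. Qed.

Lemma shape_det c p : atlas c -> chart_dom c p ->
  A c p 0 0 * A c p 1 1 - A c p 0 1 * A c p 1 0 = extrinsic p.
Proof.
move=> ac dp; rewrite /extrinsic (trA2 ac dp) trace2 !mulmx2.
have -> : f = (A c p 0 0 + A c p 1 1) / 2 by rewrite (shape_trace ac dp); field.
by move: (A c p 0 0) (A c p 0 1) (A c p 1 0) (A c p 1 1) => x y z t; field.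
Qed.

Definition detn (a b c : 'I_3 -> S -> R) p : R :=
  det3 (a 0 p) (a 1 p) (a ord_max p) (b 0 p) (b 1 p) (b ord_max p)
    (c 0 p) (c 1 p) (c ord_max p).

Lemma extrinsic_area c p : atlas c -> chart_dom c p ->
  detn normal (nabla_normal c 0) (nabla_normal c 1) p = extrinsic p * area c p.
Proof.
move=> ac dp; have N' i k : nabla_normal c i k p =
    - A c p i 0 * tangent c 0 k p + - A c p i 1 * tangent c 1 k p.
  by rewrite !mulNr -opprD (shape_frame i k ac dp) opprK.
rewrite -(shape_det ac dp) /detn !N' det3_combination; congr (_ * _).
by rewrite !mulrNN [A c p 1 0 * _]mulrC.
Qed.

(** Since [N] is just a function, regularity is obtained by writing [det A] as the quotient of two
    triple products of regular vectors. *)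
Lemma extrinsic_C m : SCk m extrinsic.
Proof.
move=> c ac; have oc := @codom_open _ _ c.
have wn u : chart_codom c u -> (area c \o chart_inv c) u != 0.
  by move=> /chart_invP[du _]; exact: area_neq0.
have H := CkM oc (Ck_det3 oc (fun k => normal_C m k ac) (fun k => nabla_normal_C m 0 k ac)
  (fun k => nabla_normal_C m 1 k ac)) (CkV oc wn (area_C m ac)).
apply: (Ck_eq oc _ H) => u cu; have [du ue] := chart_invP cu.
have w0 := area_neq0 ac du.
exact: (etrans (congr1 (fun x => x / _) (extrinsic_area ac du)) (mulfK w0 _)).
Qed.

Lemma half_gap_C m : SCk m half_gap.
Proof.
move=> c ac; have oc := @codom_open _ _ c.
apply: (Ck_sqrt oc _ (CkB oc (Ck_cst m _ (f ^+ 2)) (extrinsic_C m ac))) => u cu.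
by have := half_gap_gt0 (chart_inv c u); rewrite sqrtr_gt0.
Qed.

Lemma curvature_C m : SCk m curvature.
Proof.
move=> c ac; have oc := @codom_open _ _ c.
exact: (CkB oc (CkD oc (extrinsic_C m ac) (CkM oc (Ck_cst m _ 2)
  (CkX 2 oc (normal_C m ord_max ac)))) (Ck_cst m _ 1)).
Qed.

Lemma curvature_ge0 p : 0 <= curvature p.
Proof.
rewrite /curvature addrAC addr_ge0 ?subr_ge0 ?extrinsic_ge1 //.
by rewrite mulr_ge0 // sqr_ge0.
Qed.

(* [half_gap] is half the difference of the principal curvatures, so that
   [f + half_gap] is the larger one. *)
Definition principal c p (v : 'I_3 -> R) : Prop := exists a0 a1, forall k,
  v k = a0 * tangent c 0 k p + a1 * tangent c 1 k p /\
  - (a0 * nabla_normal c 0 k p + a1 * nabla_normal c 1 k p) = (f + half_gap p) * v k.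

(** Replacing a tangent vector in [area] by the combination multiplies the determinant by the
    corresponding coefficient, and the new determinant has a zero row. *)
Lemma tangent_independent c p (x y : R) : atlas c -> chart_dom c p ->
  (forall k, x * tangent c 0 k p + y * tangent c 1 k p = 0) -> x = 0 /\ y = 0.
Proof.
move=> ac dp H; have w0 := area_neq0 ac dp.
have alg1 (n0 n1 n2 a0 a1 a2 b0 b1 b2 s t : R) :
  s * det3 n0 n1 n2 a0 a1 a2 b0 b1 b2 = det3 n0 n1 n2 (s * a0 + t * b0)
    (s * a1 + t * b1) (s * a2 + t * b2) b0 b1 b2 by rewrite /det3; ring.
have alg2 (n0 n1 n2 a0 a1 a2 b0 b1 b2 s t : R) :
  t * det3 n0 n1 n2 a0 a1 a2 b0 b1 b2 = det3 n0 n1 n2 a0 a1 a2 (s * a0 + t * b0)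
    (s * a1 + t * b1) (s * a2 + t * b2) by rewrite /det3; ring.
have z1 (n0 n1 n2 b0 b1 b2 : R) : det3 n0 n1 n2 0 0 0 b0 b1 b2 = 0 by rewrite /det3; ring.
have z2 (n0 n1 n2 b0 b1 b2 : R) : det3 n0 n1 n2 b0 b1 b2 0 0 0 = 0 by rewrite /det3; ring.
split; apply: (mulIf w0); rewrite mul0r /area.
  by rewrite (alg1 _ _ _ _ _ _ _ _ _ x y) !H z1.
by rewrite (alg2 _ _ _ _ _ _ _ _ _ x y) !H z2.
Qed.

Lemma principal_coordinates c p (v : 'I_3 -> R) : atlas c -> chart_dom c p ->
  principal c p v -> exists a0 a1,
  [/\ forall k, v k = a0 * tangent c 0 k p + a1 * tangent c 1 k p,
      a0 * A c p 0 0 + a1 * A c p 1 0 = (f + half_gap p) * a0 &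
      a0 * A c p 0 1 + a1 * A c p 1 1 = (f + half_gap p) * a1].
Proof.
move=> ac dp [a0 [a1 H]]; exists a0, a1.
have H1 k := (H k).1; have H2 k := (H k).2.
have [E1 E2] := @tangent_independent c p
  (a0 * A c p 0 0 + a1 * A c p 1 0 - (f + half_gap p) * a0)
  (a0 * A c p 0 1 + a1 * A c p 1 1 - (f + half_gap p) * a1) ac dp
  (fun k => ltac:(have h := H2 k; rewrite (H1 k) in h;
     rewrite -[nabla_normal c 0 k p]opprK -[nabla_normal c 1 k p]opprK
       -!(shape_frame _ k ac dp) in h;
     move: (tangent c 0 k p) (tangent c 1 k p) h => s t h;
     apply/eqP; rewrite -subr_eq0 subr0; apply/eqP;
     transitivity ((f + half_gap p) * (a0 * s + a1 * t) -
       (f + half_gap p) * (a0 * s + a1 * t)); [rewrite -{1}h; ring|ring])).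
by split => //; apply/eqP; rewrite -subr_eq0; apply/eqP.
Qed.

(** Two independent eigenvectors would make [A] the multiple [f + half_gap p] of the identity, of
    trace larger than [2 * f]. *)
Lemma principal_parallel c p (v v' : 'I_3 -> R) : atlas c -> chart_dom c p ->
  principal c p v -> principal c p v' -> forall k l, v k * v' l = v l * v' k.
Proof.
move=> ac dp /(principal_coordinates ac dp)[a0 [a1 [Hv e1 e2]]].
move=> /(principal_coordinates ac dp)[b0 [b1 [Hv' e1' e2']]].
have s0 := half_gap_gt0 p; have tr := shape_trace ac dp.
suff D : a0 * b1 = a1 * b0.
  move=> k l; rewrite !Hv !Hv'.
  move: (tangent c 0 k p) (tangent c 1 k p) (tangent c 0 l p) (tangent c 1 l p) => x y z t.
  apply/eqP; rewrite -subr_eq0; apply/eqP.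
  transitivity ((a0 * b1 - a1 * b0) * (x * t - y * z)); first by ring.
  by rewrite D subrr mul0r.
apply/eqP; rewrite -subr_eq0; apply/negPn/negP => D0.
have h1 : A c p 0 0 = f + half_gap p.
  apply: (mulIf D0); transitivity (b1 * (a0 * A c p 0 0 + a1 * A c p 1 0)
    - a1 * (b0 * A c p 0 0 + b1 * A c p 1 0)); first by ring.
  by rewrite e1 e1'; ring.
have h2 : A c p 1 1 = f + half_gap p.
  apply: (mulIf D0); transitivity (a0 * (b0 * A c p 0 1 + b1 * A c p 1 1)
    - b0 * (a0 * A c p 0 1 + a1 * A c p 1 1)); first by ring.
  by rewrite e2 e2'; ring.
by move: tr; rewrite h1 h2; lra.
Qed.

Definition dotn (v v' : 'I_3 -> R) : R :=
  dot3 (v 0) (v 1) (v ord_max) (v' 0) (v' 1) (v' ord_max).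

(** Unit vectors on one line agree up to sign, so their tensor squares coincide; multiplying by the
    squared norms avoids distinguishing the signs. *)
Lemma principal_unique c p (v v' : 'I_3 -> R) : atlas c -> chart_dom c p ->
  principal c p v -> principal c p v' -> dotn v v = 1 -> dotn v' v' = 1 ->
  forall k l, v k * v l = v' k * v' l.
Proof.
move=> ac dp P P' u u' k l; have X := principal_parallel ac dp P P'.
transitivity (v k * v l * dotn v' v'); first by rewrite u' mulr1.
transitivity (v' k * v' l * dotn v v); last by rewrite u mulr1.
rewrite /dotn /dot3.
transitivity ((v k * v' 0) * (v l * v' 0) + (v k * v' 1) * (v l * v' 1)
  + (v k * v' ord_max) * (v l * v' ord_max)); first by ring.
by rewrite !(X k) !(X l); ring.
Qed.

Definition candidate c i k p : R :=
  - nabla_normal c i k p + (half_gap p - f) * tangent c i k p.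

Lemma candidate_C m c i k : atlas c ->
  Ck m (chart_codom c) (fun u => candidate c i k (chart_inv c u)).
Proof.
move=> ac; have oc := @codom_open _ _ c.
exact: (CkD oc (CkN oc (nabla_normal_C m i k ac))
  (CkM oc (CkB oc (half_gap_C m ac) (Ck_cst m _ f)) (tangent_C m i k ac))).
Qed.

(* By Cayley-Hamilton the rows of [A - (f - half_gap)] are eigenvectors for
   [f + half_gap]. *)
Lemma candidate_principal c p i (t : R) : atlas c -> chart_dom c p ->
  principal c p (fun k => candidate c i k p * t).
Proof.
move=> ac dp; have tr := shape_trace ac dp; have dt := shape_det ac dp.
have sq := half_gap_sq p.
have sf j k := shape_frame j k ac dp.
have C k : candidate c i k p = A c p i 0 * tangent c 0 k p + A c p i 1 * tangent c 1 k p
    + (half_gap p - f) * tangent c i k p by rewrite /candidate -sf.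
have N' j k : nabla_normal c j k p =
    - (A c p j 0 * tangent c 0 k p + A c p j 1 * tangent c 1 k p) by rewrite sf opprK.
have e3 : extrinsic p = f ^+ 2 - half_gap p ^+ 2 by rewrite sq; ring.
rewrite e3 in dt.
have a11 : A c p 1 1 = 2 * f - A c p 0 0 by rewrite -tr; ring.
have bc : A c p 0 1 * A c p 1 0 =
    A c p 0 0 * (2 * f - A c p 0 0) - (f ^+ 2 - half_gap p ^+ 2) by rewrite -dt a11; ring.
have alg (x y g h a b cc s : R) : b * cc = a * (2 * g - a) - (g ^+ 2 - h ^+ 2) ->
    x = a * (a + (h - g)) + b * cc - (g + h) * (a + (h - g)) ->
    y = s -> x = 0.
  by move=> -> -> _; ring.
have bc' := bc; rewrite mulrC in bc'.
move: i C; apply: ord2P => C.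
- exists (t * (A c p 0 0 + (half_gap p - f))), (t * A c p 0 1) => k; rewrite C !N' a11.
  move: (tangent c 0 k p) (tangent c 1 k p) (A c p 0 0) (A c p 0 1) (A c p 1 0) (half_gap p)
    bc => x y a b b' h bc; split; first by ring.
  apply/eqP; rewrite -subr_eq0; apply/eqP.
  transitivity (t * x * (b * b' - (a * (2 * f - a) - (f ^+ 2 - h ^+ 2)))); first by ring.
  by rewrite bc subrr mulr0.
- exists (t * A c p 1 0), (t * (A c p 1 1 + (half_gap p - f))) => k; rewrite C !N' a11.
  move: (tangent c 0 k p) (tangent c 1 k p) (A c p 0 0) (A c p 0 1) (A c p 1 0) (half_gap p)
    bc => x y a b b' h bc; split; first by ring.
  apply/eqP; rewrite -subr_eq0; apply/eqP.
  transitivity (t * y * (b * b' - (a * (2 * f - a) - (f ^+ 2 - h ^+ 2)))); first by ring.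
  by rewrite bc subrr mulr0.
Qed.

(** If both rows vanished, [A] would be the multiple [f - half_gap p] of the identity, of trace
    smaller than [2 * f]. *)
Lemma candidate_neq0 c p : atlas c -> chart_dom c p -> exists i,
  0 < dotn (candidate c i ^~ p) (candidate c i ^~ p).
Proof.
move=> ac dp; have sf j k := shape_frame j k ac dp.
have dot_ge0 (v : 'I_3 -> R) : 0 <= dotn v v.
  by rewrite /dotn /dot3 -!expr2 !addr_ge0 ?sqr_ge0.
have dot0 (v : 'I_3 -> R) : dotn v v <= 0 -> forall k, v k = 0.
  rewrite /dotn /dot3 -!expr2 => h.
  have h0 := sqr_ge0 (v 0); have h1 := sqr_ge0 (v 1); have h2 := sqr_ge0 (v ord_max).
  by apply: ord3P; apply/eqP; rewrite -sqrf_eq0; apply/eqP; lra.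
have pos (v : 'I_3 -> R) : 0 < dotn v v \/ forall k, v k = 0.
  by have [h|h] := ltP 0 (dotn v v); [left|right; exact: dot0].
have [h|z0] := pos (candidate c 0 ^~ p); first by exists 0.
have [h|z1] := pos (candidate c 1 ^~ p); first by exists 1.
have [e1 _] := @tangent_independent c p (A c p 0 0 + (half_gap p - f)) (A c p 0 1) ac dp
  (fun k => ltac:(rewrite -(z0 k) /candidate -sf; ring)).
have [_ e2] := @tangent_independent c p (A c p 1 0) (A c p 1 1 + (half_gap p - f)) ac dp
  (fun k => ltac:(rewrite -(z1 k) /candidate -sf; ring)).
have s0 := half_gap_gt0 p; have := addr_gt0 s0 s0.
have -> : half_gap p + half_gap p = 0; last by rewrite ltxx.
transitivity (A c p 0 0 + (half_gap p - f) + (A c p 1 1 + (half_gap p - f))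
  - (A c p 0 0 + A c p 1 1 - 2 * f)); first by ring.
by rewrite e1 e2 (shape_trace ac dp) subrr !addr0 subr0.
Qed.

Lemma chart_partial_change c d F p i : atlas c -> atlas d -> chart_dom c p -> chart_dom d p ->
  SCk 1 F -> chart_partial c F i p =
    partial i (coord (transition c d) 0) (c p) * chart_partial d F 0 p
    + partial i (coord (transition c d) 1) (c p) * chart_partial d F 1 p.
Proof.
move=> ac ad cp dp CF; apply: (etrans (partial_transition i ac ad cp dp CF)).
by congr (_ + _); exact: mulrC.
Qed.

Lemma tangent_change c d p i k : atlas c -> atlas d -> chart_dom c p -> chart_dom d p ->
  tangent c i k p = partial i (coord (transition c d) 0) (c p) * tangent d 0 k p
    + partial i (coord (transition c d) 1) (c p) * tangent d 1 k p.
Proof.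
move=> ac ad cp dp; rewrite /tangent (chart_partial_change i ac ad cp dp (position_C 1 k)).
by rewrite mulrDr; congr (_ + _); exact: mulrCA.
Qed.

Lemma nabla_normal_change c d p i k : atlas c -> atlas d -> chart_dom c p -> chart_dom d p ->
  nabla_normal c i k p = partial i (coord (transition c d) 0) (c p) * nabla_normal d 0 k p
    + partial i (coord (transition c d) 1) (c p) * nabla_normal d 1 k p.
Proof.
move=> ac ad cp dp; rewrite /nabla_normal (chart_partial_change i ac ad cp dp (normal_C 1 k)).
rewrite !(tangent_change i _ ac ad cp dp).
move: (partial i (coord (transition c d) 0) (c p)) => J0.
move: (partial i (coord (transition c d) 1) (c p)) => J1.
move: (chart_partial d (normal k) 0 p) (chart_partial d (normal k) 1 p) => m0 m1.
move: (tangent d 0 0 p) (tangent d 0 1 p) (tangent d 1 0 p) (tangent d 1 1 p)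
  (normal 0 p) (normal 1 p) (normal ord_max p) => a b a' b' x y z.
move: k; apply: ord3P => /=; ring.
Qed.

Lemma area_change c d p : atlas c -> atlas d -> chart_dom c p -> chart_dom d p ->
  area c p = jac2 (transition c d) (c p) * area d p.
Proof.
move=> ac ad cp dp; rewrite {1}/area !(tangent_change _ _ ac ad cp dp).
exact: det3_combination.
Qed.

Lemma principal_change c d p v : atlas c -> atlas d -> chart_dom c p -> chart_dom d p ->
  principal d p v -> principal c p v.
Proof.
move=> ac ad cp dp [a0 [a1 H]].
pose J i j := partial i (coord (transition d c) j) (d p).
have T i k : tangent d i k p = J i 0 * tangent c 0 k p + J i 1 * tangent c 1 k p.
  exact: (tangent_change i k ad ac dp cp).
have N' i k : nabla_normal d i k p =
    J i 0 * nabla_normal c 0 k p + J i 1 * nabla_normal c 1 k p.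
  exact: (nabla_normal_change i k ad ac dp cp).
clearbody J; exists (a0 * J 0 0 + a1 * J 1 0), (a0 * J 0 1 + a1 * J 1 1) => k.
have [h0 e1] := H k; rewrite -e1 h0 !T !N'; split.
  by move: (tangent c 0 k p) (tangent c 1 k p) => x y; ring.
by move: (nabla_normal c 0 k p) (nabla_normal c 1 k p) => x y; ring.
Qed.

(** The vectors are chosen point by point, with arbitrary signs; only the products of their
    components are used as functions on the surface. *)
Lemma principal_field : exists E : S -> 'I_3 -> R, forall q, dotn (E q) (E q) = 1 /\
  forall c, atlas c -> chart_dom c q -> principal c q (E q).
Proof.
suff H q : exists v : 'I_3 -> R, dotn v v = 1 /\
    forall c, atlas c -> chart_dom c q -> principal c q v by have [E HE] := choice H; exists E.
have [c ac dq] := atlas_cover q; have [i] := candidate_neq0 ac dq.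
set D := dotn _ _ => D0; pose t := (Num.sqrt D)^-1.
exists (fun k => candidate c i k q * t); split.
  have E : t * t * D = 1.
    by rewrite -expr2 exprVn sqr_sqrtr ?mulVf ?gt_eqF // ltW.
  by rewrite -E /D /dotn /dot3; ring.
move=> d ad; move=> dq'; apply: (principal_change ad ac dq' dq).
exact: candidate_principal.
Qed.

Lemma principal_orthogonal c p v : atlas c -> chart_dom c p -> principal c p v ->
  dotn v (normal ^~ p) = 0.
Proof.
move=> ac dp [a0 [a1 H]]; have H1 k := (H k).1.
rewrite /dotn !H1 dot3_combination (tangent_orthogonal 0 ac dp).
by rewrite (tangent_orthogonal 1 ac dp) !mulr0 addr0.
Qed.

(** * The connection form of the principal line field *)

Section PrincipalField.
Context (E : S -> 'I_3 -> R) (E_unit : forall q, dotn (E q) (E q) = 1).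
Context (E_principal : forall q c, atlas c -> chart_dom c q -> principal c q (E q)).

(** A candidate that is nonzero at [u] remains so nearby, where dividing it by its norm gives a
    regular unit eigenvector; uniqueness of the eigenline identifies its tensor square with that of
    [E]. *)
Lemma principal_lift c u : atlas c -> chart_codom c u -> exists V (e : 'I_3 -> 'rV[R]_2 -> R),
  [/\ open V, V u, V `<=` chart_codom c, forall k, Ck 2 V (e k) & forall v, V v ->
   [/\ dotv e e v = 1, dotv e (fun k => normal k \o chart_inv c) v = 0 &
     forall k l, e k v * e l v = E (chart_inv c v) k * E (chart_inv c v) l]].
Proof.
move=> ac cu; have oc := @codom_open _ _ c; have [du ue] := chart_invP cu.
have [i D0] := candidate_neq0 ac du.
pose a k v := candidate c i k (chart_inv c v).
have Ca k : Ck 2 (chart_codom c) (a k) by exact: candidate_C.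
have CD : Ck 2 (chart_codom c) (dotv a a).
  exact: (CkD oc (CkD oc (CkM oc (Ca 0) (Ca 0)) (CkM oc (Ca 1) (Ca 1)))
    (CkM oc (Ca ord_max) (Ca ord_max))).
pose V := [set v | chart_codom c v /\ 0 < dotv a a v].
have oV : open V by exact: (Ck_open_pos oc CD).
have Vc : V `<=` chart_codom c by move=> v [].
have s0 v : V v -> 0 < Num.sqrt (dotv a a v) by move=> [_ h]; rewrite sqrtr_gt0.
exists V, (fun k v => a k v * (Num.sqrt (dotv a a v))^-1); split=> //.
  move=> k; apply: (CkM oV (Ck_subset Vc (Ca k))); apply: (CkV oV).
    by move=> v /s0 h; rewrite gt_eqF.
  apply: (Ck_sqrt oV _ (Ck_subset Vc CD)); by move=> v [].
move=> v Vv; have [cv h] := Vv; have [dv ve] := chart_invP cv.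
have P := @candidate_principal c (chart_inv c v) i (Num.sqrt (dotv a a v))^-1 ac dv.
have U : dotv (fun k v => a k v * (Num.sqrt (dotv a a v))^-1)
    (fun k v => a k v * (Num.sqrt (dotv a a v))^-1) v = 1.
  have : (Num.sqrt (dotv a a v))^-1 ^+ 2 * dotv a a v = 1.
    by rewrite exprVn sqr_sqrtr ?mulVf ?gt_eqF // ltW.
  rewrite /dotv; set t := _^-1; rewrite /dot3 => <-; ring.
split; first exact: U.
  exact: principal_orthogonal ac dv P.
exact: principal_unique ac dv P (E_principal ac dv) U (E_unit _).
Qed.

Definition projector k l q : R := E q k * E q l.

Lemma projector_C k l : SCk 2 (projector k l).
Proof.
move=> c ac; apply: Ck_local => u cu.
have [V [e [oV Vu Vc Ce He]]] := principal_lift ac cu; exists V => //.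
apply: (Ck_eq oV _ (CkM oV (Ce k) (Ce l))) => v /He[_ _]; exact.
Qed.

(* For a local lift [e] of the line field this is [<D_i e, e x n>], written in
   terms of the globally defined [e (x) e]. *)
Definition rotation c i p : R := \sum_l
  detn (fun k => chart_partial c (projector k l) i) normal (projector ^~ l) p.

(** For a local lift [e] the sum in parentheses is [<nabla_i e, n x e>]. The terms added to
    [rotation] come from the connection of Sol_3; they do not contain [e], because [e] and [n] are
    orthonormal. The sign is the one for which the exterior derivative is [curvature] times
    [area]. *)
Definition connection_form c p i : R := - (rotation c i p
  + (tangent c i 1 p * normal 0 p + tangent c i 0 p * normal 1 p)).

Lemma rotation_C c i : atlas c ->
  Ck 1 (chart_codom c) (fun u => rotation c i (chart_inv c u)).
Proof.
move=> ac; have oc := @codom_open _ _ c; apply: (Ck_sum _ oc) => l _.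
exact: (Ck_det3 oc (fun k => chart_partial_C i ac (projector_C k l))
  (fun k => normal_C 1 k ac) (fun k => CkW (projector_C k l ac))).
Qed.

Lemma connection_form_C c i : atlas c ->
  Ck 1 (chart_codom c) (fun u => connection_form c (chart_inv c u) i).
Proof.
move=> ac; have oc := @codom_open _ _ c.
exact: (CkN oc (CkD oc (rotation_C i ac)
  (CkD oc (CkM oc (tangent_C 1 i 1 ac) (normal_C 1 0 ac))
    (CkM oc (tangent_C 1 i 0 ac) (normal_C 1 1 ac))))).
Qed.

Lemma rotation_change c d p i : atlas c -> atlas d -> chart_dom c p -> chart_dom d p ->
  rotation c i p = partial i (coord (transition c d) 0) (c p) * rotation d 0 p
    + partial i (coord (transition c d) 1) (c p) * rotation d 1 p.
Proof.
move=> ac ad cp dp; rewrite !mulr_sumr -big_split; apply: eq_bigr => l _ /=.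
have P k := chart_partial_change i ac ad cp dp (SCkW (projector_C k l)).
rewrite {1}/detn !P; exact: det3_combination_l.
Qed.

Lemma connection_form_change c d p i : atlas c -> atlas d -> chart_dom c p ->
  chart_dom d p -> connection_form c p i =
    partial i (coord (transition c d) 0) (c p) * connection_form d p 0
    + partial i (coord (transition c d) 1) (c p) * connection_form d p 1.
Proof.
move=> ac ad cp dp; rewrite /connection_form (rotation_change i ac ad cp dp).
rewrite !(tangent_change i _ ac ad cp dp).
move: (partial i (coord (transition c d) 0) (c p)) => J0.
move: (partial i (coord (transition c d) 1) (c p)) => J1.
move: (rotation d 0 p) (rotation d 1 p) => m0 m1.
move: (tangent d 0 0 p) (tangent d 0 1 p) (tangent d 1 0 p) (tangent d 1 1 p)
  (normal 0 p) (normal 1 p) => a b a' b' x y.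
ring.
Qed.

Lemma rotation_lift c V (e : 'I_3 -> 'rV[R]_2 -> R) v i : atlas c -> open V ->
  V `<=` chart_codom c -> V v -> (forall k, Ck 2 V (e k)) ->
  (forall v, V v -> dotv e e v = 1) ->
  (forall v k l, V v -> e k v * e l v = E (chart_inv c v) k * E (chart_inv c v) l) ->
  rotation c i (chart_inv c v) =
  detv (pv i e) (fun k => normal k \o chart_inv c) e v.
Proof.
move=> ac oV Vc Vv Ce ee eE; have [dv ve] := chart_invP (Vc v Vv).
have de k : differentiable (e k) v := Ck_differentiable (Ce k) Vv.
have P k l : chart_partial c (projector k l) i (chart_inv c v) =
    pv i e k v * e l v + e k v * pv i e l v.
  rewrite /chart_partial ve -(partialM i (de k) (de l)); apply: partial_near.
  by apply: filterS (open_nbhs_nbhs (conj oV Vv)) => t Vt; rewrite (eE t).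
rewrite /rotation sum3 /detn !P /projector -!(eE v _ _ Vv).
exact: (rotation_alg _ _ _ _ _ _ (ee v Vv)).
Qed.

(** The forms [tangent c _ k] are the pullbacks of the coframe [e^z dx], [e^-z dy], [dz], and
    [d (e^z dx) = dz /\ (e^z dx)], with the opposite sign for the second. *)
Lemma tangent_curl c p k : atlas c -> chart_dom c p ->
  partial 0 (fun u => tangent c 1 k (chart_inv c u)) (c p)
  - partial 1 (fun u => tangent c 0 k (chart_inv c u)) (c p) =
  frame_exp k * (tangent c 0 ord_max p * tangent c 1 k p
    - tangent c 1 ord_max p * tangent c 0 k p).
Proof.
move=> ac dp; have cp := chart_codom_map dp; have oc := @codom_open _ _ c.
have ip : chart_inv c (c p) = p by exact: chart_mapE.
pose X := position k \o chart_inv c; pose Z := position ord_max \o chart_inv c.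
have CX : Ck 2 (chart_codom c) X := position_C 2 k ac.
have dZ : differentiable Z (c p) := Ck_differentiable (position_C 1 ord_max ac) cp.
have dX j : differentiable (partial j X) (c p) := Ck_differentiable (Ck_partial j CX) cp.
have D i j : partial i (fun u => tangent c j k (chart_inv c u)) (c p) =
    frame_scale k p * (frame_exp k * chart_partial c (position ord_max) i p
      * chart_partial c (position k) j p + partial i (partial j X) (c p)).
  have P := partial_product_expR (frame_exp k) i (dX j) dZ.
  have Zp : Z (c p) = phi p 0 ord_max by rewrite /Z /= ip.
  rewrite Zp in P; apply: etrans P; apply: partial_near.
  apply: filterS (open_nbhs_nbhs (conj oc cp)) => u cu.
  by have [_ ue] := chart_invP cu; rewrite /tangent /chart_partial ue.
have Sch := schwarz oc CX cp.
have s2 : frame_scale ord_max p = 1 by rewrite /frame_scale mul0r expR0.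
rewrite !D Sch /tangent s2.
move: (partial 1 (partial 0 X) (c p)) => y.
move: (chart_partial c (position ord_max) 0 p) (chart_partial c (position ord_max) 1 p)
  (chart_partial c (position k) 0 p) (chart_partial c (position k) 1 p)
  (frame_scale k p) (frame_exp k) => a b a' b' g t.
ring.
Qed.

Lemma connection_form_partial c p i j : atlas c -> chart_dom c p ->
  partial i (fun u => connection_form c (chart_inv c u) j) (c p) =
  - (partial i (fun u => rotation c j (chart_inv c u)) (c p)
    + (partial i (fun u => tangent c j 1 (chart_inv c u)) (c p) * normal 0 p
      + tangent c j 1 p * chart_partial c (normal 0) i p
      + (partial i (fun u => tangent c j 0 (chart_inv c u)) (c p) * normal 1 p
      + tangent c j 0 p * chart_partial c (normal 1) i p))).
Proof.
move=> ac dp; have cp := chart_codom_map dp.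
have ip : chart_inv c (c p) = p by exact: chart_mapE.
have dr := Ck_differentiable (rotation_C j ac) cp.
have dt k : differentiable (fun u => tangent c j k (chart_inv c u)) (c p).
  exact: (Ck_differentiable (tangent_C 1 j k ac) cp).
have dn k : differentiable (normal k \o chart_inv c) (c p).
  exact: (Ck_differentiable (normal_C 1 k ac) cp).
have dM k l := differentiableM (dt k) (dn l).
have N0 := partialN i (differentiableD dr (differentiableD (dM 1 0) (dM 0 1))).
apply: (etrans N0); congr (- _).
apply: (etrans (partialD i dr (differentiableD (dM 1 0) (dM 0 1)))); congr (_ + _).
apply: (etrans (partialD i (dM 1 0) (dM 0 1))).
have PM k l : partial i (fun u => tangent c j k (chart_inv c u) * (normal l \o chart_inv c) u)
    (c p) = partial i (fun u => tangent c j k (chart_inv c u)) (c p) * normal l p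
      + tangent c j k p * chart_partial c (normal l) i p.
  by have := partialM i (dt k) (dn l); rewrite /= ip.
by congr (_ + _); exact: PM.
Qed.

(** Derivatives depend on germs only, so a regular local lift may replace the projectors. *)
Lemma rotation_curl c p : atlas c -> chart_dom c p ->
  partial 0 (fun u => rotation c 1 (chart_inv c u)) (c p)
  - partial 1 (fun u => rotation c 0 (chart_inv c u)) (c p) =
  - detn normal (fun k => chart_partial c (normal k) 0) (fun k => chart_partial c (normal k) 1) p.
Proof.
move=> ac dp; have cp := chart_codom_map dp.
have [V [e [oV Vu Vc Ce He]]] := principal_lift ac cp.
pose n k := normal k \o chart_inv c.
have ee v : V v -> dotv e e v = 1 by case/He.
have en v : V v -> dotv e n v = 0 by case/He.
have eE v k l : V v -> e k v * e l v = E (chart_inv c v) k * E (chart_inv c v) l.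
  by case/He=> _ _; exact.
have nn v : V v -> dotv n n v = 1 by move=> _; exact: normal_norm.
have Cn k : Ck 2 V (n k) := Ck_subset Vc (normal_C 2 k ac).
have RE i j : partial i (fun u => rotation c j (chart_inv c u)) (c p) =
    partial i (detv (pv j e) n e) (c p).
  apply: partial_near; apply: filterS (open_nbhs_nbhs (conj oV Vu)) => v Vv.
  exact: (rotation_lift j ac oV Vc Vv Ce ee eE).
rewrite !RE (line_field_curl oV Vu Ce Cn ee nn en).
by rewrite /detv /detn /n /= chart_mapE.
Qed.

(** The Gauss equation: [rotation_curl] gives the curvature of the spherical image of the frame
    components of the normal, and [gauss_alg] turns it, together with the curl of the correction
    terms, into [det A] plus the ambient sectional curvature. *)
Lemma connection_form_curl c p : atlas c -> chart_dom c p ->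
  partial 0 (fun u => connection_form c (chart_inv c u) 1) (c p)
  - partial 1 (fun u => connection_form c (chart_inv c u) 0) (c p) =
  curvature p * area c p.
Proof.
move=> ac dp; have cp := chart_codom_map dp; have oc := @codom_open _ _ c.
have ip : chart_inv c (c p) = p by exact: chart_mapE.
rewrite !(connection_form_partial _ _ ac dp).
have RC := rotation_curl ac dp.
have TC k := tangent_curl k ac dp.
have nu := normal_norm p.
have [w0 w1 w2] := cross_normal nu (tangent_orthogonal 0 ac dp) (tangent_orthogonal 1 ac dp).
pose n k := normal k \o chart_inv c.
have nn v : chart_codom c v -> dotv n n v = 1 by move=> _; exact: normal_norm.
have dn k : differentiable (n k) (c p) := Ck_differentiable (normal_C 1 k ac) cp.
have mn i : dot3 (chart_partial c (normal 0) i p) (chart_partial c (normal 1) i p)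
    (chart_partial c (normal ord_max) i p) (normal 0 p) (normal 1 p) (normal ord_max p) = 0.
  by rewrite -(partial_unit_orthogonal i oc cp nn dn) /dotv /n /= ip.
have G := gauss_alg nu (mn 0) (mn 1) w0 w1 w2.
have s2 i : nabla_normal c i ord_max p = chart_partial c (normal ord_max) i p
    - tangent c i 0 p * normal 0 p + tangent c i 1 p * normal 1 p.
  exact: addrA.
have X := extrinsic_area ac dp; rewrite /detn !s2 in X.
have KE : curvature p * area c p =
    extrinsic p * area c p + (2 * normal ord_max p ^+ 2 - 1) * area c p.
  by rewrite -mulrDl addrA.
rewrite KE -X; apply: etrans G.
have f0 : frame_exp 0 = 1 by []. have f1 : frame_exp 1 = -1 by [].
(* The curls of the first two coframe forms are, in exchanged order, the first two components of the
   cross product of the tangent vectors, which is how they occur in [gauss_alg]. *)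
have T0 := TC 0; have T1 := TC 1; rewrite f0 mul1r in T0; rewrite f1 mulN1r in T1.
rewrite /detn in RC.
move: (partial 0 (fun u => rotation c 1 (chart_inv c u)) (c p))
  (partial 1 (fun u => rotation c 0 (chart_inv c u)) (c p))
  (partial 0 (fun u => tangent c 1 1 (chart_inv c u)) (c p))
  (partial 1 (fun u => tangent c 0 1 (chart_inv c u)) (c p))
  (partial 0 (fun u => tangent c 1 0 (chart_inv c u)) (c p))
  (partial 1 (fun u => tangent c 0 0 (chart_inv c u)) (c p)) RC T0 T1 {TC KE X w0 w1 w2 s2}
  => r1 r0 t01 t10 t00 t11 RC T0 T1.
move: RC T0 T1; set D := det3 _ _ _ _ _ _ _ _ _; clearbody D.
move: (chart_partial c (normal 0) 0 p) (chart_partial c (normal 0) 1 p)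
  (chart_partial c (normal 1) 0 p) (chart_partial c (normal 1) 1 p) => m0 l0 m1 l1.
move: (normal 0 p) (normal 1 p) => n0 n1.
move: (tangent c 0 0 p) (tangent c 0 1 p) (tangent c 0 ord_max p)
  (tangent c 1 0 p) (tangent c 1 1 p) (tangent c 1 ord_max p) => a0 a1 a2 b0 b1 b2.
move=> RC T0 T1.
have -> : D = - (r1 - r0) by rewrite RC opprK.
have -> : a1 * b2 - a2 * b1 = t01 - t10 by rewrite T1; ring.
have -> : a2 * b0 - a0 * b2 = t00 - t11 by rewrite T0; ring.
ring.
Qed.

End PrincipalField.

(** * Vanishing of the curvature and contradiction at a highest point *)

Context (cS : compact [set: S]).

Lemma curvature_eq0 q : curvature q = 0.
Proof.
have [E HE] := principal_field.
have Eu p : dotn (E p) (E p) = 1 := (HE p).1.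
have Ep p c : atlas c -> chart_dom c p -> principal c p (E p) := (HE p).2 c.
apply: (stokes_eq0 cS (area_C 1) area_neq0 area_change (eta := connection_form E)
  _ _ (curvature_C 1) curvature_ge0 _ q).
- by move=> c i ac; exact: (connection_form_C Eu Ep).
- by move=> c d p i ac ad; exact: (connection_form_change Eu Ep).
- by move=> c p; exact: (connection_form_curl Eu Ep).
Qed.

Lemma no_surface : False.
Proof.
have [p0 _] := surface_nonempty S.
have cz : continuous (position ord_max) := SCk_continuous (position_C 0 ord_max).
have [p _ pmax] := compact_EVT_max (ex_intro _ p0 I) cS (continuous_subspaceT cz).
have [c ac dp] := atlas_cover p; have cp := chart_codom_map dp.
have ip : chart_inv c (c p) = p by exact: chart_mapE.
have dz v : chart_codom c v -> differentiable (position ord_max \o chart_inv c) v.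
  by move=> cv; exact: (Ck_differentiable (position_C 1 ord_max ac) cv).
have t2 i : tangent c i ord_max p = 0.
  rewrite /tangent /chart_partial (partial_at_max i (@codom_open _ _ c) cp dz) ?mulr0 //.
  by move=> v _ /=; rewrite ip pmax // in_setT.
have [w0 w1 _] := cross_normal (normal_norm p) (tangent_orthogonal 0 ac dp)
  (tangent_orthogonal 1 ac dp).
have W := area_neq0 ac dp.
have n0 : normal 0 p = 0.
  by apply: (mulfI W); rewrite mulr0; apply: (etrans (esym w0)); rewrite !t2 mulr0 mul0r subrr.
have n1 : normal 1 p = 0.
  by apply: (mulfI W); rewrite mulr0; apply: (etrans (esym w1)); rewrite !t2 mulr0 mul0r subrr.
have := normal_norm p; rewrite n0 n1 /dot3 !mul0r !add0r -expr2 => n2.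
have := curvature_eq0 p; rewrite /curvature n2; have := extrinsic_ge1 p.
move=> k1 /eqP; rewrite mulr1 gt_eqF // subr_gt0.
by rewrite (le_lt_trans k1) // ltrDl.
Qed.

End FrameData.

Unset Implicit Arguments.

Theorem theorem4p1 (R : realType) :
  ~ exists (S : surface R) (h : chart R S -> S -> 'M[R]_2)
      (phi xi : S -> 'rV[R]_3) (A : chart R S -> S -> 'M[R]_2)
      (H normA2 : S -> R) (f : R),
    compact [set: S] /\
    is_riemannian_metric h /\
    isometric_immersion h phi /\
    unit_normal phi xi /\
    shape_operator phi xi A /\
    mean_curvature A H /\
    squared_norm A normA2 /\
    (forall p : S, H p = f) /\
    (forall p : S, 2 * f ^+ 2 + 2 <= normA2 p <= 4 * f ^+ 2 - 2).
Proof.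
move=> [S [h [phi [xi [A [H [N [f [cS [_ [im [un [sh [mc [sn [Hf bounds]]]]]]]]]]]]]]]].
have trA c p : atlas c -> chart_dom c p -> f = 2^-1 * \tr (A c p).
  by move=> ac dp; rewrite -(Hf p); exact: mc.
exact: (no_surface (immersion_smooth im) (normal_smooth un) (immersion_injective im)
  (normal_unit un) (normal_orthogonal un) sh trA sn bounds cS).
Qed.
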